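(* Let $K$ be a finite extension of $\mathbb{Q}_p$ with residue field $F$, and let $q=\#F$. Let $n\ge 4r+1$ and let $q^{(1)},\ldots,q^{(r)}\in K[x_1,\ldots,x_n]$ be quadratic forms. Then the forms $q^{(1)},\ldots,q^{(r)}$ have a non-trivial common zero in $K^n$ provided that $q\ge (2r)^r$. More specifically, they have a non-trivial common zero in $K^n$ whenever $q>n\ge 4r+1$ and $\sigma_1+\sigma_2<1$, where \[\sigma_1=q^{r-n}+\sum_{\lceil n/2r\rceil-1\le t\le n/2}q^{-t}\Big(\frac{q}{2t+1}\Big)^{[4rt/n]}(2t+1)^r\] and \[\sigma_2=\frac{1}{q-1}\sum_{\rho=2(\lceil n/2r\rceil-1)}^{n-1}\ \sum_{0\le t\le(n-\rho)/2}C_{\rho,t}\,q^{-\rho-t+[2r\rho/n]+[2r(\rho+2t)/n]},\] with \[C_{\rho,t}=(\rho+1)^{r-[2r\rho/n]}(2t+1)^{r-[2r(\rho+2t)/n]}.\]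
   Context: $[\theta]$ denotes the integer part (floor) of $\theta$, and $\lceil\theta\rceil=\min\{m\in\mathbb{Z}: m\ge\theta\}$. Sums over $t$ run over integers $t$ in the stated range. *)

(* Defs.v *)
From HB Require Import structures.
From mathcomp Require Import all_boot all_order all_algebra.
Set Implicit Arguments. Unset Strict Implicit. Unset Printing Implicit Defensive.
Import Order.TTheory GRing.Theory Num.Theory.
Local Open Scope ring_scope.

(* Non-archimedean local fields of characteristic 0 (= finite extensions   *)
(* of Q_p), described through a normalized-free discrete valuation         *)
(* v : K -> int (the value v 0 is irrelevant and never used).              *)

Definition discrete_valuation (K : fieldType) (v : K -> int) : Prop :=
  [/\ (forall x y : K, x != 0 -> y != 0 -> v (x * y) = v x + v y),
      (forall x y : K, x != 0 -> y != 0 -> x + y != 0 ->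
          Num.min (v x) (v y) <= v (x + y))
    & (exists x : K, (x != 0) && (v x != 0))].

Definition vsmall (K : fieldType) (v : K -> int) (N : int) (x : K) : Prop :=
  x = 0 \/ N <= v x.

Definition vcomplete (K : fieldType) (v : K -> int) : Prop :=
  forall u : nat -> K,
    (forall N : int, exists M : nat, forall m k : nat,
        (M <= m)%N -> (M <= k)%N -> vsmall v N (u m - u k)) ->
    exists l : K, forall N : int, exists M : nat, forall m : nat,
        (M <= m)%N -> vsmall v N (u m - l).

Definition in_vring (K : fieldType) (v : K -> int) (x : K) : Prop := vsmall v 0 x.
Definition in_vmax (K : fieldType) (v : K -> int) (x : K) : Prop := vsmall v 1 x.

Definition residue_card (K : fieldType) (v : K -> int) (q : nat) : Prop :=
  exists s : seq K,
    [/\ size s = q,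
        (forall i : nat, (i < q)%N -> in_vring v (nth 0 s i)),
        (forall i j : nat, (i < q)%N -> (j < q)%N -> i <> j ->
            ~ in_vmax v (nth 0 s i - nth 0 s j))
      & (forall x : K, in_vring v x ->
            exists2 i : nat, (i < q)%N & in_vmax v (x - nth 0 s i))].

(* K (with valuation v) is a finite extension of Q_p whose residue field has q
   elements: a field of characteristic 0, complete for a discrete valuation,
   with finite residue field of cardinality q. *)
Definition padic_field (K : fieldType) (v : K -> int) (q : nat) : Prop :=
  [/\ [pchar K] =i pred0, discrete_valuation v, vcomplete v & residue_card v q].

(* Every quadratic form is of this shape (e.g. with A upper triangular).   *)
Definition qform (K : fieldType) (n : nat) (A : 'M[K]_n) (x : 'I_n -> K) : K :=
  \sum_(i < n) \sum_(j < n) A i j * x i * x j.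

Definition common_nontrivial_zero (K : fieldType) (n r : nat)
    (Q : 'I_r -> 'M[K]_n) : Prop :=
  exists x : 'I_n -> K, (exists i : 'I_n, x i != 0) /\ forall k : 'I_r, qform (Q k) x = 0.

(* [theta] = floor, realised by %/ on naturals (all arguments are >= 0).   *)
Definition ceil_div (a b : nat) : nat := (a + b - 1) %/ b.  (* = ceil(a/b) for b > 0 *)

Definition sigma1 (q n r : nat) : rat :=
  (q%:R : rat) ^ (r%:Z - n%:Z) +
  \sum_((ceil_div n (2 * r)).-1 <= t < (n %/ 2).+1)
     (q%:R : rat) ^ (- t%:Z)
     * ((q%:R / (2 * t + 1)%:R : rat) ^+ ((4 * r * t) %/ n))
     * ((2 * t + 1)%:R : rat) ^+ r.

Definition Cconst (n r rho t : nat) : rat :=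
  ((rho + 1)%:R : rat) ^ (r%:Z - ((2 * r * rho) %/ n)%:Z)
  * ((2 * t + 1)%:R : rat) ^ (r%:Z - ((2 * r * (rho + 2 * t)) %/ n)%:Z).

Definition sigma2 (q n r : nat) : rat :=
  (q%:R - 1 : rat)^-1 *
  \sum_((2 * (ceil_div n (2 * r)).-1)%N <= rho < n)
    \sum_(0 <= t < ((n - rho) %/ 2).+1)
      Cconst n r rho t
      * (q%:R : rat) ^ (- rho%:Z - t%:Z + ((2 * r * rho) %/ n)%:Z
                         + ((2 * r * (rho + 2 * t)) %/ n)%:Z).

(* Main.v *)
(* Fix a system without nontrivial zero, and argue by induction on the number of forms. Among the
   changes of variables [T] and of basis of forms [U] keeping the system integral, the weight
   [2 r v(det T) + n v(det U)] is bounded below: by compactness primitive vectors are not common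
   zeros modulo a fixed power of the uniformizer, and smaller systems have zeros. At a minimum of
   the weight the reduction over the residue field is semistable: if an [s]-dimensional space of
   forms vanishes on a subspace of codimension [m], then [n s <= 2 r m]. It suffices to find a
   nonsingular zero of the reduction, since it lifts by Hensel's lemma.

   Over the residue field the number of zeros is a sum over the forms [c.Q] of the system, in which
   a form of even rank [2 t] contributes at most [q ^ (n - r - t)]. A singular zero lies in the
   radical of some [c.Q] with [c <> 0], and the zeros in this radical are counted in the same way.
   The number of forms of given rank is bounded by a Bezout argument: the minors of size [rho + 1]
   (in characteristic 2, the Pfaffians, written as hafnians) vanish on the forms of rank at most
   [rho], and their differentials at [c] cut out the forms vanishing on the radical of [c.Q], a space
   whose dimension is at most [2 r rho / n] by semistability. *)

Require Import Defs.
From HB Require Import structures.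
From Stdlib Require Import Classical IndefiniteDescription.
From mathcomp Require Import all_boot all_order all_algebra all_fingroup.
From mathcomp Require Import cyclic finfield mpoly zify ring lra.
Set Implicit Arguments. Unset Strict Implicit. Unset Printing Implicit Defensive.
Import Order.TTheory GRing.Theory Num.Theory.
Local Open Scope ring_scope.

(** * A Bezout bound for point counts over a finite field *)

(** The weight is unchanged when [T] is multiplied by a uniformizer and [U] by its inverse square,
    which fixes the proportion of its two coefficients. Its lower bound uses zeros of the smaller
    systems with [n1 / r1 > n / r]. Every pair met in the induction thus has a ratio at least the
    original one, and the sums do not increase under such a replacement, so that one numerical
    hypothesis serves for all of them.

    The Bezout bound concerns rational points only: the equations [x_i ^ q = x_i] supply the missing
    parameters, of degree [q], and linear independence of polynomials takes the place of
    intersection theory.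

    The obstacle is characteristic 2, where a quadratic form is not determined by its polar form:
    the polar rank may be smaller than the codimension of the space that carries the singular zeros,
    and more forms can then be tangent to the stratum. Hafnians, of about half the degree of the
    minors, compensate for this loss, and the same sum bounds the singular zeros in every
    characteristic. *)

Section DegreeBound.
Variables (R : idomainType) (r : nat).
Implicit Types f g : {mpoly R[r]}.

(** [msize] is the degree plus one, and 0 for the zero polynomial, which therefore satisfies every
    bound. *)
Definition degle d f := (msize f <= d.+1)%N.

Lemma degleW d e f : (d <= e)%N -> degle d f -> degle e f.
Proof. by move=> de fd; apply: leq_trans fd _. Qed.

Lemma degleC d c : degle d (c%:MP : {mpoly R[r]}).
Proof. by rewrite /degle msizeC; case: (c != 0). Qed.

Lemma degle1 d : degle d (1 : {mpoly R[r]}).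
Proof. exact: degleC. Qed.

Lemma degleX i : degle 1 ('X_i : {mpoly R[r]}).
Proof. by rewrite /degle msizeX mdeg1. Qed.

Lemma degleZ d c f : degle d f -> degle d (c *: f).
Proof. by move=> fd; apply: leq_trans (msizeZ_le _ _) fd. Qed.

Lemma degleD d f g : degle d f -> degle d g -> degle d (f + g).
Proof.
move=> fd gd; apply: leq_trans (msizeD_le _ _) _.
by rewrite geq_max; apply/andP.
Qed.

Lemma degleN d f : degle d f -> degle d (- f).
Proof. by rewrite /degle msizeN. Qed.

Lemma degle_sum d (I : Type) (s : seq I) (P : pred I) (h : I -> {mpoly R[r]}) :
  (forall i, P i -> degle d (h i)) -> degle d (\sum_(i <- s | P i) h i).
Proof.
move=> hd; elim/big_rec: _ => [|i f Pi fd]; first by rewrite /degle msize0.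
exact: degleD (hd i Pi) fd.
Qed.

Lemma degleM d e f g : degle d f -> degle e g -> degle (d + e) (f * g).
Proof.
rewrite /degle; have [->|f0] := eqVneq f 0; first by rewrite mul0r msize0.
have [->|g0] := eqVneq g 0; first by rewrite mulr0 msize0.
rewrite msizeM //; move: (msize f) (msize g) => a b fd ge; lia.
Qed.

Lemma degle_prod (I : Type) (s : seq I) (h : I -> {mpoly R[r]}) (e : I -> nat) :
  (forall i, degle (e i) (h i)) ->
  degle (\sum_(i <- s) e i)%N (\prod_(i <- s) h i).
Proof.
move=> hd; elim: s => [|i s IH]; first by rewrite !big_nil degle1.
by rewrite !big_cons; apply: degleM.
Qed.

Lemma degleXn d f k : degle d f -> degle (d * k) (f ^+ k).
Proof.
move=> fd; elim: k => [|k IH]; first by rewrite muln0 expr0 degle1.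
by rewrite mulnS exprS; apply: degleM.
Qed.

End DegreeBound.

Lemma nontrivial_relation (F : fieldType) (I J : finType) (a : I -> J -> F) :
  (#|J| < #|I|)%N ->
  exists2 lam : I -> F, exists i, lam i != 0 &
    forall j, \sum_i lam i * a i j = 0.
Proof.
move=> ltJI.
pose A : 'M[F]_(#|I|, #|J|) := \matrix_(i, j) a (enum_val i) (enum_val j).
have: kermx A != 0.
  rewrite -mxrank_eq0 mxrank_ker -lt0n subn_gt0.
  exact: leq_ltn_trans (rank_leq_col A) ltJI.
case/rowV0Pn=> x /sub_kermxP xA x0.
exists (fun i => x 0 (enum_rank i)).
  case/rV0Pn: x0 => k xk; exists (enum_val k); by rewrite enum_valK.
move=> j; have /(congr1 (fun M : 'rV_#|J| => M 0 (enum_rank j))) := xA.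
rewrite !mxE => xAj; rewrite -[RHS]xAj (reindex_onto enum_val enum_rank) /=.
  under [RHS]eq_bigr => k _ do rewrite mxE enum_rankK.
  by apply: eq_big => k; rewrite ?enum_valK ?eqxx.
by move=> k _; rewrite enum_rankK.
Qed.

(* [f(P + T u)], expanded in powers of the new variable [T]. *)
HB.lock Definition evline (F : finFieldType) (r : nat) (P : 'rV[F]_r)
    (u : 'I_r -> {mpoly F[r]}) : {mpoly F[r]} -> {poly {mpoly F[r]}} :=
  mmap (polyC \o @mpolyC r F) (fun i => (P 0 i)%:MP%:P + u i *: 'X).

Section Evaluation.
Variables (F : finFieldType) (r : nat).
Local Notation B := {mpoly F[r]}.
Implicit Types (P : 'rV[F]_r) (u : 'I_r -> B) (f g : B).

Lemma evline_is_zmod_morphism P u : zmod_morphism (evline P u).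
Proof. by move=> f g; rewrite unlock raddfB. Qed.

Lemma evline_is_monoid_morphism P u : monoid_morphism (evline P u).
Proof. by rewrite unlock; split=> [|f g]; rewrite ?rmorph1 ?rmorphM. Qed.

HB.instance Definition _ P u := GRing.isZmodMorphism.Build B {poly B} (evline P u)
  (evline_is_zmod_morphism P u).
HB.instance Definition _ P u := GRing.isMonoidMorphism.Build B {poly B} (evline P u)
  (evline_is_monoid_morphism P u).

Lemma evlineB P u f g : evline P u (f - g) = evline P u f - evline P u g.
Proof. exact: evline_is_zmod_morphism. Qed.

Lemma evlineM P u f g : evline P u (f * g) = evline P u f * evline P u g.
Proof. exact: (evline_is_monoid_morphism P u).2. Qed.

Lemma evline1 P u : evline P u 1 = 1.
Proof. exact: (evline_is_monoid_morphism P u).1. Qed.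

Lemma evline_sum P u (I : Type) (s : seq I) (C : pred I) (h : I -> B) :
  evline P u (\sum_(i <- s | C i) h i) = \sum_(i <- s | C i) evline P u (h i).
Proof. exact: raddf_sum. Qed.

Lemma evlineXn P u f k : evline P u (f ^+ k) = evline P u f ^+ k.
Proof. by elim: k => [|k IH]; rewrite ?expr0 ?evline1 // !exprS evlineM IH. Qed.

Lemma evline_coef0 P u f : (evline P u f)`_0 = (f.@[fun i => P 0 i])%:MP.
Proof.
rewrite -horner_coef0 unlock /mmap mevalE horner_sum rmorph_sum /=.
apply: eq_bigr => m _; rewrite hornerM hornerC rmorphM /=; congr (_ * _).
rewrite /mmap1 horner_prod rmorph_prod; apply: eq_bigr => i _ /=.
by rewrite horner_exp rmorphXn /= !hornerE ?mulr0 ?addr0.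
Qed.

Lemma evlineX P u i : evline P u 'X_i = (P 0 i)%:MP%:P + u i *: 'X.
Proof. by rewrite unlock mmapX mmap1U. Qed.

Lemma evlineC P u c : evline P u c%:MP = c%:MP%:P.
Proof. by rewrite unlock mmapC. Qed.

(** [l] is the differential of [f] at [P]. Directions with polynomial entries are allowed because
    [bezout_count] moves away from [P] along a generic vector. *)
Definition has_lin P f (l : 'rV[F]_r) :=
  forall u, (evline P u f)`_1 = \sum_i l 0 i *: u i.

Lemma factorX (p : {poly B}) : p`_0 = 0 -> p = drop_poly 1 p * 'X.
Proof.
move=> p0; apply/polyP => -[|i]; first by rewrite coefMX p0.
by rewrite coefMX /= coef_drop_poly addn1.
Qed.

(** Along the line each [f i] is divisible by the new variable, so the product vanishes to order
    [mdeg b], and its term of that order is governed by the linear parts. *)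
Lemma evline_monomial P u g (f : 'I_r -> B) (b : 'X_{1..r}) :
  (forall i, (f i).@[fun i => P 0 i] = 0) ->
  let p := evline P u (g * \prod_i f i ^+ b i) in
  p`_(mdeg b) = (g.@[fun i => P 0 i])%:MP * \prod_i (evline P u (f i))`_1 ^+ b i
  /\ forall k, (k < mdeg b)%N -> p`_k = 0.
Proof.
move=> f0 p.
pose h i := drop_poly 1 (evline P u (f i)).
have hE i : evline P u (f i) = h i * 'X.
  by apply: factorX; rewrite evline_coef0 f0 mpolyC0.
have pE : p = evline P u g * (\prod_i h i ^+ b i) * 'X^(mdeg b).
  rewrite /p rmorphM rmorph_prod -mulrA; congr (_ * _).
  have -> : mdeg b = (\sum_i b i)%N by rewrite mdegE.
  rewrite -prodrXr -big_split /=; apply: eq_bigr => i _.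
  by rewrite rmorphXn /= hE exprMn.
clearbody p; subst p; rewrite coefMXn ltnn subnn coef0M.
split; last by move=> k kb; rewrite coefMXn kb.
have -> : (evline P u g)`_0 = (g.@[fun i => P 0 i])%:MP by exact: evline_coef0.
have -> : (\prod_i h i ^+ b i)`_0 = \prod_i (evline P u (f i))`_1 ^+ b i.
  rewrite coef0_prod; apply: eq_bigr => i _.
  by rewrite -horner_coef0 horner_exp horner_coef0 /h coef_drop_poly.
by [].
Qed.

(** Chevalley's polynomial for the indicator function of a point: [1 - a ^ (q - 1)] is 1 at [a = 0]
    and 0 elsewhere. *)
Definition indic P : B := \prod_i (1 - ('X_i - (P 0 i)%:MP) ^+ #|F|.-1).

Lemma indicE P P' : (indic P).@[fun i => P' 0 i] = (P == P')%:R.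
Proof.
have E i : (1 - ('X_i - (P 0 i)%:MP_[r]) ^+ #|F|.-1).@[fun i => P' 0 i]
   = (P 0 i == P' 0 i)%:R.
  rewrite mevalB meval1 rmorphXn /= mevalB mevalXU mevalC.
  have [->|neq] := eqVneq; last first.
    apply/eqP; rewrite subr_eq0 eq_sym; apply/eqP.
    have nz : P' 0 i - P 0 i != 0 by rewrite subr_eq0 eq_sym.
    apply: (mulfI nz); rewrite -exprS prednK ?mulr1 ?expf_card //.
    exact: ltnW (card_finNzRing_gt1 F).
  rewrite subrr expr0n -subn1 subn_eq0 leqNgt.
  by rewrite card_finNzRing_gt1 subr0.
have -> : (indic P).@[fun i => P' 0 i] = \prod_i (P 0 i == P' 0 i)%:R.
  by rewrite /indic rmorph_prod; apply: eq_bigr => i _; exact: E.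
have [<-|neq] := eqVneq P P'.
  by rewrite big1 // => i _; rewrite eqxx.
have [i neqi] : exists i, P 0 i != P' 0 i.
  apply/existsP; rewrite -negb_forall; apply: contra neq => /forallP h.
  by apply/eqP/rowP => i; apply/eqP/h.
by rewrite (bigD1 i) //= (negbTE neqi) mul0r.
Qed.

Lemma indic_deg P : degle (r * #|F|.-1) (indic P).
Proof.
have := @degle_prod F r _ (index_enum 'I_r)
  (fun i => 1 - ('X_i - (P 0 i)%:MP) ^+ #|F|.-1) (fun=> #|F|.-1).
rewrite sum_nat_const card_ord; apply=> i.
apply: degleD; first exact: degle1.
apply: degleN; rewrite -[X in degle X]mul1n; apply: degleXn.
by apply: degleD; [exact: degleX | apply/degleN/degleC].
Qed.

End Evaluation.

(** Bernoulli's inequality gives [C / D <= (1 + 1 / D) ^ C]. Its power [r + 1] grows like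
    [C ^ (r + 1)], which beats a polynomial of degree [r] in [k = C (r + 1)]. *)
Lemma exp_beats_poly (r E D : nat) : (0 < D)%N ->
  exists k, ((k * E).+1 ^ r * D ^ k < D.+1 ^ k)%N.
Proof.
move=> D0; pose C := (D ^ r.+1 * (r.+1 * E).+1 ^ r).+1.
exists (C * r.+1)%N.
have bern j : (j * D ^ j <= D.+1 ^ j * D)%N.
  elim: j => [|j IH]; first by rewrite mul0n.
  have h : (D ^ j <= D.+1 ^ j)%N by case: j {IH} => // j; rewrite leq_exp2r.
  rewrite !expnS; move: (D ^ j)%N (D.+1 ^ j)%N IH h => a b IH h; nia.
have bC : (C * D ^ C <= D.+1 ^ C * D)%N by exact: bern.
have {bC}: ((C * D ^ C) ^ r.+1 <= (D.+1 ^ C * D) ^ r.+1)%N by rewrite leq_exp2r.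
rewrite !expnMn -!expnM => bC.
rewrite -(ltn_pmul2r (m := D ^ r.+1)) ?expn_gt0 ?D0 //.
apply: leq_trans bC; rewrite mulnAC ltn_pmul2r ?expn_gt0 ?D0 //.
apply: (@leq_ltn_trans ((C * (r.+1 * E).+1) ^ r * D ^ r.+1)%N).
  rewrite leq_pmul2r ?expn_gt0 ?D0 //.
  case: (posnP r) => [->|r0] //; rewrite leq_exp2r //; nia.
rewrite expnMn [ltnRHS]expnS mulnC [(C ^ r * _)%N]mulnC mulnA.
by rewrite ltn_pmul2r // expn_gt0.
Qed.

Lemma card_monomials_le r T : (#|{: 'X_{1..r < T.+1}}| <= T.+1 ^ r)%N.
Proof.
pose phi (m : 'X_{1..r < T.+1}) : {ffun 'I_r -> 'I_T.+1} := [ffun i => inord (m i)].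
have phi_inj : injective phi.
  have le (m : 'X_{1..r < T.+1}) i : (m i < T.+1)%N.
    apply: leq_ltn_trans (bmdeg m); rewrite mdegE (bigD1 i) //=; exact: leq_addr.
  move=> m m' /ffunP e; apply: val_inj; apply/mnmP => i.
  by have := e i; rewrite !ffunE => /(congr1 val); rewrite /= !inordK.
by have := leq_card phi phi_inj; rewrite card_ffun !card_ord.
Qed.

(** The exponents [b] for which [\prod_i f i ^+ b i] has degree at most [M] as soon as each [f i]
    has degree at most [d i]. *)
Definition weighted_monomials r (d : 'I_r -> nat) M : {set 'X_{1..r < M.+1}} :=
  [set b : 'X_{1..r < M.+1} | \sum_i d i * b i <= M]%N.

(** Divide each exponent by [d i]: the quotients form a weighted monomial and the remainders take
    [\prod_i d i] values. *)
Lemma card_weighted_monomials r (d : 'I_r -> nat) M : (forall i, 0 < d i)%N ->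
  (#|{: 'X_{1..r < M.+1}}| <= \prod_i d i * #|weighted_monomials d M|)%N.
Proof.
move=> d0.
pose quo (m : 'X_{1..r}) : 'X_{1..r} := [multinom m i %/ d i | i < r].
have quo_le (m : 'X_{1..r}) : (\sum_i d i * quo m i <= mdeg m)%N.
  rewrite mdegE; apply: leq_sum => i _; rewrite mnmE mulnC; exact: leq_trunc_div.
have quo_deg (m : 'X_{1..r < M.+1}) : (mdeg (quo m) < M.+1)%N.
  apply: leq_ltn_trans (bmdeg m); rewrite !mdegE; apply: leq_sum => i _.
  by rewrite mnmE leq_div.
pose phi (m : 'X_{1..r < M.+1}) : 'X_{1..r < M.+1} * {dffun forall i : 'I_r, 'I_(d i)} :=
  (BMultinom (quo_deg m), [ffun i => Ordinal (ltn_pmod (m i) (d0 i))]).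
have phi_inj : injective phi.
  move=> m m' e; apply: val_inj; apply/mnmP => i.
  have := congr1 (fun x => (bmnm x.1) i) e.
  have := congr1 (fun x : 'X_{1..r < M.+1} * {dffun forall i : 'I_r,
    'I_(d i)} => nat_of_ord (x.2 i)) e; rewrite /= !ffunE !mnmE /= => e2 e1.
  by rewrite (divn_eq (m i) (d i)) e1 e2 -divn_eq.
rewrite mulnC -[X in (_ * X)%N](_ : #|{dffun forall i : 'I_r, 'I_(d i)}| = _); last first.
  rewrite card_dep_ffun foldrE big_map big_enum /=.
  by apply: eq_bigr => i _; rewrite card_ord.
rewrite -(card_imset _ phi_inj) -[X in (_ <= _ * X)%N]cardsT -cardsX.
apply/subset_leq_card/subsetP => _ /imsetP[m _ ->].
rewrite !inE andbT; apply: leq_trans (quo_le _) _; by rewrite -ltnS bmdeg.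
Qed.

Section Bezout.
Variables (F : finFieldType) (r : nat).
Local Notation B := {mpoly F[r]}.
Local Notation pt P := (fun i : 'I_r => (P : 'rV[F]_r) 0 i).

(* The products [indic P * f P ^ b] over points [P] and exponents [b] are linearly independent: in
   a relation, a pair of least degree [|b|] is detected by the lowest term of the expansion at [P]
   in the coordinates given by [f P]. *)
Lemma bezout_count (S : {set 'rV[F]_r}) (d : 'I_r -> nat)
    (f : 'rV[F]_r -> 'I_r -> B) (J : 'rV[F]_r -> 'M[F]_r) M :
  (forall P i, P \in S -> degle (d i) (f P i)) ->
  (forall P P' i, P \in S -> P' \in S -> (f P i).@[pt P'] = 0) ->
  (forall P i, P \in S -> has_lin P (f P i) (row i (J P))) ->
  (forall P, P \in S -> J P \in unitmx) ->
  (#|S| * #|weighted_monomials d M| <= #|{: 'X_{1..r < (M + r * #|F|.-1).+1}}|)%N.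
Proof.
move=> fd fv fl Ju; set W := weighted_monomials d M.
pose I := {x : 'rV[F]_r * 'X_{1..r < M.+1} | x \in setX S W}.
pose G (x : I) : B := indic (val x).1 * \prod_i f (val x).1 i ^+ (val x).2 i.
have xS (x : I) : (val x).1 \in S by case: x => x /=; rewrite inE => /andP[].
have xW (x : I) : (val x).2 \in W by case: x => x /=; rewrite inE => /andP[].
have Gd x : degle (M + r * #|F|.-1) (G x).
  rewrite addnC; apply: degleM; first exact: indic_deg.
  have := xW x; rewrite inE => /degleW; apply.
  apply: (@degle_prod F r _ _ _ (fun i => d i * (val x).2 i)%N) => i.
  exact/degleXn/fd.
rewrite leqNgt; apply/negP => lt_card.
have cI : #|{: I}| = (#|S| * #|W|)%N by rewrite card_sig -cardsX; apply: eq_card.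
rewrite -cI in lt_card.
have [lam [x0 lx0] rel] := nontrivial_relation (fun x m => (G x)@_(bmnm m)) lt_card.
have sum0 : \sum_x lam x *: G x = 0.
  apply/mpolyP => m; rewrite mcoeff0 raddf_sum /=.
  have [mM|mM] := ltnP (mdeg m) (M + r * #|F|.-1).+1.
    rewrite -[RHS](rel (BMultinom mM)); apply: eq_bigr => x _; exact: mcoeffZ.
  apply: big1 => x _; rewrite mcoeffZ [_@__]memN_msupp_eq0 ?mulr0 //.
  apply: msize_mdeg_ge; exact: leq_trans (Gd x) mM.
case: (arg_minnP (P := fun x => lam x != 0) (fun x => mdeg (val x).2) lx0) => x1 lx1 min1.
set P := (val x1).1; set b1 : 'X_{1..r} := (val x1).2; pose k := mdeg b1.
have PS : P \in S by exact: xS.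
(* The inverse Jacobian applied to the generic vector: along this direction the linear part of
   [f P i] becomes ['X_i], so that distinct exponents give distinct leading monomials. *)
pose u i : B := \sum_j invmx (J P) i j *: 'X_j.
have uE i : (evline P u (f P i))`_1 = 'X_i.
  rewrite (fl P i PS) /u.
  under eq_bigr => l _ do rewrite scaler_sumr.
  rewrite exchange_big /= (bigD1 i) //= [X in _ + X]big1 ?addr0.
    under eq_bigr => l _ do rewrite scalerA mxE.
    rewrite -scaler_suml; have := congr1 (fun A : 'M_r => A i i) (mulmxV (Ju P PS)).
    by rewrite !mxE eqxx => ->; rewrite scale1r.
  move=> j ji; under eq_bigr => l _ do rewrite scalerA mxE.
  rewrite -scaler_suml; have := congr1 (fun A : 'M_r => A i j) (mulmxV (Ju P PS)).
  by rewrite !mxE eq_sym (negbTE ji) => ->; rewrite scale0r.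
have term x : lam x * ((evline P u (G x))`_k)@_b1 = if x == x1 then lam x else 0.
  have [lx|lx] := eqVneq (lam x) 0; first by rewrite lx mul0r; case: ifP.
  have fv' i : (f (val x).1 i).@[pt P] = 0 by apply: fv => //; exact: xS.
  have [ek el] := evline_monomial u (indic (val x).1) (val x).2 fv'.
  have := min1 x lx; rewrite -/b1 -/k leq_eqVlt => /orP[/eqP kE|lt_k]; last first.
    rewrite /G el // mcoeff0 mulr0; have [xE|//] := eqVneq x x1.
    by rewrite xE ltnn in lt_k.
  rewrite kE (ek : (evline P u (G x))`_(mdeg (val x).2) = _).
  rewrite indicE; have [PE|PN] := eqVneq (val x).1 P; last first.
    rewrite mpolyC0 mul0r mcoeff0 mulr0; have [xE|//] := eqVneq x x1.
    by rewrite xE eqxx in PN.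
  rewrite mpolyC1 mul1r PE; under eq_bigr => i _ do rewrite uE.
  rewrite -mpolyXE_id mcoeffX; have [->|xN] := eqVneq x x1; first by rewrite eqxx mulr1.
  case: eqP => [bE|_]; last by rewrite mulr0.
  case/eqP: xN; apply: val_inj; apply: injective_projections; first exact: PE.
  exact: val_inj.
have := congr1 (fun p => ((evline P u p)`_k)@_b1) sum0.
rewrite /= rmorph0 coef0 mcoeff0 rmorph_sum coef_sum raddf_sum /=.
under eq_bigr => x _.
  rewrite -mul_mpolyC rmorphM /= evlineC coefCM mcoeffCM term; over.
by rewrite -big_mkcond big_pred1_eq => /eqP; rewrite (negbTE lx1).
Qed.

(** If [S] had more than [D] points, the two counts above would give [(D + 1) A M <= D A (M + E)],
    where [A M] is the number of monomials of degree at most [M]. Iterating this makes [A] grow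
    exponentially, whereas it grows polynomially. *)
Theorem bezout (S : {set 'rV[F]_r}) (d : 'I_r -> nat)
    (f : 'rV[F]_r -> 'I_r -> B) (J : 'rV[F]_r -> 'M[F]_r) :
  (forall i, 0 < d i)%N ->
  (forall P i, P \in S -> degle (d i) (f P i)) ->
  (forall P P' i, P \in S -> P' \in S -> (f P i).@[pt P'] = 0) ->
  (forall P i, P \in S -> has_lin P (f P i) (row i (J P))) ->
  (forall P, P \in S -> J P \in unitmx) ->
  (#|S| <= \prod_i d i)%N.
Proof.
move=> d0 fd fv fl Ju; rewrite leqNgt; apply/negP => ltDN.
set D := (\prod_i d i)%N in ltDN.
have D0 : (0 < D)%N by rewrite prodn_gt0.
pose E := (r * #|F|.-1)%N.
pose A M := #|{: 'X_{1..r < M.+1}}|.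
have step M : (D.+1 * A M <= D * A (M + E))%N.
  have h1 := bezout_count M fd fv fl Ju; have h2 := card_weighted_monomials M d0.
  apply: leq_trans (leq_mul ltDN h2) _.
  by rewrite mulnCA leq_mul2l h1 orbT.
have A0 : (0 < A 0)%N.
  by apply/card_gt0P; have h : (mdeg (0%MM : 'X_{1..r}) < 1)%N; [rewrite mdeg0 | exists (BMultinom h)].
have growth k : (D.+1 ^ k <= D ^ k * A (k * E))%N.
  elim: k => [|k IH]; first by rewrite !expn0 mul0n mul1n.
  have -> : (k.+1 * E = k * E + E)%N by rewrite mulSn addnC.
  rewrite expnS; apply: leq_trans (leq_mul (leqnn _) IH) _.
  rewrite mulnCA expnSr -mulnA leq_mul2l; apply/orP; right; exact: step.
have [k hk] := exp_beats_poly r E D0.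
have := leq_trans hk (growth k); rewrite mulnC ltn_pmul2l ?expn_gt0 ?D0 //.
by rewrite ltnNge card_monomials_le.
Qed.

End Bezout.

Lemma natr_card_finField (F : finFieldType) : (#|F|%:R : F) = 0.
Proof.
have := expg_cardG (in_setT (1 : F)).
by rewrite cardsT FinRing.zmodXgE FinRing.zmod1gE.
Qed.

Lemma row_free_rowsub (F : fieldType) m1 m2 n (A : 'M[F]_(m2, n)) (h : 'I_m1 -> 'I_m2) :
  injective h -> row_free A -> row_free (rowsub h A).
Proof.
move=> hi /row_freeP[B AB].
apply/row_freeP; exists (B *m (rowsub h 1%:M)^T).
rewrite mulmxA mul_rowsub_mx AB; apply/matrixP => i j; rewrite !mxE.
rewrite (bigD1 (h i)) //= !mxE eqxx mul1r big1 ?addr0 ?(inj_eq hi) 1?eq_sym //.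
by move=> k ki; rewrite !mxE eq_sym (negbTE ki) mul0r.
Qed.

Lemma extract_rows (F : fieldType) m n a (L : 'M[F]_(m, n)) :
  (a <= \rank L)%N -> exists h : 'I_a -> 'I_m, row_free (rowsub h L).
Proof.
move=> aL; exists (maxrankfun L \o widen_ord aL).
rewrite -[rowsub _ L]/(mxsub _ _ _).
have -> : mxsub (maxrankfun L \o widen_ord aL) id L
    = rowsub (widen_ord aL) (rowsub (maxrankfun L) L) by apply/matrixP => i j; rewrite !mxE.
apply: row_free_rowsub (maxrowsub_free L).
by move=> i j /(congr1 val) /= ij; apply: val_inj.
Qed.

Lemma complete_basis (F : fieldType) a s (A : 'M[F]_(a, a + s)) :
  row_free A -> exists N : 'M[F]_(s, a + s), col_mx A N \in unitmx.
Proof.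
move=> Af; have rA : \rank (A^C)%MS = s.
  by rewrite mxrank_compl (eqP Af) addKn.
exists (castmx (rA, erefl) (row_base A^C)%MS).
rewrite -row_full_unit -sub1mx -addsmxE.
rewrite (_ : (A + castmx _ _ :=: A + A^C)%MS); last first.
  by apply: adds_eqmx => //; apply: eqmx_trans (eqmx_cast _ _) (eq_row_base _).
by rewrite sub1mx addsmx_compl_full.
Qed.

Section BezoutRank.
Variable F : finFieldType.

(** Since [x ^ q] has derivative zero, any linear form [l] is in this way the differential, at every
    point, of a polynomial that vanishes at all rational points. *)
Definition frob_poly r (l : 'rV[F]_r) : {mpoly F[r]} :=
  \sum_i l 0 i *: ('X_i - 'X_i ^+ #|F|).

Lemma frob_poly_deg r (l : 'rV[F]_r) : degle #|F| (frob_poly l).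
Proof.
apply: degle_sum => i _; apply/degleZ/degleD.
  exact: degleW (ltnW (card_finNzRing_gt1 F)) (degleX _ _).
by apply: degleN; rewrite -[X in degle X]mul1n; apply/degleXn/degleX.
Qed.

Lemma frob_poly_eval r (l P : 'rV[F]_r) : (frob_poly l).@[fun i => P 0 i] = 0.
Proof.
rewrite rmorph_sum big1 // => i _ /=.
by rewrite mevalZ mevalB rmorphXn /= mevalXU expf_card subrr mulr0.
Qed.

Lemma frob_poly_lin r (l P : 'rV[F]_r) : has_lin P (frob_poly l) l.
Proof.
move=> u; rewrite rmorph_sum coef_sum; apply: eq_bigr => i _ /=.
rewrite -mul_mpolyC rmorphM /= evlineC coefCM mul_mpolyC; congr (_ *: _).
have [p pE] : exists p, p = evline P u 'X_i by exists (evline P u 'X_i).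
have p1 : p`_1 = u i.
  by rewrite pE evlineX coefD coefC coefZ coefX mulr1 add0r.
have -> : evline P u ('X_i - 'X_i ^+ #|F|) = p - p ^+ #|F|.
  by rewrite pE evlineB evlineXn.
rewrite coefB p1; have -> : (p ^+ #|F|)`_1 = 0; last by rewrite subr0.
have := coef_deriv (p ^+ #|F|) 0; rewrite mulr1n => <-.
rewrite deriv_exp -mulr_natl -polyC_natr -mpolyC_nat natr_card_finField.
by rewrite mpolyC0 polyC0 mul0r coef0.
Qed.

Lemma bezout_rank_split a s (S : {set 'rV[F]_(a + s)}) D : (0 < D)%N ->
  (forall P, P \in S -> exists m (f : 'I_m -> {mpoly F[a + s]}) (L : 'M[F]_(m, a + s)),
    [/\ forall i, degle D (f i),
        forall i P', P' \in S -> (f i).@[fun k => P' 0 k] = 0,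
        forall i, has_lin P (f i) (row i L) & (a <= \rank L)%N]) ->
  (#|S| <= D ^ a * #|F| ^ s)%N.
Proof.
move=> D0 hS.
have good P : exists fJ : ('I_(a + s) -> {mpoly F[a + s]}) * 'M[F]_(a + s),
    P \in S ->
    [/\ forall i, degle (if split i then D else #|F|) (fJ.1 i),
        forall i P', P' \in S -> (fJ.1 i).@[fun k => P' 0 k] = 0,
        forall i, has_lin P (fJ.1 i) (row i fJ.2) & fJ.2 \in unitmx].
  have [PS|] := boolP (P \in S); last by exists (fun=> 0, 0).
  have [m [f [L [fd fv fl rL]]]] := hS P PS.
  have [h hL] := extract_rows rL.
  have [N NL] := complete_basis hL.
  exists (fun i => match split i with inl j => f (h j) | inr j => frob_poly (row j N) end,
          col_mx (rowsub h L) N) => _; split=> //= i.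
  - by case: splitP => j _ //; exact: frob_poly_deg.
  - by move=> P' P'S; case: splitP => j _; [exact: fv | exact: frob_poly_eval].
    case: (split_ordP i) => j ->.
      by rewrite rowKu row_rowsub.
    by rewrite rowKd; exact: frob_poly_lin.
have [fJ hfJ] := fin_all_exists good.
have -> : (D ^ a * #|F| ^ s = \prod_(i < a + s) if split i then D else #|F|)%N.
  rewrite big_split_ord /=; congr (_ * _)%N.
    rewrite -[a in LHS]card_ord -prod_nat_const; apply: eq_bigr => i _.
    by rewrite (unsplitK (inl i)).
  rewrite -[s in LHS]card_ord -prod_nat_const; apply: eq_bigr => i _.
  by rewrite (unsplitK (inr i)).
apply: (@bezout F _ S _ (fun P => (fJ P).1) (fun P => (fJ P).2)).
- by move=> i; case: (split i) => j //=; exact: ltnW (card_finNzRing_gt1 F).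
- by move=> P i PS; have [] := hfJ P PS.
- by move=> P P' i PS P'S; have [_ + _ _] := hfJ P PS; apply.
- by move=> P i PS; have [_ _ + _] := hfJ P PS; apply.
- by move=> P PS; have [] := hfJ P PS.
Qed.

(* If at each point of [S] the common kernel of the linear parts of polynomials
   of degree at most [D] vanishing on [S] has dimension at most [s], then the
   equations [x_i ^ q = x_i] complete them to a regular system of parameters. *)
Theorem bezout_rank r s (S : {set 'rV[F]_r}) D : (0 < D)%N -> (s <= r)%N ->
  (forall P, P \in S -> exists m (f : 'I_m -> {mpoly F[r]}) (L : 'M[F]_(m, r)),
    [/\ forall i, degle D (f i),
        forall i P', P' \in S -> (f i).@[fun k => P' 0 k] = 0,
        forall i, has_lin P (f i) (row i L) & (r - s <= \rank L)%N]) ->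
  (#|S| <= D ^ (r - s) * #|F| ^ s)%N.
Proof.
move=> D0 sr; move: S.
have : (r = (r - s) + s)%N by rewrite subnK.
move: (r - s)%N => a e; clear sr; subst r => S; exact: bezout_rank_split.
Qed.

End BezoutRank.

(** * Singular strata of a system of quadratic forms *)

(** Dual form of [bezout_rank]: when the common kernel of the linear parts has dimension at most
    [s], their rank is at least [r - s]. *)
Lemma bezout_tangent (F : finFieldType) r s (S : {set 'rV[F]_r}) D :
  (0 < D)%N -> (s <= r)%N ->
  (forall P, P \in S -> exists (I : finType) (f : I -> {mpoly F[r]}) (l : I -> 'rV[F]_r),
    [/\ forall i, degle D (f i),
        forall i P', P' \in S -> (f i).@[fun k => P' 0 k] = 0,
        forall i, has_lin P (f i) (l i)
      & forall C : 'M[F]_r,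
          (forall (c : 'rV_r) i, (c <= C)%MS -> c *m (l i)^T = 0) -> (\rank C <= s)%N]) ->
  (#|S| <= D ^ (r - s) * #|F| ^ s)%N.
Proof.
move=> D0 sr hS; apply: bezout_rank => // P /hS[I [f [l [fd fv fl hC]]]].
exists #|I|, (f \o enum_val), (\matrix_(i, j) l (enum_val i) 0 j); split=> //=.
- by move=> i P' P'S; exact: fv.
- move=> i u; rewrite (fl (enum_val i) u); by under [RHS]eq_bigr => j _ do rewrite !mxE.
- set L := \matrix_(i, j) _.
  have := hC (kermx L^T); rewrite mxrank_ker mxrank_tr leq_subLR addnC -leq_subLR; apply.
  move=> c i /sub_kermxP cL; apply/rowP => z; rewrite ord1 [RHS]mxE.
  have := congr1 (fun M : 'rV_#|I| => M 0 (enum_rank i)) cL.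
  rewrite !mxE => h; rewrite -[RHS]h; apply: eq_bigr => j _.
  by rewrite !mxE enum_rankK.
Qed.

Section QuadraticForms.
Variable F : fieldType.
Implicit Types n : nat.

Definition qf n (A : 'M[F]_n) (x : 'rV[F]_n) : F := (x *m A *m x^T) 0 0.
Definition pol n (A : 'M[F]_n) : 'M[F]_n := A + A^T.
Definition bf n (A : 'M[F]_n) (x y : 'rV[F]_n) : F := (x *m pol A *m y^T) 0 0.

Lemma pol_sym n (A : 'M[F]_n) : (pol A)^T = pol A.
Proof. by rewrite linearD /= trmxK addrC. Qed.

Lemma bfE n (A : 'M[F]_n) x y : bf A x y = (x *m A *m y^T) 0 0 + (y *m A *m x^T) 0 0.
Proof.
rewrite /bf mulmxDr mulmxDl mxE; congr (_ + _).
by rewrite -[RHS](mxE trmx_key (fun i j => (y *m A *m x^T) j i)) -/(trmx _) !trmx_mul trmxK mulmxA.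
Qed.

Lemma bfC n (A : 'M[F]_n) x y : bf A x y = bf A y x.
Proof. by rewrite !bfE addrC. Qed.

Lemma qfD n (A : 'M[F]_n) x y : qf A (x + y) = qf A x + qf A y + bf A x y.
Proof. by rewrite bfE /qf linearD /= !mulmxDl !mulmxDr !mxE; ring. Qed.

Lemma qfZ n (A : 'M[F]_n) a x : qf A (a *: x) = a ^+ 2 * qf A x.
Proof. by rewrite /qf linearZ /= -!scalemxAl -scalemxAr scalerA mxE expr2. Qed.

Lemma bfDl n (A : 'M[F]_n) x y z : bf A (x + y) z = bf A x z + bf A y z.
Proof. by rewrite /bf !mulmxDl mxE. Qed.

Lemma bfZl n (A : 'M[F]_n) a x y : bf A (a *: x) y = a * bf A x y.
Proof. by rewrite /bf -!scalemxAl mxE. Qed.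

Lemma bfDr n (A : 'M[F]_n) x y z : bf A x (y + z) = bf A x y + bf A x z.
Proof. by rewrite bfC bfDl ![bf A _ x]bfC. Qed.

Lemma bfZr n (A : 'M[F]_n) a x y : bf A x (a *: y) = a * bf A x y.
Proof. by rewrite bfC bfZl bfC. Qed.

Lemma bf_suml n (A : 'M[F]_n) (I : Type) (s : seq I) (C : pred I) (f : I -> 'rV[F]_n) y :
  bf A (\sum_(i <- s | C i) f i) y = \sum_(i <- s | C i) bf A (f i) y.
Proof. by rewrite /bf !mulmx_suml summxE. Qed.

Lemma bf_sumr n (A : 'M[F]_n) (I : Type) (s : seq I) (C : pred I) (f : I -> 'rV[F]_n) x :
  bf A x (\sum_(i <- s | C i) f i) = \sum_(i <- s | C i) bf A x (f i).
Proof. by rewrite bfC bf_suml; apply: eq_bigr => i _; rewrite bfC. Qed.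

Lemma bfxx n (A : 'M[F]_n) x : bf A x x = qf A x *+ 2.
Proof. by rewrite bfE mulr2n. Qed.

Definition comb n r (Q : 'I_r -> 'M[F]_n) (c : 'rV[F]_r) : 'M[F]_n :=
  \sum_k c 0 k *: Q k.

Lemma pol_comb n r (Q : 'I_r -> 'M[F]_n) c :
  pol (comb Q c) = \sum_k c 0 k *: pol (Q k).
Proof.
rewrite /pol /comb linear_sum -big_split /=; apply: eq_bigr => k _.
by rewrite linearZ scalerDr.
Qed.

Lemma qf_comb n r (Q : 'I_r -> 'M[F]_n) c x :
  qf (comb Q c) x = \sum_k c 0 k * qf (Q k) x.
Proof.
rewrite /qf /comb mulmx_sumr mulmx_suml summxE; apply: eq_bigr => k _.
by rewrite -scalemxAr -scalemxAl mxE.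
Qed.

Lemma bf_comb n r (Q : 'I_r -> 'M[F]_n) c x y :
  bf (comb Q c) x y = \sum_k c 0 k * bf (Q k) x y.
Proof.
rewrite /bf pol_comb mulmx_sumr mulmx_suml summxE; apply: eq_bigr => k _.
by rewrite -scalemxAr -scalemxAl mxE.
Qed.

End QuadraticForms.

(** * Bordered minors of the generic polar matrix and their differentials *)

Section SymmetricPivot.
Variables (F : fieldType) (n : nat) (M : 'M[F]_n).
Hypothesis Msym : M^T = M.
Local Notation R := (\rank M).
Local Notation phi := (maxrankfun M).

Definition pivot_coef : 'M[F]_(n, R) := M *m pinvmx (rowsub phi M).
(** Row [k] is the unit vector [e_k] minus the combination of pivot unit vectors that has the same
    product with [M]; the matrix is a projector onto the left kernel of [M]. *)
Definition pivot_ker : 'M[F]_n := 1%:M - pivot_coef *m rowsub phi 1%:M.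

Lemma pivot_coefK : pivot_coef *m rowsub phi M = M.
Proof. by rewrite /pivot_coef mulmxKpV // eq_maxrowsub. Qed.

Lemma pivot_kerM : pivot_ker *m M = 0.
Proof.
by rewrite mulmxBl mul1mx -mulmxA mul_rowsub_mx mul1mx pivot_coefK subrr.
Qed.

Lemma pivot_ker_id m (x : 'M[F]_(m, n)) : x *m M = 0 -> x *m pivot_ker = x.
Proof.
rewrite -{1}pivot_coefK mulmxA => h.
have x0 : x *m pivot_coef = 0.
  apply: (row_free_inj (maxrowsub_free M)); by rewrite h mul0mx.
by rewrite mulmxBr mulmx1 mulmxA x0 mul0mx subr0.
Qed.

(** By symmetry the columns indexed by [phi] span all columns, just as the rows do, so restricting
    the independent rows to these columns keeps their rank. *)
Lemma pivot_minor_unit : mxsub phi phi M \in unitmx.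
Proof.
have E : rowsub phi M = mxsub phi phi M *m pivot_coef^T.
  have M2 := congr1 trmx pivot_coefK; rewrite trmx_mul Msym in M2.
  apply/matrixP => i j.
  have := congr1 (fun A : 'M_n => A (phi i) j) M2; rewrite !mxE => <-.
  apply: eq_bigr => k _; rewrite !mxE.
  by have := congr1 (fun A : 'M_n => A (phi i) (phi k)) Msym; rewrite mxE => ->.
rewrite -row_free_unit -row_leq_rank -{1}(eqP (maxrowsub_free M)) {1}E.
exact: mxrankM_maxl.
Qed.

End SymmetricPivot.

(** A factor ['X] comes out of the last row; modulo ['X] the remaining matrix is block
    triangular. *)
Lemma det_block_X (B : comNzRingType) R (A : 'M[{poly B}]_R) b c (d : 'M[{poly B}]_1) :
  (\det (block_mx A ('X *: b) ('X *: c) ('X *: d)))`_1 = (\det A)`_0 * (d 0 0)`_0.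
Proof.
have -> : block_mx A ('X *: b) ('X *: c) ('X *: d)
   = block_mx 1%:M 0 0 'X%:M *m block_mx A ('X *: b) c d.
  by rewrite mulmx_block !mul1mx !mul0mx !addr0 !add0r !mul_scalar_mx.
rewrite det_mulmx det_ublock det1 mul1r det_scalar expr1 coefXM /=.
have hom (p : {poly B}) : p`_0 = horner_eval 0 p by rewrite /horner_eval horner_coef0.
rewrite !hom -!det_map_mx map_block_mx.
have -> : map_mx (horner_eval 0) ('X *: b) = 0 :> 'M_(R, 1).
  apply/matrixP => i j; by rewrite !mxE /horner_eval hornerM hornerX mul0r.
by rewrite det_lblock [\det (map_mx _ d)]det_mx11 mxE.
Qed.

(** By hypothesis the borders [x] and [y] contribute nothing at order zero. The border of the
    perturbed matrix is thus divisible by ['X], and at order one [D] enters only through its value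
    at [x] and [y]. *)
Lemma det_sandwich_lin (F : fieldType) (B : comNzRingType) (f : {rmorphism F -> B}) R n
    (A0 : 'M[F]_R) (M : 'M[F]_n) (a : 'M[F]_(R, n)) (x y : 'rV[F]_n) (D : 'M[B]_n)
    (e := polyC \o f) :
  col_mx a x *m M *m (col_mx a y)^T = block_mx A0 0 0 0 ->
  (\det (map_mx e (col_mx a x) *m (map_mx e M + 'X *: map_mx polyC D)
         *m (map_mx e (col_mx a y))^T))`_1
  = f (\det A0) * (map_mx f x *m D *m (map_mx f y)^T) 0 0.
Proof.
move=> EME.
pose N := map_mx e (col_mx a x) *m map_mx polyC D *m (map_mx e (col_mx a y))^T.
rewrite mulmxDr mulmxDl -scalemxAr -scalemxAl matrix.map_trmx -!map_mxM EME.
rewrite -matrix.map_trmx -/N.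
rewrite -[N]submxK map_block_mx scale_block_mx add_block_mx !map_mx0 !add0r det_block_X.
congr (_ * _).
  have hom (p : {poly B}) : p`_0 = horner_eval 0 p by rewrite /horner_eval horner_coef0.
  rewrite hom -det_map_mx -(det_map_mx f); congr (\det _).
  apply/matrixP => i j; rewrite !mxE /e /=.
  by rewrite -hom coefD coefC coefXM addr0.
have -> : drsubmx N = map_mx polyC (map_mx f x *m D *m (map_mx f y)^T).
  rewrite /N !map_col_mx tr_col_mx !mul_col_mx !mul_mx_row -block_mxEv block_mxKdr.
  rewrite !map_mxM; congr (_ *m _ *m _); apply/matrixP => i j; by rewrite !mxE.
by rewrite mxE coefC.
Qed.

Lemma mxsub_sandwich (R : pzRingType) m n a b (f : 'I_a -> 'I_m) (g : 'I_b -> 'I_n)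
    (Z : 'M[R]_(m, n)) :
  mxsub f g Z = rowsub f 1%:M *m Z *m (rowsub g 1%:M)^T.
Proof.
rewrite mul_rowsub_mx mul1mx; apply/matrixP => i j; rewrite !mxE.
rewrite (bigD1 (g j)) //= !mxE eqxx mulr1 big1 ?addr0 // => k kj.
by rewrite !mxE eq_sym (negbTE kj) mulr0.
Qed.

Section GenericMatrix.
Variables (F : finFieldType) (n r : nat) (Q : 'I_r -> 'M[F]_n).
Local Notation B := {mpoly F[r]}.
Local Notation pt P := (fun i : 'I_r => (P : 'rV[F]_r) 0 i).

Definition gmx : 'M[B]_n := \sum_k 'X_k *: map_mx (@mpolyC r F) (pol (Q k)).

Lemma gmx_deg i j : degle 1 (gmx i j).
Proof.
rewrite summxE; apply: degle_sum => k _; rewrite !mxE mulrC.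
by rewrite mul_mpolyC; apply/degleZ/degleX.
Qed.

Lemma gmx_eval P : map_mx (meval (pt P)) gmx = pol (comb Q P).
Proof.
rewrite pol_comb /gmx raddf_sum /=; apply: eq_bigr => k _.
apply/matrixP => i j; rewrite !mxE mevalM mevalXU; congr (_ * _).
by rewrite mevalC.
Qed.

Definition cst : F -> {poly B} := polyC \o @mpolyC r F.
HB.instance Definition _ := GRing.RMorphism.on cst.

Definition gdir (u : 'I_r -> B) : 'M[B]_n :=
  \sum_k u k *: map_mx (@mpolyC r F) (pol (Q k)).

Lemma gmx_evline P u : map_mx (evline P u) gmx
  = map_mx cst (pol (comb Q P)) + 'X *: map_mx polyC (gdir u).
Proof.
rewrite pol_comb /gdir !raddf_sum /= -big_split /=.
apply: eq_bigr => k _; apply/matrixP => i j; rewrite !mxE.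
rewrite evlineM evlineX; rewrite evlineC -mul_polyC /cst /= mpolyCM !polyCM; ring.
Qed.

Lemma det_deg m (Z : 'M[B]_m) : (forall i j, degle 1 (Z i j)) -> degle m (\det Z).
Proof.
move=> Zd; apply: degle_sum => s _.
have -> : (-1) ^+ s * \prod_i Z i (s i) = (-1) ^+ s *: \prod_i Z i (s i).
  by rewrite -mul_mpolyC rmorph_sign.
apply: degleZ; have := @degle_prod F r _ (index_enum 'I_m) (fun i => Z i (s i)) (fun=> 1%N).
by rewrite sum1_card card_ord; apply.
Qed.

Lemma evline_det m P u (A : 'M[B]_m) :
  evline P u (\det A) = \det (map_mx (evline P u) A).
Proof. exact: esym (det_map_mx (evline P u) A). Qed.

Definition ext R (phi : 'I_R -> 'I_n) k (i : 'I_(R + 1)) : 'I_n :=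
  if split i is inl j then phi j else k.

Definition minor_poly R (phi : 'I_R -> 'I_n) k l : B :=
  \det (mxsub (ext phi k) (ext phi l) gmx).

Lemma minor_poly_deg R (phi : 'I_R -> 'I_n) k l : degle R.+1 (minor_poly phi k l).
Proof. rewrite -addn1; apply: det_deg => i j; rewrite mxE; exact: gmx_deg. Qed.

Lemma minor_poly_eval R (phi : 'I_R -> 'I_n) k l P :
  (\rank (pol (comb Q P)) <= R)%N -> (minor_poly phi k l).@[pt P] = 0.
Proof.
move=> rP.
have -> : (minor_poly phi k l).@[pt P] = \det (mxsub (ext phi k) (ext phi l) (pol (comb Q P))).
  by rewrite -gmx_eval -map_mxsub det_map_mx.
apply/eqP; apply: contraTT rP; rewrite -unitfE.
rewrite -[_ \is a _]/(_ \in unitmx) -row_free_unit => /eqP h.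
rewrite -ltnNge -addn1 -{}h mxsub_sandwich.
exact: leq_trans (mxrankM_maxl _ _) (mxrankM_maxr _ _).
Qed.

(** Unipotent row and column operations replace the bordering unit vectors by their projections to
    the kernel of [M] without changing the minor; [det_sandwich_lin] then applies. *)
Lemma minor_poly_lin P (M := pol (comb Q P)) (k l : 'I_n) :
  has_lin P (minor_poly (maxrankfun M) k l)
    (\row_j (\det (mxsub (maxrankfun M) (maxrankfun M) M)
       * bf (Q j) (row k (pivot_ker M)) (row l (pivot_ker M)))).
Proof.
move=> u; set phi := maxrankfun M; set A0 := mxsub phi phi M.
have Ms : M^T = M by exact: pol_sym.
pose w k := row k (pivot_ker M).
have wM k' : w k' *m M = 0 by rewrite -row_mul pivot_kerM row0.
have Mw k' : M *m (w k')^T = 0 by rewrite -{1}Ms -trmx_mul wM trmx0.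
pose E k' := col_mx (rowsub phi 1%:M) (w k').
pose G k' := block_mx 1%:M 0 (- row k' (pivot_coef M)) 1%:M : 'M[F]_(\rank M + 1).
have EG k' : E k' = G k' *m rowsub (ext phi k') 1%:M.
  have -> : rowsub (ext phi k') 1%:M
      = col_mx (rowsub phi 1%:M) (row k' 1%:M) :> 'M[F]_(\rank M + 1, n).
    by apply/matrixP => i j; rewrite !mxE /ext; case: splitP => i' _; rewrite !mxE.
  rewrite mul_block_col !mul1mx mul0mx addr0 /E /w /pivot_ker.
  by rewrite linearB /= row_mul mulNmx addrC.
have detG k' : \det (G k') = 1 by rewrite det_lblock !det1 mulr1.
pose Z := map_mx cst M + 'X *: map_mx polyC (gdir u).
pose Y : 'M[{poly B}]_(\rank M + 1) := map_mx cst (E k) *m Z *m (map_mx cst (E l))^T.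
have -> : evline P u (minor_poly phi k l) = \det Y.
  rewrite /minor_poly evline_det map_mxsub (gmx_evline P u : _ = Z) /Y.
  rewrite !EG !(map_mxM cst).
  rewrite mxsub_sandwich trmx_mul -!mulmxA det_mulmx (det_map_mx cst) detG rmorph1 mul1r.
  rewrite !mulmxA det_mulmx matrix.map_trmx det_tr (det_map_mx cst) detG rmorph1 mulr1.
  by rewrite -matrix.map_trmx !map_mxsub !map_mx1.
have EME : E k *m M *m (E l)^T = block_mx A0 0 0 0.
  rewrite mul_col_mx wM tr_col_mx mul_col_mx !mul_mx_row !mul0mx.
  by rewrite -[_ *m M *m (w l)^T]mulmxA Mw mulmx0 -mxsub_sandwich block_mxEv.
have -> : (\det Y)`_1 = _ := det_sandwich_lin (@mpolyC r F) (gdir u) EME.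
rewrite /gdir mulmx_sumr mulmx_suml summxE mulr_sumr; apply: eq_bigr => j _.
rewrite -scalemxAr -scalemxAl mxE [in RHS]mxE -mul_mpolyC.
rewrite mpolyCM -!mulrA; congr (_ * _); rewrite mulrC; congr (_ * _).
by rewrite matrix.map_trmx -!map_mxM mxE.
Qed.

(** The forms [c'] allowed in [C] make up the common kernel of the differentials at [c] of the
    bordered minors, as computed in [minor_poly_lin]. *)
Definition polar_tangent_le c s := forall C : 'M[F]_r,
  (forall (c' : 'rV_r) x y, (c' <= C)%MS ->
     x *m pol (comb Q c) = 0 -> y *m pol (comb Q c) = 0 -> bf (comb Q c') x y = 0) ->
  (\rank C <= s)%N.

Lemma card_stratum_minors (S : {set 'rV[F]_r}) R s : (s <= r)%N ->
  (forall c, c \in S -> \rank (pol (comb Q c)) = R /\ polar_tangent_le c s) ->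
  (#|S| <= R.+1 ^ (r - s) * #|F| ^ s)%N.
Proof.
move=> sr hS; apply: bezout_tangent => // P PS.
have [rP hP] := hS P PS; set M := pol (comb Q P) in rP hP.
exists ('I_n * 'I_n)%type, (fun kl => minor_poly (maxrankfun M) kl.1 kl.2),
  (fun kl => \row_j (\det (mxsub (maxrankfun M) (maxrankfun M) M)
       * bf (Q j) (row kl.1 (pivot_ker M)) (row kl.2 (pivot_ker M)))).
split.
- by move=> i; rewrite -rP; exact: minor_poly_deg.
- by move=> i P' /hS[rP' _]; apply: minor_poly_eval; rewrite rP' rP.
- by move=> i; exact: minor_poly_lin.
have Ms : M^T = M by exact: pol_sym.
move=> C hC; apply: hP => c x y cC /(pivot_ker_id (M := M)) xE /(pivot_ker_id (M := M)) yE.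
suff W0 : pivot_ker M *m pol (comb Q c) *m (pivot_ker M)^T = 0.
  have : x *m (pivot_ker M *m pol (comb Q c) *m (pivot_ker M)^T) *m y^T = 0.
    by rewrite W0 mulmx0 mul0mx.
  rewrite -[x in bf _ x _]xE -[y in bf _ _ y]yE /bf trmx_mul !mulmxA => ->; by rewrite mxE.
apply/matrixP => k l; rewrite [RHS]mxE.
have -> : (pivot_ker M *m pol (comb Q c) *m (pivot_ker M)^T) k l
   = bf (comb Q c) (row k (pivot_ker M)) (row l (pivot_ker M)).
  by rewrite /bf tr_row -row_mul -[row k _ *m _]row_mul !mxE; apply: eq_bigr => i _; rewrite !mxE.
have := congr1 (fun A : 'M_1 => A 0 0) (hC c (k, l) cC); rewrite !mxE /=.
under eq_bigr => j _ do rewrite !mxE mulrCA.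
rewrite -mulr_sumr => /eqP; rewrite mulf_eq0 bf_comb => /orP[|/eqP//].
by have := pivot_minor_unit Ms; rewrite unitmxE unitfE => /negP.
Qed.

End GenericMatrix.

(** * Hafnians and strata in characteristic 2 *)

Section Hafnian.
Variables (R : comNzRingType) (n : nat) (b : 'I_n -> 'I_n -> R).
Implicit Types I J : {set 'I_n}.

(** Expansion along the picked element of [I]; [m] is fuel, and every [m] at least [#|I|] gives the
    same value. *)
Fixpoint hafnian_rec m I : R :=
  if [pick k in I] is Some k then
    if m is m'.+1 then \sum_(j in I :\ k) b k j * hafnian_rec m' (I :\ k :\ j) else 0
  else 1.

(* The sum over perfect matchings of [I]; in characteristic 2 it is the Pfaffian. *)
Definition hafnian I := hafnian_rec #|I| I.

Lemma hafnian_rec_fuel m I : (#|I| <= m)%N -> hafnian_rec m I = hafnian I.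
Proof.
rewrite /hafnian; have [p] := ubnP #|I|; elim: p => // p IH in m I *.
move=> Ip Im; case: m Im => [|m] Im; first by case: #|I| Im.
case cI: #|I| => [|c] /=.
  by case: pickP => // k; rewrite (cards0_eq cI) inE.
case: pickP => // k kI; apply: eq_bigr => j jI; congr (_ * _).
have c1 : #|I :\ k| = c by have := cardsD1 k I; rewrite kI cI; lia.
have c2 : #|I :\ k| = #|I :\ k :\ j|.+1 by rewrite (cardsD1 j) jI.
move: Ip Im; rewrite cI -c1 c2 => Ip Im.
by rewrite (IH m) ?(IH _.+1) //; [exact: ltnW Ip | exact: ltnW Ip | exact: ltnW Im].
Qed.

Lemma hafnian0 : hafnian set0 = 1.
Proof. by rewrite /hafnian cards0 /=; case: pickP => // k; rewrite inE. Qed.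

Hypothesis bC : forall i j, b i j = b j i.

(** Expanding along [k0] and then [k], or along [k] and then [k0], gives the term in which the two
    are matched together, and the same double sum over their distinct partners. *)
Lemma hafnian_expand I k : k \in I ->
  hafnian I = \sum_(j in I :\ k) b k j * hafnian (I :\ k :\ j).
Proof.
have [p] := ubnP #|I|; elim: p => // p IH in I k *; move=> Ip kI.
have step k0 : k0 \in I -> [pick k in I] = Some k0 ->
    hafnian I = \sum_(j in I :\ k0) b k0 j * hafnian (I :\ k0 :\ j).
  move=> k0I pE; rewrite {1}/hafnian (cardsD1 k0) k0I /= pE.
  apply: eq_bigr => j jI; rewrite hafnian_rec_fuel //.
  by rewrite [in leqRHS](cardsD1 j) jI leq_addl.
case pE: [pick k in I] => [k0|]; last by move: pE; case: pickP => // /(_ k); rewrite kI.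
have k0I : k0 \in I by move: pE; case: pickP => // x xI [<-].
rewrite (step k0) //.
have [->//|kk0] := eqVneq k k0.
pose J := I :\ k0 :\ k.
have JE : I :\ k :\ k0 = J by rewrite /J setDDl setUC -setDDl.
have kI0 : k \in I :\ k0 by rewrite !inE kk0.
have k0I' : k0 \in I :\ k by rewrite !inE eq_sym kk0.
rewrite (big_setD1 k kI0) (big_setD1 k0 k0I') /= -/J JE bC; congr (_ + _).
have card_lt x : x \in I -> (#|I :\ x| < p)%N.
  by move=> xI; have := cardsD1 x I; rewrite xI; lia.
have sub_lt (A B : {set 'I_n}) : A \subset B -> (#|B| < p)%N -> (#|A| < p)%N.
  by move=> AB; exact: leq_ltn_trans (subset_leq_card AB).
have E1 j : j \in J -> hafnian (I :\ k0 :\ j) = \sum_(l in J :\ j) b k l * hafnian (J :\ j :\ l).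
  rewrite !inE => /and3P[jk jk0 jI]; rewrite (IH _ k); first last.
  - by rewrite !inE kk0 kI eq_sym jk.
  - exact: sub_lt (subD1set _ _) (card_lt _ k0I).
  by have -> : I :\ k0 :\ j :\ k = J :\ j by rewrite /J setDDl setUC -setDDl.
have E2 l : l \in J -> hafnian (I :\ k :\ l) = \sum_(j in J :\ l) b k0 j * hafnian (J :\ l :\ j).
  rewrite !inE => /and3P[lk lk0 lI]; rewrite (IH _ k0); first last.
  - by rewrite !inE k0I [k0 == k]eq_sym kk0 eq_sym lk0.
  - exact: sub_lt (subD1set _ _) (card_lt _ kI).
  by have -> : I :\ k :\ l :\ k0 = J :\ l by rewrite -JE setDDl setUC -setDDl.
rewrite (eq_bigr (fun j => \sum_(l in J :\ j) b k0 j * (b k l * hafnian (J :\ j :\ l)))); last first.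
  by move=> j jJ; rewrite E1 // mulr_sumr.
rewrite [RHS](eq_bigr (fun l => \sum_(j in J :\ l) b k0 j * (b k l * hafnian (J :\ j :\ l))));
  last first.
  move=> l lJ; rewrite E2 // mulr_sumr; apply: eq_bigr => j _.
  by rewrite mulrCA; congr (_ * (_ * hafnian _)); rewrite setDDl setUC -setDDl.
rewrite (exchange_big_dep (mem J)) /=; last by move=> i j _; rewrite inE => /andP[].
apply: eq_bigr => l lJ; apply: eq_bigl => j; rewrite !in_setD1.
have /and3P[-> -> ->] : [&& l != k, l != k0 & l \in I] by move: lJ; rewrite !inE.
by rewrite !andbT [l == j]eq_sym andbC.
Qed.

Lemma hafnian_odd I : odd #|I| -> hafnian I = 0.
Proof.
have [p] := ubnP #|I|; elim: p => // p IH in I *; move=> Ip oI.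
have /set0Pn[k kI] : I != set0 by apply: contraTneq oI => ->; rewrite cards0.
rewrite (hafnian_expand kI) big1 // => j jI; rewrite IH ?mulr0 //.
  by move: Ip; rewrite (cardsD1 k) kI (cardsD1 j) jI; lia.
by move: oI; rewrite (cardsD1 k) kI (cardsD1 j) jI /= negbK.
Qed.

(** The Pfaffian counterpart of a row of cofactors: for an alternating [b] in characteristic 2 it
    lies in the kernel of [b] when [#|I|] exceeds the rank. *)
Definition hafnian_row I : 'rV[R]_n := \row_i (if i \in I then hafnian (I :\ i) else 0).

Hypotheses (b0 : forall i, b i i = 0) (char2 : 1 + 1 = 0 :> R).

Lemma sum_sym_pairs (J : {set 'I_n}) (g : 'I_n -> 'I_n -> R) :
  (forall i j, g i j = g j i) -> \sum_(i in J) \sum_(j in J :\ i) g i j = 0.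
Proof.
move=> gC.
have split i : \sum_(j in J :\ i) g i j
   = \sum_(j in J | (j < i)%N) g i j + \sum_(j in J | (i < j)%N) g i j.
  rewrite (bigID (fun j : 'I_n => j < i)%N) /=; congr (_ + _); apply: eq_bigl => j;
    rewrite !inE -(inj_eq val_inj) /=; case: (j \in J); rewrite ?andbF //=; lia.
rewrite (eq_bigr _ (fun i _ => split i)) big_split /=.
rewrite [X in X + _](exchange_big_dep (mem J)) /=; last by move=> i j _ /andP[].
rewrite -big_split big1 //= => i iJ.
rewrite [X in X + _](eq_bigr (fun j => g i j)); last by move=> j _; rewrite gC.
rewrite [X in X + _](eq_bigl (fun j => (j \in J) && (i < j)%N)); last first.
  by move=> j; rewrite iJ.
by rewrite -[X in X + X]mul1r -mulrDl char2 mul0r.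
Qed.

(** For [k] outside [I] this is the expansion along [k]. For [k] in [I] it is an expansion with a
    repeated index, whose terms cancel in pairs in characteristic 2. *)
Lemma hafnian_rowM I k :
  \sum_i hafnian_row I 0 i * b i k = if k \in I then 0 else hafnian (k |: I).
Proof.
have -> : \sum_i hafnian_row I 0 i * b i k = \sum_(i in I) b k i * hafnian (I :\ i).
  rewrite [RHS]big_mkcond; apply: eq_bigr => i _.
  by rewrite mxE; case: ifP => _; rewrite ?mul0r // mulrC bC.
case: ifP => kI; last first.
  have kN : k \notin I by rewrite kI.
  rewrite (@hafnian_expand (k |: I) k) ?setU11 // setU1K //.
rewrite (big_setD1 k kI) /= b0 mul0r add0r.
rewrite (eq_bigr (fun i => \sum_(j in (I :\ k) :\ i) b k i * (b k j * hafnian (I :\ k :\ i :\ j)))).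
  apply: sum_sym_pairs => i j; rewrite mulrCA; congr (_ * (_ * hafnian _)).
  by rewrite setDDl setUC -setDDl.
move=> i; rewrite !inE => /andP[ik iI]; rewrite (@hafnian_expand (I :\ i) k); last first.
  by rewrite !inE eq_sym ik.
rewrite mulr_sumr; have -> // : I :\ i :\ k = I :\ k :\ i by rewrite setDDl setUC -setDDl.
Qed.

(** [b] sends the second vector to one supported outside [l |: I], while the first is supported on
    [k |: I], so only the index [k] survives. The identity expresses the hafnian of size [#|I| + 2]
    to first order where it vanishes. *)
Lemma hafnian_pair I k l : k \notin I -> l \notin I -> k != l ->
  \sum_i \sum_j hafnian_row (k |: I) 0 i * b i j * hafnian_row (l |: I) 0 j
  = hafnian I * hafnian (k |: (l |: I)).
Proof.
move=> kI lI kl.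
have -> : \sum_i \sum_j hafnian_row (k |: I) 0 i * b i j * hafnian_row (l |: I) 0 j
  = \sum_i hafnian_row (k |: I) 0 i * (if i \in l |: I then 0 else hafnian (i |: (l |: I))).
  apply: eq_bigr => i _; rewrite -hafnian_rowM mulr_sumr; apply: eq_bigr => j _.
  by rewrite -mulrA bC [b _ _ * _]mulrC.
rewrite (bigD1 k) //= big1 ?addr0.
  have -> : (k \in l |: I) = false by rewrite !inE (negbTE kl) (negbTE kI).
  by rewrite mxE setU11 setU1K.
move=> i ik; rewrite mxE !inE (negbTE ik) /=.
by case: (i \in I); rewrite ?orbT ?mulr0 ?mul0r.
Qed.

End Hafnian.

Lemma hafnian_map (R S : comNzRingType) (f : {rmorphism R -> S}) n (b : 'I_n -> 'I_n -> R) (I :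
  {set 'I_n}) :
  hafnian (fun i j => f (b i j)) I = f (hafnian b I).
Proof.
rewrite /hafnian; move: #|I| => m0; elim: m0 I => [|m IH] I /=; case: pickP => [k _|_];
  rewrite ?rmorph0 ?rmorph1 //.
by rewrite rmorph_sum; apply: eq_bigr => j _; rewrite IH rmorphM.
Qed.

Lemma eq_hafnian (R : comNzRingType) n (b c : 'I_n -> 'I_n -> R) (I : {set 'I_n}) :
  (forall i j, b i j = c i j) -> hafnian b I = hafnian c I.
Proof.
move=> e; rewrite /hafnian; move: #|I| => m0; elim: m0 I => [//|m IH] I /=; case: pickP => [k _|//].
by apply: eq_bigr => j _; rewrite IH e.
Qed.

Lemma hafnian_deg (F : idomainType) r n (b : 'I_n -> 'I_n -> {mpoly F[r]}) (I : {set 'I_n}) :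
  (forall i j, b i j = b j i) -> (forall i j, degle 1 (b i j)) ->
  degle #|I|./2 (hafnian b I).
Proof.
move=> bC bd; have [p] := ubnP #|I|; elim: p => // p IH in I *; move=> Ip.
have [->|/set0Pn[k kI]] := eqVneq I set0; first by rewrite hafnian0 degle1.
rewrite (hafnian_expand bC kI); apply: degle_sum => j jI.
have cE : #|I| = #|I :\ k :\ j|.+2 by rewrite (cardsD1 k) kI (cardsD1 j) jI.
rewrite cE /= -add1n; apply: degleM => //; apply: IH.
by rewrite cE in Ip; exact: ltnW Ip.
Qed.

Section AlternatingKernel.
Variables (F : fieldType) (n : nat) (b : 'M[F]_n).
Hypotheses (bsym : b^T = b) (b0 : forall i, b i i = 0) (char2 : 1 + 1 = 0 :> F).
Local Notation hf := (hafnian (fun i j => b i j)).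
Local Notation hrow := (hafnian_row (fun i j => b i j)).

Let bC i j : b i j = b j i.
Proof. by rewrite -{1}bsym mxE. Qed.

Lemma hafnian_row_mul I k : (hrow I *m b) 0 k = if k \in I then 0 else hf (k |: I).
Proof. by rewrite -(hafnian_rowM bC b0 char2) mxE. Qed.

Variable I0 : {set 'I_n}.
Hypotheses (hI0 : hf I0 != 0) (hmax : forall J : {set 'I_n}, (#|I0| < #|J|)%N -> hf J = 0).

Lemma hafnian_row_ker (I : {set 'I_n}) : (#|I0| < #|I|)%N -> hrow I *m b = 0.
Proof.
move=> lt; apply/rowP => k; rewrite hafnian_row_mul [RHS]mxE; case: ifP => // kI.
by apply: hmax; rewrite cardsU1 kI; apply: leq_trans lt _; rewrite leq_addl.
Qed.

(** Subtracting the combination with the same coordinates outside [I0] leaves a kernel vector [y]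
    supported on [I0]. Pairing [y] with [hrow (I0 :\ i) *m b], which on [I0] is [hf I0] at [i] and
    zero elsewhere, kills its coordinate [i]. *)
Lemma alternating_ker_span x : x *m b = 0 ->
  x = \sum_(k in ~: I0) (x 0 k / hf I0) *: hrow (k |: I0).
Proof.
move=> xb; apply/eqP; rewrite -subr_eq0; apply/eqP; set y := _ - _.
have yout l : l \notin I0 -> y 0 l = 0.
  move=> lI; rewrite !mxE summxE (bigD1 l) ?inE //= big1 ?addr0.
    by rewrite !mxE setU11 setU1K // divfK // subrr.
  move=> k /andP[_ kl]; rewrite !mxE !inE eq_sym (negbTE kl) (negbTE lI) /=; exact: mulr0.
have yb : y *m b = 0.
  rewrite mulmxBl xb mulmx_suml big1 ?subrr // => k; rewrite inE => kI.
  by rewrite -scalemxAl hafnian_row_ker ?scaler0 // cardsU1 kI.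
apply/rowP => i; rewrite [RHS]mxE; have [iI|] := boolP (i \in I0); last exact: yout.
have : y *m (hrow (I0 :\ i) *m b)^T = 0.
  by rewrite trmx_mul bsym mulmxA yb mul0mx.
move=> /(congr1 (fun A : 'M_1 => A 0 0)); rewrite mxE [RHS]mxE (bigD1 i) //=.
rewrite big1 ?addr0 => [|m mi]; last first.
  rewrite [_^T _ _]mxE hafnian_row_mul !inE mi /=; case: ifP => [_|/negbT mI]; first by rewrite mulr0.
  by rewrite yout // mul0r.
rewrite [_^T _ _]mxE hafnian_row_mul !inE eqxx /= setD1K // => /eqP.
by rewrite mulf_eq0 (negbTE hI0) orbF => /eqP.
Qed.

(** The vectors [hrow (k |: I0)], for [k] outside [I0], form a basis of the kernel. *)
Lemma alternating_rank : \rank b = #|I0|.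
Proof.
pose V := \matrix_(i < #|~: I0|) hrow (enum_val i |: I0).
have out (i : 'I_#|~: I0|) : enum_val i \notin I0 by have := enum_valP i; rewrite inE.
have Vfree : row_free V.
  apply/row_freeP; exists ((hf I0)^-1 *: (rowsub (fun i : 'I_#|~: I0| => enum_val i) 1%:M)^T).
  apply/matrixP => i j; rewrite -scalemxAr !mxE (bigD1 (enum_val j)) //= big1 ?addr0.
    rewrite !mxE eqxx mulr1 !inE (negbTE (out j)) orbF (inj_eq enum_val_inj) eq_sym.
    case: eqP => [->|_]; last by rewrite mulr0.
    by rewrite setU1K // mulVf.
  by move=> k kj; rewrite !mxE eq_sym (negbTE kj) mulr0.
have VK : (kermx b :=: V)%MS.
  apply/eqmxP/andP; split.
    apply/row_subP => i; have /sub_kermxP/alternating_ker_span-> := row_sub i (kermx b).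
    apply: summx_sub => k kI; apply: scalemx_sub.
    have -> : hrow (k |: I0) = row (enum_rank_in kI k) V.
      by rewrite rowK enum_rankK_in.
    exact: row_sub.
  apply/row_subP => i; rewrite rowK; apply/sub_kermxP/hafnian_row_ker.
  by rewrite cardsU1 out.
have := mxrank_ker b; rewrite VK (eqP Vfree).
have := cardsC I0; rewrite card_ord; have := rank_leq_row b.
move: #|~: I0| => x; move: #|I0| (\rank b) => y z; lia.
Qed.

End AlternatingKernel.

Lemma alternating_pivot (F : fieldType) n (b : 'M[F]_n) : b^T = b -> (forall i, b i i = 0) ->
  1 + 1 = 0 :> F -> exists I0 : {set 'I_n}, [/\ hafnian (fun i j => b i j) I0 != 0,
    #|I0| = \rank b & forall J : {set 'I_n}, (\rank b < #|J|)%N -> hafnian (fun i j => b i j) J = 0].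
Proof.
move=> bs b0 c2; set hf := hafnian _.
have h0 : hf set0 != 0 by rewrite /hf hafnian0 oner_eq0.
case: (arg_maxnP (P := fun I => hf I != 0) (fun I : {set 'I_n} => #|I|) h0) => I0 hI0 hm.
have hmax (J : {set 'I_n}) : (#|I0| < #|J|)%N -> hf J = 0.
  move=> lt; apply/eqP; apply: contraTT lt => /hm; by rewrite -leqNgt.
have rE := alternating_rank bs b0 c2 hI0 hmax.
by exists I0; rewrite rE.
Qed.

Section CharTwoStrata.
Variables (F : finFieldType) (n r : nat) (Q : 'I_r -> 'M[F]_n).
Hypothesis char2 : 1 + 1 = 0 :> F.
Local Notation B := {mpoly F[r]}.
Local Notation pt P := (fun i : 'I_r => (P : 'rV[F]_r) 0 i).
Local Notation hfP P := (hafnian (fun i j => pol (comb Q P) i j)).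
Local Notation hrowP P := (hafnian_row (fun i j => pol (comb Q P) i j)).
Implicit Types I J : {set 'I_n}.

Definition ghf : {set 'I_n} -> B := hafnian (fun i j => gmx Q i j).
Definition ghrow (I : {set 'I_n}) i : B := hafnian_row (fun i j => gmx Q i j) I 0 i.

Lemma pol_alt (A : 'M[F]_n) i : pol A i i = 0.
Proof. by rewrite !mxE -[X in X + X]mul1r -mulrDl char2 mul0r. Qed.

Lemma gmxC i j : gmx Q i j = gmx Q j i.
Proof.
rewrite !summxE; apply: eq_bigr => k _; rewrite !mxE; congr (_ * mpolyC _ _).
by rewrite addrC.
Qed.

Lemma gmx_alt i : gmx Q i i = 0.
Proof. by rewrite summxE big1 // => k _; rewrite mxE [_ i i]mxE pol_alt mpolyC0 mulr0. Qed.

Lemma mpoly_char2 : 1 + 1 = 0 :> B.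
Proof. by rewrite -mpolyC1 -mpolyCD char2 mpolyC0. Qed.

Lemma ghf_eval P (I : {set 'I_n}) : (ghf I).@[pt P] = hfP P I.
Proof.
rewrite /ghf -hafnian_map; apply: eq_hafnian => i j.
by rewrite -gmx_eval mxE.
Qed.

Lemma ghf_deg (I : {set 'I_n}) : degle #|I|./2 (ghf I).
Proof. by apply: hafnian_deg; [exact: gmxC | exact: gmx_deg]. Qed.

Lemma ghrow_eval P I i : (ghrow I i).@[pt P] = hrowP P I 0 i.
Proof. by rewrite /ghrow !mxE; case: ifP => _; rewrite ?meval0 // ghf_eval. Qed.

Lemma ghrow_deg t (I : {set 'I_n}) i : (#|I| <= t.*2.+1)%N -> degle t (ghrow I i).
Proof.
move=> It; rewrite /ghrow mxE; case: ifP => [iI|_]; last by rewrite /degle msize0.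
apply: degleW (ghf_deg _); move: It; rewrite (cardsD1 i) iI add1n ltnS => It.
by rewrite -(doubleK t) half_leq.
Qed.

Lemma evline_gmx P u i j : evline P u (gmx Q i j)
  = (pol (comb Q P) i j)%:MP%:P + (\sum_k pol (Q k) i j *: u k) *: 'X.
Proof.
have /(congr1 (fun A : 'M_n => A i j)) := gmx_evline Q P u; rewrite mxE => ->.
rewrite !mxE -mul_polyC mulrC; congr (_ + _%:P * _); rewrite /gdir summxE.
by apply: eq_bigr => k _; rewrite !mxE mulrC mul_mpolyC.
Qed.

Lemma coef1M3 (R : comNzRingType) (p q s : {poly R}) :
  (p * q * s)`_1 = p`_1 * (q`_0 * s`_0) + p`_0 * q`_1 * s`_0 + p`_0 * q`_0 * s`_1.
Proof.
have c1 (a b : {poly R}) : (a * b)`_1 = a`_1 * b`_0 + a`_0 * b`_1.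
  by rewrite coefM !big_ord_recl big_ord0 /= addr0 addrC.
by rewrite !c1 !coef0M; ring.
Qed.

(** The product rule gives three terms; as both end vectors lie in the kernel at [P], only the term
    that differentiates the matrix remains. *)
Lemma bilinear_lin P (u : 'I_r -> B) (U V : 'I_n -> {poly B}) (x y : 'rV[F]_n) :
  (forall i, (U i)`_0 = (x 0 i)%:MP) -> (forall i, (V i)`_0 = (y 0 i)%:MP) ->
  x *m pol (comb Q P) = 0 -> y *m pol (comb Q P) = 0 ->
  (\sum_i \sum_j U i * evline P u (gmx Q i j) * V j)`_1
  = \sum_k bf (Q k) x y *: u k.
Proof.
move=> U0 V0 xK yK; set M := pol (comb Q P) in xK yK.
have Z0 i j : (evline P u (gmx Q i j))`_0 = (M i j)%:MP.
  by rewrite evline_gmx coefD coefC coefZ coefX mulr0 addr0.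
have Z1 i j : (evline P u (gmx Q i j))`_1 = \sum_k pol (Q k) i j *: u k.
  by rewrite evline_gmx coefD coefC coefZ coefX mulr1 add0r.
have xM j : \sum_i x 0 i * M i j = 0.
  by have := congr1 (fun A : 'rV_n => A 0 j) xK; rewrite mxE [RHS]mxE.
have My i : \sum_j M i j * y 0 j = 0.
  have := congr1 (fun A : 'rV_n => A 0 i) yK; rewrite mxE [RHS]mxE => h; rewrite -[RHS]h.
  apply: eq_bigr => j _; rewrite mulrC; congr (_ * _).
  have Ms : M^T = M by exact: pol_sym.
  by rewrite -{1}Ms mxE.
have -> : (\sum_i \sum_j U i * evline P u (gmx Q i j) * V j)`_1
  = \sum_i (U i)`_1 * (\sum_j M i j * y 0 j)%:MP
    + \sum_i \sum_j (x 0 i * y 0 j) *: (\sum_k pol (Q k) i j *: u k)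
    + \sum_j (\sum_i x 0 i * M i j)%:MP * (V j)`_1.
  have E3 : \sum_j (\sum_i x 0 i * M i j)%:MP * (V j)`_1
     = \sum_i \sum_j (x 0 i * M i j)%:MP * (V j)`_1.
    rewrite exchange_big; apply: eq_bigr => j _; by rewrite raddf_sum mulr_suml.
  rewrite E3 coef_sum -!big_split; apply: eq_bigr => i _ /=.
  rewrite coef_sum raddf_sum mulr_sumr -!big_split; apply: eq_bigr => j _ /=.
  rewrite coef1M3 U0 V0 Z0 Z1 -!mpolyCM; congr (_ + _ + _).
  by rewrite mulrAC -mpolyCM mul_mpolyC.
rewrite big1 => [|i _]; last by rewrite My mpolyC0 mulr0.
rewrite [X in _ + X]big1 => [|i _]; last by rewrite xM mpolyC0 mul0r.
rewrite add0r addr0.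
under eq_bigr => i _.
  under eq_bigr => j _ do rewrite scaler_sumr.
  rewrite exchange_big; over.
rewrite exchange_big; apply: eq_bigr => k _ /=.
under eq_bigr => i _.
  under eq_bigr => j _ do rewrite scalerA.
  rewrite -scaler_suml; over.
rewrite -scaler_suml; congr (_ *: _).
rewrite /bf mxE exchange_big; apply: eq_bigr => j _ /=.
rewrite !mxE mulr_suml; apply: eq_bigr => i _; by rewrite !mxE; ring.
Qed.

(** In [hafnian_pair] the larger hafnian vanishes at [P] and that of [I0] does not, so its linear
    part is the one of the left-hand side, given by [bilinear_lin], divided by [hfP P I0]. *)
Lemma ghf_lin P (I0 : {set 'I_n}) k l : hfP P I0 != 0 ->
  (forall J : {set 'I_n}, (#|I0| < #|J|)%N -> hfP P J = 0) ->
  k \notin I0 -> l \notin I0 -> k != l ->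
  has_lin P (ghf (k |: (l |: I0)))
   (\row_j ((hfP P I0)^-1 * bf (Q j) (hrowP P (k |: I0)) (hrowP P (l |: I0)))).
Proof.
move=> h0 hmax kI lI kl u.
have ps := pol_sym (comb Q P); have pa := pol_alt (comb Q P).
have kK : hrowP P (k |: I0) *m pol (comb Q P) = 0.
  by apply: (hafnian_row_ker ps pa char2 hmax); rewrite cardsU1 kI.
have lK : hrowP P (l |: I0) *m pol (comb Q P) = 0.
  by apply: (hafnian_row_ker ps pa char2 hmax); rewrite cardsU1 lI.
have := hafnian_pair gmxC gmx_alt mpoly_char2 kI lI kl.
move=> /(congr1 (fun p => (evline P u p)`_1)); rewrite evlineM.
have -> : evline P u (\sum_i \sum_j hafnian_row (fun i j => gmx Q i j) (k |: I0) 0 i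
     * gmx Q i j * hafnian_row (fun i j => gmx Q i j) (l |: I0) 0 j)
  = \sum_i \sum_j evline P u (ghrow (k |: I0) i) * evline P u (gmx Q i j)
       * evline P u (ghrow (l |: I0) j).
  rewrite evline_sum; apply: eq_bigr => i _; rewrite evline_sum; apply: eq_bigr => j _.
  by rewrite !evlineM.
rewrite (@bilinear_lin P u _ _ (hrowP P (k |: I0)) (hrowP P (l |: I0))) //; first last.
- by move=> i; rewrite evline_coef0 ghrow_eval.
- by move=> i; rewrite evline_coef0 ghrow_eval.
rewrite coefM !big_ord_recl big_ord0 /= addr0 !evline_coef0.
rewrite -/(ghf I0) -/(ghf (k |: (l |: I0))) !ghf_eval [hfP P (k |: _)]hmax; last first.
  by rewrite cardsU1 !inE (negbTE kl) (negbTE kI) cardsU1 lI; lia.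
rewrite mpolyC0 mulr0 addr0 /bump /= mul_mpolyC => e.
have -> : (evline P u (ghf (k |: (l |: I0))))`_1
   = (hfP P I0)^-1 *: (hfP P I0 *: (evline P u (ghf (k |: (l |: I0))))`_1).
  by rewrite scalerA mulVf // scale1r.
rewrite -e scaler_sumr; by apply: eq_bigr => j _; rewrite scalerA mxE.
Qed.

End CharTwoStrata.

(** * Counting forms of given rank in characteristic 2 *)

Section CharTwoCounts.
Variables (F : finFieldType) (n r : nat) (Q : 'I_r -> 'M[F]_n).
Hypothesis char2 : 1 + 1 = 0 :> F.
Local Notation B := {mpoly F[r]}.
Local Notation pt P := (fun i : 'I_r => (P : 'rV[F]_r) 0 i).
Local Notation hfP P := (hafnian (fun i j => pol (comb Q P) i j)).
Local Notation hrowP P := (hafnian_row (fun i j => pol (comb Q P) i j)).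
Implicit Types I J : {set 'I_n}.

(* The value of the generic form at a generic kernel vector: a half-determinant. *)
Definition half_det I : B :=
  \sum_k 'X_k * \sum_i \sum_j (Q k i j)%:MP * ghrow Q I i * ghrow Q I j.

Lemma half_det_deg t I : (#|I| <= t.*2.+1)%N -> degle t.*2.+1 (half_det I).
Proof.
move=> It; apply: degle_sum => k _; rewrite -add1n; apply: degleM; first exact: degleX.
rewrite -addnn -[X in degle (X + _)]add0n.
apply: degle_sum => i _; apply: degle_sum => j _; apply: degleM; last exact: ghrow_deg.
by apply: degleM; [exact: degleC | exact: ghrow_deg].
Qed.

Lemma half_det_eval P I : (half_det I).@[pt P] = qf (comb Q P) (hrowP P I).
Proof.
rewrite qf_comb /half_det raddf_sum /=; apply: eq_bigr => k _.
rewrite mevalM mevalXU; congr (_ * _); rewrite raddf_sum /qf mxE /=.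
under [RHS]eq_bigr => j _ do rewrite [_^T _ _]mxE mxE mulr_suml.
rewrite exchange_big; apply: eq_bigr => i _; rewrite raddf_sum /=; apply: eq_bigr => j _.
rewrite !mevalM mevalC !ghrow_eval; ring.
Qed.

(** The derivative of the kernel vector enters only through its polar pairing at [P] with that
    vector, hence disappears; what remains is the derivative of the coefficients of the generic
    form. *)
Lemma half_det_lin P I :
  hrowP P I *m pol (comb Q P) = 0 ->
  has_lin P (half_det I) (\row_j qf (Q j) (hrowP P I)).
Proof.
move=> wK u; set w := hrowP P I in wK *.
pose U i := evline P u (ghrow Q I i).
have U0 i : (U i)`_0 = (w 0 i)%:MP by rewrite /U evline_coef0 ghrow_eval.
pose q k := \sum_i \sum_j (Q k i j)%:MP%:P * U i * U j.
have -> : evline P u (half_det I) = \sum_k ((P 0 k)%:MP%:P + u k *: 'X) * q k.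
  rewrite evline_sum; apply: eq_bigr => k _; rewrite evlineM evlineX; congr (_ * _).
  rewrite evline_sum; apply: eq_bigr => i _; rewrite evline_sum; apply: eq_bigr => j _.
  by rewrite !evlineM evlineC.
have c1 (a b : {poly B}) : (a * b)`_1 = a`_1 * b`_0 + a`_0 * b`_1.
  by rewrite coefM !big_ord_recl big_ord0 /= addr0 addrC.
have q0 k : (q k)`_0 = (qf (Q k) w)%:MP.
  rewrite coef_sum /qf mxE raddf_sum /=.
  under [RHS]eq_bigr => j _ do rewrite [_^T _ _]mxE mxE mulr_suml raddf_sum.
  rewrite exchange_big; apply: eq_bigr => i _; rewrite coef_sum; apply: eq_bigr => j _.
  rewrite !coef0M !U0 coefC -!mpolyCM /=; congr (mpolyC _ _); ring.
rewrite coef_sum; under eq_bigr => k _.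
  rewrite c1 !coefD !coefC !coefZ !coefX /= mulr0 mulr1 addr0 add0r q0 mulrC mul_mpolyC.
  over.
rewrite big_split /= [X in _ + X](_ : _ = 0) ?addr0.
  by apply: eq_bigr => k _; rewrite mxE.
have q1 k : (q k)`_1 = \sum_i \sum_j (Q k i j) *: ((w 0 j)%:MP * (U i)`_1 + (w 0 i)%:MP * (U j)`_1).
  rewrite coef_sum; apply: eq_bigr => i _; rewrite coef_sum; apply: eq_bigr => j _.
  rewrite coef1M3 !coefC !U0 /= mul0r add0r -mul_mpolyC; ring.
under eq_bigr => k _ do rewrite q1 mul_mpolyC scaler_sumr.
rewrite exchange_big /=.
have -> : \sum_j \sum_i P 0 i *:
     \sum_k Q i j k *: ((w 0 k)%:MP * (U j)`_1 + (w 0 j)%:MP * (U k)`_1)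
  = \sum_i \sum_j comb Q P i j *: ((w 0 j)%:MP * (U i)`_1 + (w 0 i)%:MP * (U j)`_1).
  apply: eq_bigr => i _; under eq_bigr => k _ do rewrite scaler_sumr.
  rewrite exchange_big; apply: eq_bigr => j _ /=; rewrite summxE scaler_suml.
  by apply: eq_bigr => k _; rewrite scalerA [(_ *: Q k) _ _]mxE.
have -> : \sum_i \sum_j comb Q P i j *: ((w 0 j)%:MP * (U i)`_1 + (w 0 i)%:MP * (U j)`_1)
  = \sum_i \sum_j pol (comb Q P) j i *: ((w 0 j)%:MP * (U i)`_1).
  transitivity (\sum_i \sum_j comb Q P i j *: ((w 0 j)%:MP * (U i)`_1)
              + \sum_i \sum_j comb Q P j i *: ((w 0 j)%:MP * (U i)`_1)).
    rewrite [X in _ + X]exchange_big -big_split; apply: eq_bigr => i _ /=.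
    by rewrite -big_split; apply: eq_bigr => j _ /=; rewrite scalerDr.
  rewrite -big_split; apply: eq_bigr => i _ /=; rewrite -big_split; apply: eq_bigr => j _ /=.
  by rewrite -scalerDl; congr (_ *: _); rewrite !mxE addrC.
apply: big1 => i _.
under eq_bigr => j _ do rewrite -mul_mpolyC mulrA -mpolyCM mulrC.
rewrite -mulr_sumr -raddf_sum /=.
have -> : \sum_j pol (comb Q P) j i * w 0 j = 0; last by rewrite mpolyC0 mulr0.
have := congr1 (fun A : 'rV_n => A 0 i) wK; rewrite mxE [RHS]mxE => h; rewrite -[RHS]h.
by apply: eq_bigr => j _; rewrite mulrC.
Qed.

Lemma bf_sum_eq0 (c : 'rV[F]_r) (K : finType) (A : {set K}) (w : K -> 'rV[F]_n) (x y : K -> F) :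
  (forall k l, k \in A -> l \in A -> bf (comb Q c) (w k) (w l) = 0) ->
  bf (comb Q c) (\sum_(k in A) x k *: w k) (\sum_(k in A) y k *: w k) = 0.
Proof.
move=> h; rewrite bf_suml big1 // => k kA; rewrite bfZl bf_sumr big1 ?mulr0 // => l lA.
by rewrite bfZr h ?mulr0.
Qed.

(** The hafnians of size [2 a + 2] have degree [a + 1], against [2 a + 1] for the minors that define
    the same locus. This saving is spent in [singular_sum_char2]. *)
Lemma card_stratum_char2 (S : {set 'rV[F]_r}) a s : (s <= r)%N ->
  (forall c, c \in S -> \rank (pol (comb Q c)) = a.*2 /\ polar_tangent_le Q c s) ->
  (#|S| <= a.+1 ^ (r - s) * #|F| ^ s)%N.
Proof.
move=> sr hS; apply: bezout_tangent => // P PS.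
have [rP hP] := hS P PS.
have ps := pol_sym (comb Q P); have pa := pol_alt char2 (comb Q P).
have [I0 [h0 cI0 hmax]] := alternating_pivot ps pa char2.
rewrite rP in cI0 hmax.
pose good kl := [&& kl.1 \notin I0, kl.2 \notin I0 & kl.1 != kl.2].
exists ('I_n * 'I_n)%type,
  (fun kl => if good kl then ghf Q (kl.1 |: (kl.2 |: I0)) else 0),
  (fun kl => if good kl then \row_j ((hfP P I0)^-1 *
     bf (Q j) (hrowP P (kl.1 |: I0)) (hrowP P (kl.2 |: I0))) else 0).
have cJ k l : k \notin I0 -> l \notin I0 -> k != l -> #|k |: (l |: I0)| = a.+1.*2.
  by move=> kI lI kl; rewrite cardsU1 !inE negb_or kl kI cardsU1 lI cI0.
split.
- move=> [k l]; case: ifP => [/and3P[kI lI kl]|_]; last by rewrite /degle msize0.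
  by rewrite -[a.+1]doubleK -(cJ k l) //; exact: ghf_deg.
- move=> [k l] P' P'S; case: ifP => [/and3P[kI lI kl]|_]; last exact: meval0.
  have [rP' _] := hS P' P'S; rewrite ghf_eval.
  have [? [_ _]] := alternating_pivot (pol_sym (comb Q P')) (pol_alt char2 (comb Q P')) char2.
  by apply; rewrite rP' cJ // ltn_double.
- move=> [k l]; case: ifP => [/and3P[kI lI kl]|_].
    by apply: ghf_lin => //; rewrite cI0.
  by move=> u; rewrite raddf0 coef0 big1 // => j _; rewrite mxE scale0r.
move=> C hC; apply: hP => c x y cC xK yK.
rewrite -cI0 in hmax.
rewrite (alternating_ker_span ps pa char2 h0 hmax xK) (alternating_ker_span ps pa char2 h0 hmax yK).
apply: bf_sum_eq0 => k l; rewrite !inE => kI lI.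
have [->|kl] := eqVneq k l; first by rewrite bfxx -[X in X *+ 2]mul1r -mulrnAl mulr2n char2 mul0r.
have := congr1 (fun A : 'M_1 => A 0 0) (hC c (k, l) cC); rewrite /good /= kI lI kl !mxE.
under eq_bigr => j _ do rewrite !mxE mulrCA.
rewrite -mulr_sumr -bf_comb => /eqP.
by rewrite mulf_eq0 invr_eq0 (negbTE h0) => /eqP.
Qed.

Definition form_tangent_le c s := forall C : 'M[F]_r,
  (forall (c' : 'rV_r) x, (c' <= C)%MS -> x *m pol (comb Q c) = 0 -> qf (comb Q c') x = 0) ->
  (\rank C <= s)%N.

(** The differentials of the hafnians control the polar form of [c'] on the radical, and those of
    the half-determinants, of degree [1 + t + t], control its values on a spanning family. Together
    they give the vanishing of [c'] on the radical as a quadratic form. *)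
Lemma card_even_stratum_char2 (S : {set 'rV[F]_r}) t s : (s <= r)%N ->
  (forall c, c \in S -> [/\ \rank (pol (comb Q c)) = t.*2,
     forall x, x *m pol (comb Q c) = 0 -> qf (comb Q c) x = 0 & form_tangent_le c s]) ->
  (#|S| <= t.*2.+1 ^ (r - s) * #|F| ^ s)%N.
Proof.
move=> sr hS; apply: bezout_tangent => // P PS.
have [rP zP hP] := hS P PS.
have ps := pol_sym (comb Q P); have pa := pol_alt char2 (comb Q P).
have [I0 [h0 cI0 hmax]] := alternating_pivot ps pa char2.
rewrite rP in cI0 hmax.
have hmax0 : forall J, (#|I0| < #|J|)%N -> hfP P J = 0 by rewrite cI0.
have ker k : k \notin I0 -> hrowP P (k |: I0) *m pol (comb Q P) = 0.
  by move=> kI; apply: (hafnian_row_ker ps pa char2 hmax0); rewrite cardsU1 kI.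
pose good kl := [&& kl.1 \notin I0, kl.2 \notin I0 & kl.1 != kl.2].
pose f (i : ('I_n * 'I_n) + 'I_n) : B := match i with
  | inl kl => if good kl then ghf Q (kl.1 |: (kl.2 |: I0)) else 0
  | inr k => if k \notin I0 then half_det (k |: I0) else 0 end.
pose l (i : ('I_n * 'I_n) + 'I_n) : 'rV[F]_r := match i with
  | inl kl => if good kl then \row_j ((hfP P I0)^-1 *
     bf (Q j) (hrowP P (kl.1 |: I0)) (hrowP P (kl.2 |: I0))) else 0
  | inr k => if k \notin I0 then \row_j qf (Q j) (hrowP P (k |: I0)) else 0 end.
exists (('I_n * 'I_n) + 'I_n)%type, f, l.
have cJ k m : k \notin I0 -> m \notin I0 -> k != m -> #|k |: (m |: I0)| = t.+1.*2.
  by move=> kI mI km; rewrite cardsU1 !inE negb_or km kI cardsU1 mI cI0.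
have cJ1 k : k \notin I0 -> #|k |: I0| = t.*2.+1 by move=> kI; rewrite cardsU1 kI cI0.
have big P' : P' \in S -> forall J, (t.*2 < #|J|)%N -> hfP P' J = 0.
  move=> P'S; have [<- _ _] := hS P' P'S.
  by have [? [_ _]] := alternating_pivot (pol_sym (comb Q P')) (pol_alt char2 (comb Q P')) char2.
split.
- move=> [[k m]|k] /=; case: ifP; rewrite ?/degle ?msize0 //.
    move=> /and3P[kI mI km]; apply: (@degleW _ _ t.+1); first by rewrite ltnS -addnn leq_addr.
    by rewrite -[t.+1]doubleK -(cJ k m) //; exact: ghf_deg.
  by move=> kI; apply: half_det_deg; rewrite cJ1.
- move=> [[k m]|k] P' P'S /=; case: ifP; rewrite ?meval0 //.
    by move=> /and3P[kI mI km]; rewrite ghf_eval big // cJ // ltn_double.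
  move=> kI; rewrite half_det_eval; have [_ zP' _] := hS P' P'S; apply: zP'.
  apply/rowP => m; rewrite (hafnian_row_mul (pol_sym _) (pol_alt char2 _) char2) [RHS]mxE.
  by case: ifP => // mI; apply: big; rewrite // cardsU1 mI cJ1 //; lia.
- move=> [[k m]|k] /=; case: ifP.
  + by move=> /and3P[kI mI km]; apply: ghf_lin.
  + by move=> _ u; rewrite raddf0 coef0 big1 // => j _; rewrite mxE scale0r.
  + by move=> kI; apply: half_det_lin; exact: ker.
  + by move=> _ u; rewrite raddf0 coef0 big1 // => j _; rewrite mxE scale0r.
move=> C hC; apply: hP => c x cC xK.
rewrite (alternating_ker_span ps pa char2 h0 hmax0 xK).
have bf0 k m : k \in ~: I0 -> m \in ~: I0 -> bf (comb Q c) (hrowP P (k |: I0)) (hrowP P (m |: I0)) = 0.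
  rewrite !inE => kI mI.
  have [->|km] := eqVneq k m; first by rewrite bfxx -[X in X *+ 2]mul1r -mulrnAl mulr2n char2 mul0r.
  have := congr1 (fun A : 'M_1 => A 0 0) (hC c (inl (k, m)) cC); rewrite /= /good /= kI mI km !mxE.
  under eq_bigr => j _ do rewrite !mxE mulrCA.
  rewrite -mulr_sumr -bf_comb => /eqP.
  by rewrite mulf_eq0 invr_eq0 (negbTE h0) => /eqP.
have q0 k : k \in ~: I0 -> qf (comb Q c) (hrowP P (k |: I0)) = 0.
  rewrite !inE => kI; have := congr1 (fun A : 'M_1 => A 0 0) (hC c (inr k) cC).
  rewrite /= kI !mxE qf_comb => h; rewrite -[RHS]h.
  by apply: eq_bigr => j _; rewrite !mxE.
suff /(_ (enum (~: I0))) : forall s0 : seq 'I_n, {subset s0 <= ~: I0} ->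
    qf (comb Q c) (\sum_(k <- s0) (x 0 k / hfP P I0) *: hrowP P (k |: I0)) = 0.
  by rewrite big_enum /=; apply=> k; rewrite mem_enum.
elim=> [|k s0 IH] sub; first by rewrite big_nil /qf !mul0mx mxE.
rewrite big_cons qfD qfZ q0 ?sub ?mem_head // mulr0 IH ?addr0 ?add0r; last first.
  by move=> m ms; rewrite sub // inE ms orbT.
rewrite bfZl bf_sumr big_seq big1 ?mulr0 // => m ms.
rewrite bfZr bf0 ?mulr0 // sub ?mem_head //.
by rewrite inE ms orbT.
Qed.

End CharTwoCounts.

(** * Quadratic forms over a finite field *)

Section FiniteFieldSquares.
Variable F : finFieldType.

Lemma finField_sqrt_char2 (a : F) : 1 + 1 = 0 :> F -> exists x : F, x ^+ 2 = a.
Proof.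
move=> c2; have sq_inj : injective (fun x : F => x ^+ 2).
  move=> x y /= e; apply/eqP; rewrite -subr_eq0 -sqrf_eq0 sqrrB e; apply/eqP.
  have -> : y ^+ 2 - x * y *+ 2 + y ^+ 2 = (1 + 1) * (y ^+ 2 - x * y) by ring.
  by rewrite c2 mul0r.
have [g _ gK] := injF_bij sq_inj; by exists (g a).
Qed.

Lemma finField_two_squares (a b c : F) : 1 + 1 != 0 :> F -> a != 0 -> b != 0 ->
  exists x y : F, a * x ^+ 2 + b * y ^+ 2 = c.
Proof.
move=> c2 a0 b0.
pose sq := [set x ^+ 2 | x in [set: F]].
have csq : (#|F| < 2 * #|sq|)%N.
  have sq0 : 0 \in sq by apply/imsetP; exists 0; rewrite ?inE // expr0n.
  have : (#|F| <= \sum_(y in sq) if y == 0%R then 1 else 2)%N.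
    rewrite -sum1_card (partition_big (fun x : F => x ^+ 2) (mem sq)) /=; last first.
      by move=> x _; apply: imset_f; rewrite inE.
    apply: leq_sum => y /imsetP[z _ ->]; rewrite sum1_card.
    case: eqP => [z0|/eqP z0].
      rewrite (@eq_card1 _ 0) // => x; rewrite !inE z0; exact: sqrf_eq0.
    apply: leq_trans (_ : (#|[set z; - z]| <= 2)%N); last by rewrite cards2; case: eqP.
    apply/subset_leq_card/subsetP => x /eqP e; by rewrite !inE -eqf_sqr e eqxx.
  rewrite (big_setD1 0 sq0) eqxx /= (eq_bigr (fun=> 2%N)); last first.
    by move=> y; rewrite !inE => /andP[/negbTE->].
  rewrite sum_nat_const [in X in _ -> X](cardsD1 0) sq0.
  move: #|_ :\ _| #|F| => u v; lia.
pose A := [set a * s | s in sq]; pose B := [set c - b * s | s in sq].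
have cA : #|A| = #|sq| by apply: card_imset; exact: mulfI.
have cB : #|B| = #|sq| by apply: card_imset => x y /addrI/oppr_inj/(mulfI b0).
have /set0Pn[z] : A :&: B != set0.
  apply: contraTneq csq => AB0; rewrite -leqNgt mul2n -addnn -{1}cA -cB.
  by rewrite -cardsUI AB0 cards0 addn0 max_card.
rewrite inE => /andP[/imsetP[_ /imsetP[x _ ->] ->] /imsetP[_ /imsetP[y _ ->] e]].
by exists x, y; rewrite e subrK.
Qed.

Lemma card_mul_eq (c : F) :
  #|[set p : F * F | p.1 * p.2 == c]| = (#|F|.-1 + (if c == 0%R then #|F| else 0))%N.
Proof.
rewrite -sum1_card (partition_big fst predT) //= (bigD1 0) //= addnC; congr (_ + _)%N.
  rewrite -(cardC1 (0 : F)) -sum1_card; apply: eq_bigr => a a0.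
  rewrite sum1_card (@eq_card1 _ (a, c / a)) // => -[x y]; rewrite unfold_in /= !inE /= xpair_eqE.
  case: (x =P a) => [->|]; rewrite ?andbF ?andbT //=.
  by rewrite -[RHS](inj_eq (mulfI a0)) mulrCA divff // mulr1.
rewrite sum1_card; case: ifP => c0.
  rewrite -[RHS](card_imset _ (_ : injective (fun y : F => (0 : F, y)))); last by move=> x y [].
  apply: eq_card => -[x y]; rewrite unfold_in /= !inE /=;
    apply/andP/imsetP => [[_ /eqP->]|[z _ [-> ->]]].
    by exists y.
  by rewrite mul0r eq_sym c0.
apply: eq_card0 => -[x y]; rewrite unfold_in /= !inE /=; apply/negP => /andP[xy /eqP x0].
by rewrite x0 mul0r eq_sym c0 in xy.
Qed.

End FiniteFieldSquares.

Section Subspaces.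
Variables (F : finFieldType) (n : nat).
Implicit Types (U V : {set 'rV[F]_n}) (x y : 'rV[F]_n).

(** Subspaces are finite sets here, as their cardinalities enter the counts; [subspace_mx] passes to
    matrices. *)
Definition subspace V := 0 \in V /\ forall a x y, x \in V -> y \in V -> a *: x + y \in V.

Lemma subspaceD V x y : subspace V -> x \in V -> y \in V -> x + y \in V.
Proof. by move=> [_ h] xV yV; rewrite -[x]scale1r; exact: h. Qed.

Lemma subspaceZ V a x : subspace V -> x \in V -> a *: x \in V.
Proof. by move=> [h0 h] xV; rewrite -[_ *: _]addr0; exact: h. Qed.

Lemma subspaceB V x y : subspace V -> x \in V -> y \in V -> x - y \in V.
Proof. by move=> sV xV yV; apply: subspaceD => //; rewrite -scaleN1r; exact: subspaceZ. Qed.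

Definition add_line U x := [set p.2 + p.1 *: x | p : F * 'rV[F]_n in setX setT U].

Lemma add_lineP U x z : reflect (exists2 a, z - a *: x \in U & true) (z \in add_line U x).
Proof.
apply: (iffP imsetP) => [[[a u]]|[a aU _]].
  by rewrite !inE /= => uU ->; exists a; rewrite // addrK.
by exists (a, z - a *: x); rewrite ?inE //= subrK.
Qed.

Lemma add_line_subspace U x : subspace U -> subspace (add_line U x).
Proof.
move=> sU; split; first by apply/add_lineP; exists 0; rewrite // scale0r subr0; case: sU.
move=> a y z /add_lineP[b yU _] /add_lineP[c zU _]; apply/add_lineP; exists (a * b + c) => //.
have -> : a *: y + z - (a * b + c) *: x = a *: (y - b *: x) + (z - c *: x).
  by rewrite scalerBr scalerA scalerDl opprD addrACA.
by case: sU => _; apply.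
Qed.

Lemma add_line_sub U x z : z \in U -> z \in add_line U x.
Proof. by move=> zU; apply/add_lineP; exists 0; rewrite // scale0r subr0. Qed.

Lemma add_line_mem U x : subspace U -> x \in add_line U x.
Proof. by move=> [U0 _]; apply/add_lineP; exists 1; rewrite // scale1r subrr. Qed.

Lemma add_line_min U V x : subspace V -> U \subset V -> x \in V -> add_line U x \subset V.
Proof.
move=> sV /subsetP UV xV; apply/subsetP => z /add_lineP[a /UV h _].
by rewrite -(subrK (a *: x) z); apply: subspaceD => //; exact: subspaceZ.
Qed.

Lemma card_add_line U x : subspace U -> x \notin U -> #|add_line U x| = (#|F| * #|U|)%N.
Proof.
move=> sU xU; rewrite card_in_imset; first by rewrite cardsX cardsT.
move=> [a u] [b w]; rewrite !inE /= => uU wU e.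
have [ab|ab] := eqVneq a b; first by rewrite ab in e *; rewrite (addIr _ e).
case/negP: xU; have -> : x = (a - b)^-1 *: (w - u).
  have -> : w - u = (a - b) *: x by rewrite scalerBl; apply/eqP;
    rewrite subr_eq addrAC eq_sym subr_eq addrC e addrC.
  by rewrite scalerA mulVf ?scale1r // subr_eq0.
by apply: subspaceZ => //; exact: subspaceB.
Qed.

Lemma subspace_mx V : subspace V -> exists M : 'M[F]_n, forall x, (x <= M)%MS = (x \in V).
Proof.
move=> sV; exists (\sum_(x in V) <<x>>)%MS => x; apply/idP/idP => [|xV]; last first.
  by apply: (sumsmx_sup x) => //; rewrite genmxE.
move=> /sub_sumsmxP[u ->].
elim/big_rec: _ => [|y z yV zV]; first by case: sV.
apply: subspaceD => //; have : (u y *m <<y>> <= y)%MS.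
  by apply: submx_trans (submxMl _ _) _; rewrite genmxE.
by move/sub_rVP => [a ->]; exact: subspaceZ.
Qed.

Lemma card_mx_rows m (M : 'M[F]_(m, n)) : #|[set x : 'rV[F]_n | (x <= M)%MS]| = (#|F| ^ \rank M)%N.
Proof.
pose f (y : 'rV[F]_(\rank M)) := y *m row_base M.
have finj : injective f.
  by apply: row_free_inj; exact: row_base_free.
have -> : [set x : 'rV[F]_n | (x <= M)%MS] = [set f y | y in [set: 'rV[F]_(\rank M)]].
  apply/setP => x; rewrite inE -(eq_row_base M); apply/submxP/imsetP => [[y ->]|[y _ ->]].
    by exists y; rewrite ?inE.
  by exists y.
by rewrite card_imset // cardsT card_mx mul1n.
Qed.

End Subspaces.

Section Classification.
Variables (F : finFieldType) (n : nat) (A : 'M[F]_n).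
Implicit Types (U V I : {set 'rV[F]_n}) (x y : 'rV[F]_n).
Local Notation q := #|F|.

Definition zeros V := [set x in V | qf A x == 0].
(** The vectors of [V] by which one can translate without changing the form on [V]. In
    characteristic 2 they can be fewer than the radical of the polar form. *)
Definition vtx V := [set x in V | (qf A x == 0) && [forall y in V, bf A x y == 0]].

Lemma vtxP V x : reflect [/\ x \in V, qf A x = 0 & forall y, y \in V -> bf A x y = 0] (x \in vtx V).
Proof.
rewrite inE; apply: (iffP and3P) => [[xV /eqP x0 /forall_inP h]|[xV -> h]]; split=> //.
  by move=> y /h/eqP.
by apply/forall_inP => y /h ->.
Qed.

Lemma qf0 : qf A 0 = 0.
Proof. by rewrite /qf !mul0mx mxE. Qed.

Lemma bf0l y : bf A 0 y = 0.
Proof. by rewrite /bf !mul0mx mxE. Qed.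

Lemma vtx_subspace V : subspace V -> subspace (vtx V).
Proof.
move=> sV; split.
  by apply/vtxP; split=> [||y _]; [case: sV | exact: qf0 | exact: bf0l].
move=> a x y /vtxP[xV x0 xb] /vtxP[yV y0 yb]; apply/vtxP; split.
- by case: sV => _; apply.
- by rewrite qfD qfZ x0 y0 bfZl xb // !mulr0 !addr0.
- by move=> z zV; rewrite bfDl bfZl xb // yb // mulr0 addr0.
Qed.

Lemma bf_self_zero x : qf A x = 0 -> bf A x x = 0.
Proof. by move=> h; rewrite bfxx h mul0rn. Qed.

Section Anisotropic.
Variable V : {set 'rV[F]_n}.
Hypotheses (sV : subspace V) (Vaniso : zeros V = vtx V).

Let nonzero x : x \in V -> x \notin vtx V -> qf A x != 0.
Proof. by move=> xV; apply: contra => x0; rewrite -Vaniso inE xV x0. Qed.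

Let zero_vtx x : x \in V -> qf A x = 0 -> x \in vtx V.
Proof. by move=> xV x0; rewrite -Vaniso inE xV x0 /=. Qed.

(** This is the isotropy of ternary forms over a finite field. In characteristic 2, a vector [y]
    orthogonal to [x1] and independent of it exists, and a square root makes [l x1 + y] isotropic.
    Otherwise the vectors are orthogonalized and the binary form on [x1] and [y2] represents
    [- qf A y3]. *)
Lemma anisotropic_no_three x1 x2 x3 :
  x1 \in V -> x2 \in V -> x3 \in V ->
  x1 \notin vtx V -> x2 \notin add_line (vtx V) x1 ->
  x3 \notin add_line (add_line (vtx V) x1) x2 -> False.
Proof.
move=> x1V x2V x3V x1N x2N x3N.
have sW := vtx_subspace sV; set W := vtx V in sW *.
have sW1 := add_line_subspace x1 sW; set W1 := add_line W x1 in sW1 x2N x3N.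
have sW2 := add_line_subspace x2 sW1; set W2 := add_line W1 x2 in sW2 x3N.
have W_W1 z : z \in W -> z \in W1 by exact: add_line_sub.
have W1_W2 z : z \in W1 -> z \in W2 by exact: add_line_sub.
have x1W1 : x1 \in W1 by exact: add_line_mem.
have x2W2 : x2 \in W2 by exact: add_line_mem.
have q1 := nonzero x1V x1N.
have [c2|c2] := eqVneq (1 + 1 : F) 0.
  have [y [yV yN b1y]] : exists y, [/\ y \in V, y \notin W1 & bf A x1 y = 0].
    have [b12|b12] := eqVneq (bf A x1 x2) 0; first by exists x2.
    exists (x3 - (bf A x1 x3 / bf A x1 x2) *: x2); split.
    - by apply: subspaceB => //; exact: subspaceZ.
    - apply: contra x3N => h.
      rewrite -(subrK ((bf A x1 x3 / bf A x1 x2) *: x2) x3).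
      by apply: subspaceD => //; [exact: W1_W2 | exact: subspaceZ].
    - by rewrite -scaleNr bfDr bfZr mulNr divfK // subrr.
  have [l hl] := finField_sqrt_char2 (qf A y / qf A x1) c2.
  have : l *: x1 + y \in W.
    apply: zero_vtx; first by case: sV => _; apply.
    rewrite qfD qfZ hl bfZl b1y mulr0 addr0 divfK //.
    by rewrite -[X in X + X]mul1r -mulrDl c2 mul0r.
  move=> /W_W1 h; case/negP: yN.
  by rewrite -(addrK (l *: x1) y) addrC [y + _]addrC subspaceD // -scaleNr subspaceZ.
have bxx x : bf A x x = (1 + 1) * qf A x by rewrite bfxx mulrDl mul1r mulr2n.
have b11 : bf A x1 x1 != 0 by rewrite bxx mulf_neq0.
pose y2 := x2 - (bf A x1 x2 / bf A x1 x1) *: x1.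
have y2V : y2 \in V by apply: subspaceB => //; exact: subspaceZ.
have b1y2 : bf A x1 y2 = 0 by rewrite /y2 -scaleNr bfDr bfZr mulNr divfK // subrr.
have y2N : y2 \notin W.
  apply: contra x2N => /W_W1 h.
  rewrite -(subrK ((bf A x1 x2 / bf A x1 x1) *: x1) x2).
  by apply: subspaceD => //; exact: subspaceZ.
have q2 := nonzero y2V y2N.
have b22 : bf A y2 y2 != 0 by rewrite bxx mulf_neq0.
have y2W2 : y2 \in W2 by apply: subspaceB => //; apply: subspaceZ => //; exact: W1_W2.
pose y3 := x3 - ((bf A x1 x3 / bf A x1 x1) *: x1 + (bf A y2 x3 / bf A y2 y2) *: y2).
have b1y3 : bf A x1 y3 = 0.
  rewrite /y3 -[- _]scaleN1r bfDr bfZr bfDr !bfZr b1y2 mulr0 addr0 divfK //.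
  by rewrite mulN1r subrr.
have b2y3 : bf A y2 y3 = 0.
  rewrite /y3 -[- _]scaleN1r bfDr bfZr bfDr !bfZr (bfC A y2 x1) b1y2 mulr0 add0r divfK //.
  by rewrite mulN1r subrr.
have y3V : y3 \in V.
  by apply: subspaceB => //; apply: subspaceD => //; exact: subspaceZ.
have [a [b ab]] := finField_two_squares (- qf A y3) c2 q1 q2.
have : a *: x1 + (b *: y2 + y3) \in W.
  apply: zero_vtx; first by case: (sV) => _ h; apply: (h) => //; apply: h.
  rewrite qfD qfZ bfZl bfDr bfZr b1y2 b1y3 qfD qfZ bfZl b2y3.
  have -> : a ^+ 2 * qf A x1 + (b ^+ 2 * qf A y2 + qf A y3 + b * 0) + a * (b * 0 + 0)
    = (qf A x1 * a ^+ 2 + qf A y2 * b ^+ 2) + qf A y3 by ring.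
  by rewrite ab addNr.
move=> /W_W1/W1_W2 h; case/negP: x3N.
have y3W2 : y3 \in W2.
  have -> : y3 = (a *: x1 + (b *: y2 + y3)) - (a *: x1 + b *: y2).
    by rewrite addrA [_ + y3]addrC addrK.
  apply: subspaceB => //; apply: subspaceD => //; apply: subspaceZ => //; exact: W1_W2.
rewrite -(subrK ((bf A x1 x3 / bf A x1 x1) *: x1 + (bf A y2 x3 / bf A y2 y2) *: y2) x3).
apply: subspaceD => //; apply: subspaceD => //; apply: subspaceZ => //; exact: W1_W2.
Qed.

Lemma anisotropic_card : exists2 e, (e <= 2)%N & #|V| = (q ^ e * #|vtx V|)%N.
Proof.
have sW := vtx_subspace sV; have WV : vtx V \subset V by apply/subsetP => x /vtxP[].
have grow U : U \subset V -> V = U \/ exists2 x, x \in V & x \notin U.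
  move=> UV; have [VU|/subsetPn[x xV xU]] := boolP (V \subset U).
    by left; apply/eqP; rewrite eqEsubset VU UV.
  by right; exists x.
case: (grow _ WV) => [VE|[x1 x1V x1N]].
  by exists 0%N => //; rewrite mul1n {1}VE.
have sW1 := add_line_subspace x1 sW; have W1V := add_line_min sV WV x1V.
have c1 := card_add_line sW x1N.
case: (grow _ W1V) => [VE|[x2 x2V x2N]].
  by exists 1%N => //; rewrite {1}VE c1 expn1.
have sW2 := add_line_subspace x2 sW1; have W2V := add_line_min sV W1V x2V.
have c2 := card_add_line sW1 x2N.
case: (grow _ W2V) => [VE|[x3 x3V x3N]].
  by exists 2%N => //; rewrite {1}VE c2 c1 mulnA.
by case: (anisotropic_no_three x1V x2V x3V x1N x2N x3N).
Qed.

End Anisotropic.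

(** The zero counts of hyperbolic, parabolic and elliptic forms with [w] vectors in the vertex,
    arranged so as to avoid division and subtraction in [nat]. *)
Definition zero_count h e w N :=
  match e with
  | 0 => q * N = q ^ (h + h) * w + q.-1 * q ^ h * w
  | 1 => N = q ^ (h + h) * w
  | _ => q * N + q.-1 * q ^ h.+1 * w = q ^ (h + h + 2) * w
  end%N.

(* [h] hyperbolic planes, an anisotropic part of dimension [e], and the vertex. *)
Lemma classification V : subspace V -> exists h e, [/\ (e <= 2)%N,
   #|V| = (q ^ (h + h + e) * #|vtx V|)%N, zero_count h e #|vtx V| #|zeros V| &
   exists I, [/\ subspace I, I \subset zeros V & #|V| = (q ^ (h + e) * #|I|)%N]].
Proof.
have q1 : (1 < q)%N := card_finNzRing_gt1 F.
have [p] := ubnP #|V|; elim: p => // p IH in V *; move=> Vp sV.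
have [iso|niso] := boolP (zeros V \subset vtx V).
  have VE : zeros V = vtx V.
    apply/eqP; rewrite eqEsubset iso /=; apply/subsetP => x /vtxP[xV x0 _].
    by rewrite inE xV x0 /=.
  have [e e2 cV] := anisotropic_card sV VE; exists 0%N, e; split=> //.
    rewrite VE; case: e e2 {cV} => [|[|[|//]]] _ /=.
    - by rewrite !mul1n muln1 -{2}[#|vtx V|]mul1n -mulnDl add1n prednK // ltnW.
    - by rewrite mul1n.
    - by rewrite expn1 -mulnA -mulSn prednK ?(ltnW q1) // expnS expn1 mulnA.
  by exists (vtx V); split; rewrite ?VE //; exact: vtx_subspace.
have /subsetPn[x] := niso; rewrite inE => /andP[xV /eqP x0] xN.
have [y yV bxy] : exists2 y, y \in V & bf A x y != 0.
  apply/exists_inP; apply: contraR xN; rewrite negb_exists_in => /forall_inP h.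
  by apply/vtxP; split=> // y /h; rewrite negbK => /eqP.
have bxx := bf_self_zero x0.
have {y yV bxy} [y [yV y0 bxy]] : exists y, [/\ y \in V, qf A y = 0 & bf A x y = 1].
  have [y1 y1V b1] : exists2 y1, y1 \in V & bf A x y1 = 1.
    by exists ((bf A x y)^-1 *: y); [exact: subspaceZ | rewrite bfZr mulVf].
  exists (y1 - qf A y1 *: x); split.
  - by apply: subspaceB => //; exact: subspaceZ.
  - by rewrite -scaleNr qfD qfZ x0 bfZr (bfC A y1) b1; ring.
  - by rewrite -scaleNr bfDr bfZr bxx b1 mulr0 addr0.
have byy := bf_self_zero y0.
have [V' V'E] : exists V' : {set 'rV[F]_n},
    forall z, (z \in V') = [&& z \in V, bf A x z == 0 & bf A y z == 0].
  by exists [set z in V | (bf A x z == 0) && (bf A y z == 0)] => z; rewrite inE.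
have V'P z : reflect [/\ z \in V, bf A x z = 0 & bf A y z = 0] (z \in V').
  by rewrite V'E; apply: (iffP and3P) => -[? /eqP ? /eqP ?].
have sV' : subspace V'.
  split; first by apply/V'P; split; rewrite ?(bfC A _ 0) ?bf0l //; case: sV.
  move=> a u w /V'P[uV u1 u2] /V'P[wV w1 w2]; apply/V'P.
  split; first by case: sV => _; apply.
    by rewrite bfDr bfZr u1 w1 mulr0 addr0.
  by rewrite bfDr bfZr u2 w2 mulr0 addr0.
(* [V] is the orthogonal sum of the hyperbolic plane on [x] and [y] and of [V'], to which the
   induction applies. *)
pose phi (t : (F * F) * 'rV[F]_n) := t.1.1 *: x + (t.1.2 *: y + t.2).
have bphi t : t.2 \in V' -> bf A x (phi t) = t.1.2 /\ bf A y (phi t) = t.1.1.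
  move=> /V'P[_ h1 h2]; rewrite /phi !bfDr !bfZr bxx bxy (bfC A y x) bxy byy h1 h2.
  by split; ring.
have phi_inj : {in setX setT V' &, injective phi}.
  move=> [[a b] z] [[c d] w]; rewrite !inE /= => zV wV e.
  have [e1 e2] := bphi ((a, b), z) zV; have [e3 e4] := bphi ((c, d), w) wV.
  rewrite e e3 /= in e1; rewrite e e4 /= in e2; subst b a; congr (_, _).
  by move: e; rewrite /phi /= => /addrI/addrI.
have phi_im : V = phi @: setX setT V'.
  apply/setP => v; apply/idP/imsetP => [vV|[[[a b] z]]]; last first.
    rewrite !inE /= => /V'P[zV _ _] ->; rewrite /phi /=.
    by apply: (subspaceD sV); [|apply: (subspaceD sV) => //]; exact: (subspaceZ _ sV).
  exists ((bf A y v, bf A x v), v - (bf A y v *: x + bf A x v *: y)); last first.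
    by rewrite /phi /= addrA addrC subrK.
  rewrite !inE /=; apply/V'P; split.
  - by apply: (subspaceB sV) => //; apply: (subspaceD sV); exact: (subspaceZ _ sV).
  - by rewrite -[- _]scaleN1r bfDr bfZr bfDr !bfZr bxx bxy; ring.
  - by rewrite -[- _]scaleN1r bfDr bfZr bfDr !bfZr (bfC A y x) bxy byy; ring.
have cV : #|V| = (q * q * #|V'|)%N.
  by rewrite {1}phi_im card_in_imset // cardsX cardsT card_prod.
have vV : vtx V = vtx V'.
  apply/setP => z; apply/vtxP/vtxP => [[zV z0 h]|[/V'P[zV z1 z2] z0 h]]; split=> //.
  - by apply/V'P; split; rewrite // bfC h.
  - by move=> u /V'P[uV _ _]; exact: h.
  - move=> u; rewrite phi_im => /imsetP[[[a b] w]]; rewrite !inE /= => wV' ->.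
    by rewrite /phi /= !bfDr !bfZr (bfC A z x) (bfC A z y) z1 z2 h ?inE // !mulr0 !addr0.
have V'0 : (0 < #|V'|)%N by apply/card_gt0P; exists 0; case: sV'.
have [|h [e [e2 cV' cN [I [sI IZ cI]]]]] := IH V' _ sV'.
  apply: leq_trans (_ : #|V| <= p)%N; last by [].
  by rewrite cV -[ltnLHS]mul1n ltn_pmul2r //; nia.
(* The form is [a b + qf A z] at [a x + b y + z], so each [z] contributes [q - 1] pairs, and [q]
   more when [qf A z] is zero. *)
have cZ : #|zeros V| = (q * #|zeros V'| + q.-1 * #|V'|)%N.
  have -> : #|zeros V| = (\sum_(z in V') #|[set p : F * F | (p.1 * p.2)%R == - qf A z]|)%N.
    have -> : zeros V = phi @: [set t in setX setT V' | qf A (phi t) == 0].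
      apply/setP => v; rewrite inE {1}phi_im; apply/andP/imsetP => [[/imsetP[t tV ->] t0]|[t]].
        by exists t; rewrite // inE tV t0.
      by rewrite inE => /andP[tV t0] ->; split=> //; apply/imsetP; exists t.
    rewrite card_in_imset; last first.
      by move=> t u; rewrite !inE /= => /andP[? _] /andP[? _]; apply: phi_inj; rewrite !inE.
    rewrite -sum1_card (partition_big snd (mem V')) /=; last first.
      by move=> t; rewrite !inE => /andP[].
    apply: eq_bigr => z zV'; rewrite sum1_card.
    rewrite -[RHS](card_imset _ (_ : injective (fun p : F * F => (p, z)))); last by move=> ? ? [].
    apply: eq_card => -[[a b] w]; rewrite unfold_in /= !inE /=.
    have qphi : w \in V' -> qf A (phi ((a, b), w)) = a * b + qf A w.
      move=> /V'P[_ h1 h2].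
      by rewrite /phi /= !qfD !qfZ x0 y0 !bfDr !bfZl !bfZr bxy h1 h2; ring.
    apply/andP/imsetP => [[/andP[wV' w0] /eqP wz]|[[c d]]].
      subst w; exists (a, b) => //; rewrite inE /= -subr_eq0 opprK.
      by rewrite -qphi // inE.
    rewrite inE /= => cd [ac bd wz]; subst a b w; split=> //.
    by rewrite zV' qphi // (eqP cd) addNr eqxx.
  rewrite (eq_bigr _ (fun z _ => card_mul_eq _)) big_split /= sum_nat_const addnC.
  rewrite [(#|V'| * _)%N]mulnC; congr (_ + _)%N.
  rewrite -big_mkcondr /= sum_nat_const mulnC.
  by congr (_ * _)%N; apply: eq_card => z; rewrite unfold_in /= !inE oppr_eq0.
exists h.+1, e; split=> //.
- by rewrite vV cV cV' addSn addnS !addSn !expnS !mulnA.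
- rewrite vV cZ cV'; move: #|vtx V'| #|zeros V'| cN => w N.
  rewrite /zero_count addSn addnS !addSn !expnS.
  move: q q1 => [//|q'] _ /=.
  case: e e2 {cV' cI} => [|[|[|//]]] _ /=; rewrite ?addn0 ?expnD ?expnS ?expn0 ?muln1.
  + move: (q'.+1 ^ h)%N => X; nia.
  + move: (q'.+1 ^ h)%N => X; nia.
  + move: (q'.+1 ^ h)%N => X; nia.
have IP z : z \in I -> [/\ z \in V, bf A x z = 0, bf A y z = 0 & qf A z = 0].
  by move=> /(subsetP IZ); rewrite inE => /andP[/V'P[? ? ?] /eqP ?].
have xI : x \notin I by apply/negP => /IP[_ _ + _]; rewrite bfC bxy => /eqP; rewrite oner_eq0.
exists (add_line I x); split; first exact: add_line_subspace.
  apply/subsetP => z /add_lineP[a /IP[zV z1 z2 z0] _].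
  have -> : z = (z - a *: x) + a *: x by rewrite subrK.
  move: (z - a *: x) zV z1 z2 z0 => u uV u1 u2 u0; rewrite inE.
  rewrite (subspaceD sV uV (subspaceZ _ sV xV)) qfD qfZ u0 x0 bfZr (bfC A u) u1.
  by rewrite !mulr0 !addr0 eqxx.
by rewrite card_add_line // cV cI addSn expnS !mulnA; congr (_ * _)%N; rewrite mulnAC.
Qed.

End Classification.

Section QuadraticRank.
Variables (F : finFieldType) (n : nat).
Implicit Type A : 'M[F]_n.
Local Notation q := #|F|.

Definition vertex A := vtx A [set: 'rV[F]_n].
(** The codimension of the vertex, read off its cardinality. In characteristic 2 it can exceed the
    rank of the polar form by one. *)
Definition qrank A : nat := n - trunc_log q #|vertex A|.

Lemma setT_subspace : subspace [set: 'rV[F]_n].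
Proof. by split; [rewrite inE | move=> *; rewrite inE]. Qed.

Let q1 : (1 < q)%N := card_finNzRing_gt1 F.
Let q0 : (0 < q)%N := ltnW q1.

Lemma card_rV : #|[set: 'rV[F]_n]| = (q ^ n)%N.
Proof. by rewrite cardsT card_mx mul1n. Qed.

Lemma qrank_classification A : exists h e, [/\ (e <= 2)%N, qrank A = (h + h + e)%N,
  (qrank A <= n)%N, #|vertex A| = (q ^ (n - qrank A))%N &
  zero_count F h e #|vertex A| #|zeros A [set: 'rV[F]_n]|] /\
  exists M : 'M[F]_n, (forall x, (x <= M)%MS -> qf A x = 0) /\ (n = \rank M + (h + e))%N.
Proof.
have [h [e [e2 cV cN [I [sI IZ cI]]]]] := classification A setT_subspace.
rewrite -/(vertex A) card_rV in cV cN cI.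
have w0 : (0 < #|vertex A|)%N.
  by apply/card_gt0P; exists 0; case: (vtx_subspace A setT_subspace).
have le : (h + h + e <= n)%N.
  by rewrite -(leq_exp2l _ _ q1) cV leq_pmulr.
have cW : #|vertex A| = (q ^ (n - (h + h + e)))%N.
  apply/eqP; rewrite -(eqn_pmul2l (m := q ^ (h + h + e))) ?expn_gt0 ?q0 //.
  by rewrite -cV -expnD subnKC.
have rE : qrank A = (h + h + e)%N by rewrite /qrank cW trunc_expnK // subKn.
exists h, e; rewrite -rE in cW le.
split; first by split.
have [M hM] := subspace_mx sI; exists M; split.
  by move=> x; rewrite hM => /(subsetP IZ); rewrite inE => /andP[_ /eqP].
have IE : I = [set x : 'rV[F]_n | (x <= M)%MS] by apply/setP => x; rewrite inE hM.
move: cI; rewrite IE card_mx_rows -expnD => /(congr1 (trunc_log q)).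
by rewrite !trunc_expnK // addnC.
Qed.

Lemma qrank_le A : (qrank A <= n)%N.
Proof. exact: leq_subr. Qed.

Lemma card_vertex A : #|vertex A| = (q ^ (n - qrank A))%N.
Proof. by have [h [e [[]]]] := qrank_classification A. Qed.

(** The subspace of the classification has codimension [h + e], with [e <= 2], and the rank is
    [2 h + e]. *)
Lemma isotropic_subspace A : exists M : 'M[F]_n,
  (forall x, (x <= M)%MS -> qf A x = 0) /\ (n <= \rank M + (qrank A)./2.+1)%N.
Proof.
have [h [e [[e2 rE _ _ _] [M [hM nE]]]]] := qrank_classification A.
exists M; split=> //; rewrite {1}nE leq_add2l rE addnn.
rewrite halfD odd_double doubleK /= add0n -addnS leq_add2l.
by case: e e2 {rE nE} => [|[|[|]]].
Qed.

(** The sign is 1 for the hyperbolic type, -1 for the elliptic type and 0 for odd rank. *)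
Lemma zeros_sign A : exists s : int, [/\ s \in [:: 0; 1; -1], odd (qrank A) -> s = 0 &
  (q * #|zeros A [set: 'rV[F]_n]|)%:Z
  = (q ^ n)%:Z + s * (q.-1 * q ^ (n - (qrank A)./2))%:Z].
Proof.
have [h [e [[e2 rE rn cW cN] _]]] := qrank_classification A.
move: cN; rewrite cW; set N := #|zeros _ _|; rewrite rE in rn *.
case: e e2 rE rn => [|[|[|//]]] _ rE rn /= cN;
  rewrite ?addn0 ?addn1 ?addn2 /= ?addnn ?odd_double ?doubleK ?uphalf_double in rn *.
- exists 1; split=> //; rewrite mul1r cN -PoszD; congr (Posz (_ + _)).
    by rewrite -expnD; congr (q ^ _)%N; lia.
  by rewrite -mulnA -expnD; congr (_ * q ^ _)%N; lia.
- exists 0; split=> //; rewrite mul0r addr0 cN mulnA -expnS -expnD; congr (Posz (q ^ _)); lia.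
- exists (-1); split=> //.
  have : (q * N + q.-1 * q ^ (n - h.+1) = q ^ n)%N.
    have -> : (q ^ (n - h.+1) = q ^ h.+1 * q ^ (n - (h + h + 2)))%N.
      by rewrite -expnD; congr (q ^ _)%N; lia.
    rewrite mulnA cN -expnD; congr (q ^ _)%N; lia.
  by move=> <-; rewrite PoszD mulN1r addrK.
Qed.

End QuadraticRank.

(** * Counting the common zeros of a system *)

Section SystemCount.
Variables (F : finFieldType) (d r : nat) (Q : 'I_r -> 'M[F]_d).
Local Notation q := #|F|.
Let q1 : (1 < q)%N := card_finNzRing_gt1 F.
Let q0 : (0 < q)%N := ltnW q1.

Definition common_zeros := [set x : 'rV[F]_d | [forall k, qf (Q k) x == 0]].

(** For fixed [x] the value [qf (comb Q c) x] is linear in [c], and this linear function is zero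
    exactly when [x] is a common zero. *)
Lemma card_forms_vanishing x :
  (q * #|[set c : 'rV[F]_r | qf (comb Q c) x == 0%R]|
   = (if x \in common_zeros then q else 1) * q ^ r)%N.
Proof.
pose v : 'cV[F]_r := \col_k qf (Q k) x.
have -> : [set c : 'rV[F]_r | qf (comb Q c) x == 0] = [set c : 'rV[F]_r | (c <= kermx v)%MS].
  apply/setP => c; rewrite !inE qf_comb; apply/eqP/sub_kermxP => [h|/(congr1 (fun A : 'M_1 => A 0 0))].
    apply/rowP => i; rewrite ord1 mxE [RHS]mxE -[RHS]h; apply: eq_bigr => k _; by rewrite mxE.
  by rewrite mxE [RHS]mxE => h; rewrite -[RHS]h; apply: eq_bigr => k _; rewrite mxE.
rewrite card_mx_rows mxrank_ker; case: ifP => [|/negbT]; rewrite inE.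
  move=> /forallP h; have -> : v = 0; last by rewrite mxrank0 subn0.
  by apply/colP => k; rewrite !mxE; apply/eqP.
rewrite negb_forall => /existsP[k hk]; have rv : \rank v = 1%N.
  apply/eqP; rewrite eqn_leq rank_leq_col lt0n mxrank_eq0.
  by apply: contra hk => /eqP/(congr1 (fun A : 'cV_r => A k 0)); rewrite !mxE => ->.
rewrite rv mul1n -expnS subn1 prednK //; exact: leq_ltn_trans (leq0n k) (ltn_ord k).
Qed.

Lemma sum_zeros : (q * \sum_(c : 'rV[F]_r) #|zeros (comb Q c) [set: 'rV[F]_d]|
  = #|common_zeros| * (q.-1 * q ^ r) + q ^ d * q ^ r)%N.
Proof.
have -> : (\sum_(c : 'rV[F]_r) #|zeros (comb Q c) [set: 'rV[F]_d]|
  = \sum_x #|[set c : 'rV[F]_r | qf (comb Q c) x == 0%R]|)%N.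
  transitivity (\sum_(c : 'rV[F]_r) \sum_(x | qf (comb Q c) x == 0%R) 1)%N.
    by apply: eq_bigr => c _; rewrite -sum1_card; apply: eq_bigl => x; rewrite !inE.
  rewrite (exchange_big_dep predT) //=; apply: eq_bigr => x _.
  by rewrite -sum1_card; apply: eq_bigl => c; rewrite !inE.
rewrite big_distrr /= (eq_bigr _ (fun x _ => card_forms_vanishing x)) -big_distrl /=.
have -> : (\sum_(x : 'rV[F]_d) (if x \in common_zeros then q else 1)
   = #|common_zeros| * q.-1 + q ^ d)%N.
  rewrite (eq_bigr (fun x => (if x \in common_zeros then q.-1 else 0) + 1)%N).
    by rewrite big_split -big_mkcond /= sum_nat_const sum1_card card_mx mul1n.
  by move=> x _; case: ifP => _; rewrite ?addn1 ?prednK.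
by rewrite mulnDl mulnA.
Qed.

(** Double counting of the pairs of a form [c] and a zero of it takes the place of exponential sums:
    both sides lose the main term [q ^ (d + r)], and a factor [q - 1] cancels. *)
Lemma common_zeros_signed_sum : exists s : 'rV[F]_r -> int,
  [/\ forall c, s c \in [:: 0; 1; -1], forall c, odd (qrank (comb Q c)) -> s c = 0,
      s 0 = 1, qrank (comb Q 0) = 0%N
    & (#|common_zeros| * q ^ r)%:Z
      = \sum_c s c * (q ^ (d - (qrank (comb Q c))./2))%:Z].
Proof.
have [s hs] := fin_all_exists (fun c => zeros_sign (comb Q c)).
have Q0 : comb Q 0 = 0 by rewrite /comb big1 // => k _; rewrite mxE scale0r.
have z0 x : qf (0 : 'M[F]_d) x = 0 by rewrite /qf mulmx0 mul0mx mxE.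
have b0 x y : bf (0 : 'M[F]_d) x y = 0.
  by rewrite /bf /pol trmx0 addr0 mulmx0 mul0mx mxE.
have r0 : qrank (comb Q 0) = 0%N.
  have : vertex (comb Q 0) = [set: 'rV[F]_d].
    by rewrite Q0; apply/setP => x; rewrite in_setT; apply/vtxP; split=> [||y _];
      [rewrite inE | exact: z0 | exact: b0].
  by rewrite /qrank => ->; rewrite card_rV trunc_expnK // subnn.
have qm : (0 < q.-1)%N by rewrite -ltnS prednK.
exists s; split=> //.
- by move=> c; have [] := hs c.
- by move=> c; have [_ + _] := hs c; apply.
- have [_ _] := hs 0; rewrite r0 subn0.
  have -> : zeros (comb Q 0) [set: 'rV[F]_d] = [set: 'rV[F]_d].
    by rewrite Q0; apply/setP => x; rewrite !inE z0 eqxx.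
  rewrite card_rV => e; apply/eqP.
  have h : (s 0 - 1) * (q.-1 * q ^ d)%:Z = 0.
    have qE : (q * q ^ d)%:Z = (q ^ d)%:Z + (q.-1 * q ^ d)%:Z.
      by rewrite -PoszD -{2}[(q ^ d)%N]mul1n -mulnDl add1n prednK.
    by move: e; rewrite qE => /addrI e; rewrite mulrBl mul1r -e subrr.
  move/eqP: h; rewrite mulf_eq0 subr_eq0 => /orP[//|].
  by rewrite eqz_nat gtn_eqF // muln_gt0 qm expn_gt0 q0.
have := congr1 Posz sum_zeros; rewrite big_distrr /= PoszD.
rewrite (big_morph Posz PoszD (erefl _)).
under eq_bigr => c _ do (have [_ _ ->] := hs c).
rewrite big_split /= sumr_const card_mx mul1n -mulr_natr natz -PoszM addrC => /addIr.
under eq_bigr => c _ do rewrite PoszM mulrCA.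
rewrite -mulr_sumr mulnCA PoszM => /mulfI ->; first by [].
by rewrite eqz_nat gtn_eqF.
Qed.

End SystemCount.

Section ZeroCountBounds.
Variables (F : finFieldType) (d r : nat) (Q : 'I_r -> 'M[F]_d).
Local Notation q := #|F|.
Let q1 : (1 < q)%N := card_finNzRing_gt1 F.
Let q0 : (0 < q)%N := ltnW q1.

Definition even_rank_forms t := [set c : 'rV[F]_r | qrank (comb Q c) == t.*2].

Lemma sum_even_rank (P : pred 'rV[F]_r) (f : nat -> nat) :
  (\sum_(c | P c && ~~ odd (qrank (comb Q c))) f (qrank (comb Q c))./2
   = \sum_(0 <= t < d./2.+1) #|[set c in even_rank_forms t | P c]| * f t)%N.
Proof.
rewrite big_mkord (partition_big (fun c => inord (qrank (comb Q c))./2 : 'I_d./2.+1) predT) //=.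
apply: eq_bigr => t _; rewrite -sum_nat_const.
apply: congr_big => // [c|c]; last first.
  by move=> /andP[_ /eqP <-]; rewrite inordK // ltnS half_leq // qrank_le.
rewrite !inE; case: (P c); rewrite ?andbF //= andbT -(inj_eq val_inj) /=.
rewrite inordK ?ltnS ?half_leq ?qrank_le //.
apply/andP/eqP => [[ev /eqP <-]|->]; last by rewrite odd_double doubleK.
by rewrite -[LHS]odd_double_half (negbTE ev).
Qed.

Lemma common_zeros_upper :
  (#|common_zeros Q| * q ^ r <= \sum_(0 <= t < d./2.+1) #|even_rank_forms t| * q ^ (d - t))%N.
Proof.
have [s [hs so _ _ e]] := common_zeros_signed_sum Q.
rewrite -lez_nat e.
have -> : (\sum_(0 <= t < d./2.+1) #|even_rank_forms t| * q ^ (d - t)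
  = \sum_(c | ~~ odd (qrank (comb Q c))) q ^ (d - (qrank (comb Q c))./2))%N.
  rewrite (sum_even_rank predT (fun t => q ^ (d - t))%N); apply: eq_bigr => t _.
  by congr (_ * _)%N; apply: eq_card => c; rewrite !inE andbT.
rewrite (big_morph Posz PoszD (erefl _)) [leRHS]big_mkcond ler_sum // => c _.
have := hs c; case: ifP => [_|/negbFE/so ->]; last by rewrite mul0r.
by rewrite !inE => /or3P[] /eqP->; rewrite ?mul0r ?mul1r ?mulN1r // -subr_ge0 opprK addr_ge0.
Qed.

Lemma common_zeros_lower t0 :
  (forall c, c != 0 -> ~~ odd (qrank (comb Q c)) -> (t0 <= (qrank (comb Q c))./2)%N) ->
  (q ^ d <= #|common_zeros Q| * q ^ r
      + \sum_(t0 <= t < d./2.+1) #|even_rank_forms t| * q ^ (d - t))%N.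
Proof.
move=> ht; have [s [hs so s0 r0 e]] := common_zeros_signed_sum Q.
rewrite -lez_nat PoszD e (bigD1 0) //= s0 r0 subn0 mul1r -addrA lerDl.
pose P := [pred c : 'rV[F]_r | c != 0].
have le : (\sum_(c | P c && ~~ odd (qrank (comb Q c))) q ^ (d - (qrank (comb Q c))./2)
    <= \sum_(t0 <= t < d./2.+1) #|even_rank_forms t| * q ^ (d - t))%N.
  rewrite (sum_even_rank P (fun t => q ^ (d - t))%N).
  have [le|lt] := leqP t0 d./2.+1; last first.
    rewrite big_nat big1 // => t td; apply/eqP; rewrite muln_eq0 cards_eq0; apply/orP; left.
    apply/eqP/setP => c; rewrite !inE; apply/negP => /andP[/eqP ct /ht].
    rewrite ct odd_double doubleK => /(_ isT); lia.
  rewrite (big_cat_nat (n := t0)) //= [X in (X + _)%N]big_nat big1 ?add0n; last first.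
    move=> t tt; apply/eqP; rewrite muln_eq0 cards_eq0; apply/orP; left.
    apply/eqP/setP => c; rewrite !inE; apply/negP => /andP[/eqP ct /ht].
    rewrite ct odd_double doubleK => /(_ isT); lia.
  apply: leq_sum => t _; rewrite leq_mul2r; apply/orP; right.
  by apply/subset_leq_card/subsetP => c; rewrite !inE => /andP[].
apply: (@le_trans _ _ (\sum_(i | i != 0) s i * (q ^ (d - (qrank (comb Q i))./2))%:Z
   + (\sum_(c | P c && ~~ odd (qrank (comb Q c))) q ^ (d - (qrank (comb Q c))./2))%N%:Z)); last first.
  by rewrite lerD2l lez_nat.
rewrite (big_morph Posz PoszD (erefl _)) [X in _ + X]big_mkcondr -big_split /= sumr_ge0 // => c c0.
have := hs c; case: ifP => [_|/negbFE/so ->]; last by rewrite mul0r.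
by rewrite !inE => /or3P[] /eqP->; rewrite ?mul0r ?mul1r ?mulN1r ?add0r ?addNr // addr_ge0.
Qed.

(** Each exponent in the signed sum is at least [r + 1]. Consequently a nonempty zero set has at
    least [q] elements. *)
Lemma card_common_zeros_dvd : (2 * r < d)%N -> (q %| #|common_zeros Q|)%N.
Proof.
move=> dr; have [s [_ _ _ _ e]] := common_zeros_signed_sum Q.
rewrite -(dvdn_pmul2r (p := q ^ r)) ?expn_gt0 ?q0 // -expnS.
rewrite -[(_ %| _)%N]/((q ^ r.+1)%:Z %| (#|common_zeros Q| * q ^ r)%:Z)%Z e.
apply: rpred_sum => c _; apply: dvdz_mull; rewrite dvdzE /=; apply: dvdn_exp2l.
have := qrank_le (comb Q c); have := odd_double_half (qrank (comb Q c)).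
move: (qrank _) => R; lia.
Qed.

End ZeroCountBounds.

Section RadicalVertex.
Variables (F : finFieldType) (n : nat) (A : 'M[F]_n).
Local Notation q := #|F|.
Let q1 : (1 < q)%N := card_finNzRing_gt1 F.
Let q0 : (0 < q)%N := ltnW q1.

Definition radical := [set x : 'rV[F]_n | x *m pol A == 0].

Lemma radicalP x : reflect (x *m pol A = 0) (x \in radical).
Proof. by rewrite inE; apply: eqP. Qed.

Lemma radical_bf x y : x \in radical -> bf A x y = 0.
Proof. by move=> /radicalP h; rewrite /bf h mul0mx mxE. Qed.

Lemma radicalE x : (forall y, bf A x y = 0) -> x \in radical.
Proof.
move=> h; apply/radicalP/rowP => i; rewrite [RHS]mxE -(h (delta_mx 0 i)) /bf.
by rewrite trmx_delta -colE [RHS]mxE.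
Qed.

Lemma radical_subspace : subspace radical.
Proof.
split; first by apply/radicalP; rewrite mul0mx.
move=> a x y /radicalP hx /radicalP hy; apply/radicalP.
by rewrite mulmxDl -scalemxAl hx hy scaler0 addr0.
Qed.

Lemma card_radical : #|radical| = (q ^ (n - \rank (pol A)))%N.
Proof.
rewrite -mxrank_ker -card_mx_rows; apply: eq_card => x; rewrite !inE.
by apply/eqP/sub_kermxP.
Qed.

Lemma vertexE x : (x \in vertex A) = (x \in radical) && (qf A x == 0).
Proof.
apply/vtxP/andP => [[_ x0 h]|[xR /eqP x0]].
  by rewrite x0 eqxx; split=> //; apply: radicalE => y; apply: h; rewrite inE.
by split=> [||y _]; [rewrite inE | | exact: radical_bf].
Qed.

Lemma rank_pol_odd_char : 1 + 1 != 0 :> F -> radical = vertex A /\ \rank (pol A) = qrank A.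
Proof.
move=> c2; have RE : radical = vertex A.
  apply/setP => x; rewrite vertexE; case xR: (x \in radical) => //=; apply/esym/eqP.
  have := radical_bf x xR; rewrite bfxx => /eqP.
  by rewrite -mulr_natl mulf_eq0 mulr2n (negbTE c2) /= => /eqP.
split=> //; have := card_vertex A; rewrite -RE card_radical => /(congr1 (trunc_log q)).
rewrite !trunc_expnK //; have := qrank_le A; have := rank_leq_row (pol A).
by move: (\rank _) (qrank A) => a b; lia.
Qed.

(** On the radical the form is additive, scales by squares, and every scalar is a square, so the
    vertex has codimension at most one in the radical. The parity holds because the polar form is
    alternating. *)
Lemma rank_pol_char2 : 1 + 1 = 0 :> F ->
  ~~ odd (\rank (pol A)) /\ (\rank (pol A) = qrank A \/ (\rank (pol A)).+1 = qrank A).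
Proof.
move=> c2; split.
  have [I0 [h0 <- _]] := alternating_pivot (pol_sym A) (pol_alt c2 A) c2.
  apply: contraNN h0 => o; rewrite hafnian_odd //.
  by move=> i j; rewrite -{1}(pol_sym A) mxE.
have vR : vertex A \subset radical by apply/subsetP => x; rewrite vertexE => /andP[].
have le1 := subset_leq_card vR.
have le2 : (#|radical| <= q * #|vertex A|)%N.
  have [sub|/subsetPn[x xR xV]] := boolP (radical \subset vertex A).
    by apply: leq_trans (subset_leq_card sub) _; rewrite leq_pmull.
  have x0 : qf A x != 0 by apply: contra xV => h; rewrite vertexE xR h.
  rewrite -(card_add_line (vtx_subspace A (setT_subspace F n)) xV).
  apply/subset_leq_card/subsetP => y yR; apply/add_lineP.
  have [l hl] := finField_sqrt_char2 (qf A y / qf A x) c2.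
  exists l => //; rewrite -/(vertex A) vertexE -scaleNr; apply/andP; split.
    by apply: (subspaceD radical_subspace) => //; apply: (subspaceZ _ radical_subspace).
  rewrite qfD qfZ sqrrN hl divfK // radical_bf // addr0.
  by rewrite -[X in X + X]mul1r -mulrDl c2 mul0r.
move: le1 le2; rewrite card_vertex card_radical -expnS !leq_exp2l //.
have := qrank_le A; have := rank_leq_row (pol A).
by move: (\rank _) (qrank A) => a b; lia.
Qed.

End RadicalVertex.

Section EvenRankCount.
Variables (F : finFieldType) (n r : nat) (Q : 'I_r -> 'M[F]_n).
Local Notation q := #|F|.

Definition vertex_tangent_le c s := forall C : 'M[F]_r,
  (forall (c' : 'rV_r) x, (c' <= C)%MS -> x \in vertex (comb Q c) -> qf (comb Q c') x = 0) ->
  (\rank C <= s)%N.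

(** In characteristic 2 the polar rank is even and differs from [qrank] by at most one, so they
    agree when [qrank] is even. The radical is then the vertex, as it always is in odd
    characteristic. *)
Lemma card_even_rank_forms t s (S : {set 'rV[F]_r}) : (s <= r)%N ->
  (forall c, c \in S -> qrank (comb Q c) = t.*2 /\ vertex_tangent_le c s) ->
  (#|S| <= t.*2.+1 ^ (r - s) * q ^ s)%N.
Proof.
move=> sr hS; have [c2|c2] := eqVneq (1 + 1 : F) 0.
  apply: (@card_even_stratum_char2 _ n r Q) => // c cS; have [rc tc] := hS c cS.
  have [ev rk] := rank_pol_char2 (comb Q c) c2.
  have rE : \rank (pol (comb Q c)) = t.*2.
    case: rk => [->//|rk]; move: ev; rewrite -[_ (\rank _)]negbK -oddS rk rc odd_double //.
  have RV : radical (comb Q c) = vertex (comb Q c).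
    apply/esym/eqP; rewrite eqEcard card_vertex card_radical rE rc leqnn andbT.
    by apply/subsetP => x; rewrite vertexE => /andP[].
  split=> //.
    by move=> x /radicalP; rewrite RV vertexE => /andP[_ /eqP].
  move=> C hC; apply: tc => c' x c'C; rewrite -RV => /radicalP; exact: hC.
apply: (@card_stratum_minors _ n r Q) => // c cS; have [rc tc] := hS c cS.
have [RV ->] := rank_pol_odd_char (comb Q c) c2; split=> //.
move=> C hC; apply: tc => c' x c'C; rewrite -RV => /radicalP xR.
have := hC c' x x c'C xR xR; rewrite bfxx => /eqP.
by rewrite -mulr_natl mulf_eq0 mulr2n (negbTE c2) /= => /eqP.
Qed.

End EvenRankCount.

(** * Numerical estimates *)

Section Numerics.
Variables (q n r : nat).

(* [2 r x / n]: the largest possible dimension of a space of forms vanishing on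
   a subspace of codimension [x]. *)
Definition slope x := ((2 * r * x) %/ n)%N.

(** The exponent of [D] is an integer because [s], a slope, can exceed [r], as in [Cconst]. *)
Definition bezout_bound D s : rat := D%:R ^ (r%:Z - s%:Z) * q%:R ^+ s.

(** Multiplied by [q ^ (n - r)], it bounds the number of common zeros in a subspace of codimension
    [k]; see [card_common_zeros_subspace]. *)
Definition zero_bound k : rat :=
  \sum_(0 <= t < ((n - k) %/ 2).+1) bezout_bound (2 * t + 1) (slope (k + 2 * t)) * (q%:R ^+ (k + t))^-1.

Definition rank_sum : rat :=
  \sum_((ceil_div n (2 * r)).-1 <= t < (n %/ 2).+1)
     bezout_bound (2 * t + 1) (slope (2 * t)) * (q%:R ^+ t)^-1.

Definition singular_sum : rat := (q%:R - 1)^-1 *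
  \sum_((2 * (ceil_div n (2 * r)).-1)%N <= rho < n) bezout_bound (rho + 1) (slope rho) * zero_bound rho.

Hypothesis q0 : (0 < q)%N.

Let qR0 : (q%:R : rat) != 0.
Proof. by rewrite pnatr_eq0 -lt0n. Qed.

Lemma sigma1E : sigma1 q n r = (q%:R : rat) ^ (r%:Z - n%:Z) + rank_sum.
Proof.
congr (_ + _); apply: eq_bigr => t _; rewrite /bezout_bound /slope.
have D0 : ((2 * t + 1)%:R : rat) != 0 by rewrite pnatr_eq0 addn1.
have -> : (2 * r * (2 * t) = 4 * r * t)%N by ring.
rewrite expr_div_n expfzDr // -!exprnN -!exprnP; ring.
Qed.

Lemma sigma2E : sigma2 q n r = singular_sum.
Proof.
congr (_ * _); apply: eq_bigr => rho _; rewrite mulr_sumr; apply: eq_bigr => t _.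
rewrite /Cconst /bezout_bound -/(slope rho) -/(slope (rho + 2 * t)).
have D1 : ((rho + 1)%:R : rat) != 0 by rewrite pnatr_eq0 addn1.
have D2 : ((2 * t + 1)%:R : rat) != 0 by rewrite pnatr_eq0 addn1.
rewrite !expfzDr // -!exprnN -!exprnP exprD.
move: ((rho + 1)%:R : rat) ((2 * t + 1)%:R : rat) (q%:R : rat) D1 D2 qR0 => a b c a0 b0 c0.
by field; rewrite !expf_neq0.
Qed.

Lemma bezout_bound_ge0 D s : 0 <= bezout_bound D s.
Proof. by rewrite mulr_ge0 ?exprz_ge0 ?exprn_ge0. Qed.

Lemma zero_bound_ge0 k : 0 <= zero_bound k.
Proof. by apply: sumr_ge0 => t _; rewrite mulr_ge0 ?bezout_bound_ge0 ?invr_ge0 ?exprn_ge0. Qed.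

Lemma bezout_boundE D s : (0 < D)%N ->
  bezout_bound D s = D%:R ^+ r * (q%:R / D%:R) ^+ s.
Proof.
move=> D0; have DR : (D%:R : rat) != 0 by rewrite pnatr_eq0 -lt0n.
by rewrite /bezout_bound expfzDr // -exprnN -exprnP expr_div_n mulrAC mulrA.
Qed.

Lemma ratio_ge1 D : (0 < D <= q)%N -> 1 <= (q%:R / D%:R : rat).
Proof. by case/andP=> D0 Dq; rewrite ler_pdivlMr ?ltr0n // mul1r ler_nat. Qed.

Lemma bezout_bound_mono D s s' : (0 < D <= q)%N -> (s <= s')%N ->
  bezout_bound D s <= bezout_bound D s'.
Proof.
move=> Dq ss; have /andP[D0 _] := Dq.
by rewrite !bezout_boundE // ler_wpM2l ?exprn_ge0 // ler_weXn2l // ratio_ge1.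
Qed.

Lemma bezout_bound_step D s s' i : (0 < D <= q)%N -> (s' <= s + i)%N ->
  bezout_bound D s' <= bezout_bound D s * q%:R ^+ i.
Proof.
move=> Dq ss; have /andP[D0 _] := Dq.
apply: (le_trans (bezout_bound_mono Dq ss)).
rewrite /bezout_bound exprD mulrA ler_wpM2r ?exprn_ge0 // ler_wpM2r ?exprn_ge0 //.
have DR : (D%:R : rat) != 0 by rewrite pnatr_eq0 -lt0n.
have -> : (r%:Z - (s + i)%:Z) = (r%:Z - s%:Z) - i%:Z by rewrite PoszD; ring.
rewrite [leLHS]expfzDr // -exprnN ler_piMr ?exprz_ge0 //.
by rewrite invf_le1 ?exprn_gt0 ?ltr0n // exprn_ege1 // ler1n.
Qed.

(** For [s > r] the trivial bound [q ^ r] suffices, because [(q / D) ^ (s - r)] is at least 1. *)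
Lemma bezout_bound_ge D s E : (0 < D <= q)%N -> (E <= q ^ r)%N ->
  ((s <= r)%N -> (E <= D ^ (r - s) * q ^ s)%N) -> E%:R <= bezout_bound D s.
Proof.
move=> Dq Er Es; have /andP[D0 _] := Dq.
have [sr|rs] := leqP s r.
  apply: (le_trans (y := (D ^ (r - s) * q ^ s)%:R)); first by rewrite ler_nat Es.
  by rewrite natrM !natrX /bezout_bound subzn // -exprnP.
apply: (le_trans (y := (q ^ r)%:R)); first by rewrite ler_nat.
rewrite natrX (le_trans _ (bezout_bound_mono Dq (ltnW rs))) //.
by rewrite /bezout_bound subrr expr0z mul1r.
Qed.

Lemma slope_mono x y : (x <= y)%N -> (slope x <= slope y)%N.
Proof. by move=> xy; rewrite leq_div2r // leq_mul. Qed.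

Hypotheses (n4 : (4 * r <= n)%N) (n0 : (0 < n)%N).

(** As [4 r <= n], two more codimensions allow at most one more dimension of forms. *)
Lemma slope_add x i : (slope (x + 2 * i) <= slope x + i)%N.
Proof.
rewrite /slope [leqRHS]addnC -divnMDl // leq_div2r // mulnDr addnC leq_add2r.
have -> : (2 * r * (2 * i) = i * (4 * r))%N by ring.
by rewrite leq_mul2l n4 orbT.
Qed.

(** In each term the Bezout factor gains at most [q ^ i] by [slope_add], while the denominator gains
    [q ^ (2 i)]. *)
Lemma zero_bound_step k i : (forall t, (k + 2 * t <= n)%N -> (2 * t + 1 <= q)%N) ->
  zero_bound (k + 2 * i) <= (q%:R ^+ i)^-1 * zero_bound k.
Proof.
move=> hq; rewrite /zero_bound mulr_sumr.
have le : (((n - (k + 2 * i)) %/ 2).+1 <= ((n - k) %/ 2).+1)%N.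
  by rewrite ltnS leq_div2r // leq_sub2l // leq_addr.
rewrite [leRHS](big_cat_nat (n := ((n - (k + 2 * i)) %/ 2).+1)) //=.
rewrite -[leLHS]addr0 lerD //; last first.
  apply: sumr_ge0 => t _.
  by rewrite mulr_ge0 ?invr_ge0 ?exprn_ge0 // mulr_ge0 ?bezout_bound_ge0 ?invr_ge0 ?exprn_ge0.
rewrite big_nat [leRHS]big_nat; apply: ler_sum => t /andP[_]; rewrite ltnS => tk.
have Dq : (0 < 2 * t + 1 <= q)%N.
  rewrite addn1 /= -addn1; case: t tk => [|t] tk //; apply: hq.
  move: tk; rewrite leq_divRL //; lia.
have := bezout_bound_step Dq (slope_add (k + 2 * t) i).
rewrite -addnA [(2 * t + 2 * i)%N]addnC addnA => le1.
have -> : (k + 2 * i + t = (k + t) + i + i)%N by lia.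
apply: (le_trans (ler_wpM2r _ le1)); first by rewrite invr_ge0 exprn_ge0.
rewrite !exprD le_eqVlt; apply/orP; left; apply/eqP.
move: (bezout_bound _ _) => b; field.
by rewrite !expf_neq0.
Qed.

End Numerics.

Lemma ler_sum_nat_widen (R : numDomainType) (f g : nat -> R) m m' n n' :
  (m <= m')%N -> (n' <= n)%N -> (forall i, (i < n')%N -> f i <= g i) -> (forall i, 0 <= g i) ->
  \sum_(m' <= i < n') f i <= \sum_(m <= i < n) g i.
Proof.
move=> mm nn fg g0; have [le|lt] := leqP n' m'; first by rewrite big_geq // sumr_ge0.
rewrite [leRHS](big_cat_nat (n := m')) //=; last by apply: leq_trans (ltnW lt) nn.
rewrite [X in _ + X](big_cat_nat (n := n')) ?(ltnW lt) //=.
rewrite addrCA -[leLHS]addr0 lerD ?addr_ge0 ?sumr_ge0 //.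
by rewrite big_nat [leRHS]big_nat; apply: ler_sum => i /andP[_]; exact: fg.
Qed.

(** * Monotonicity of the sums under passage to a smaller system *)

Section Monotonicity.
Variables (q n r n1 r1 : nat).
Hypotheses (n1_gt0 : (0 < n1)%N) (r1_gt0 : (0 < r1)%N) (n1n : (n1 <= n)%N) (r1r : (r1 <= r)%N).
Hypotheses (ratio : (n * r1 <= n1 * r)%N) (nq : (n < q)%N).
Let n_gt0 : (0 < n)%N := leq_trans n1_gt0 n1n.

Lemma slope_ratio_mono x : (slope n1 r1 x <= slope n r x)%N.
Proof.
rewrite /slope leq_divRL // -(leq_pmul2r n1_gt0).
have := leq_divM (2 * r1 * x) n1; move: (_ %/ n1)%N => s; nia.
Qed.

Lemma bezout_bound_ratio_mono D s' s : (0 < D <= q)%N -> (s' <= s)%N ->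
  bezout_bound q r1 D s' <= bezout_bound q r D s.
Proof.
move=> Dq ss; apply: le_trans (bezout_bound_mono r Dq ss); have /andP[D0 _] := Dq.
rewrite !bezout_boundE //; apply: ler_wpM2r.
  by rewrite exprn_ge0 // divr_ge0.
by rewrite ler_weXn2l // ler1n.
Qed.

Lemma zero_bound_ratio_mono k : zero_bound q n1 r1 k <= zero_bound q n r k.
Proof.
apply: ler_sum_nat_widen => // [|t tn|t];
  last by rewrite mulr_ge0 ?bezout_bound_ge0 ?invr_ge0 ?exprn_ge0.
  by rewrite ltnS leq_div2r // leq_sub2r.
rewrite ler_wpM2r ?invr_ge0 ?exprn_ge0 //; apply: bezout_bound_ratio_mono (slope_ratio_mono _).
move: tn; rewrite ltnS leq_divRL //; lia.
Qed.

Lemma ceil_div_ratio_mono : (ceil_div n (2 * r) <= ceil_div n1 (2 * r1))%N.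
Proof.
have r0 : (0 < r)%N := leq_trans r1_gt0 r1r.
rewrite /ceil_div -ltnS ltn_divLR ?muln_gt0 //.
have : (n1 + 2 * r1 - 1 < ((n1 + 2 * r1 - 1) %/ (2 * r1)).+1 * (2 * r1))%N by rewrite ltn_ceil
  ?muln_gt0.
move: ((_ - 1) %/ _)%N => c hc; have le : (n1 <= 2 * r1 * c)%N by nia.
have : (n * r1 <= (2 * r * c) * r1)%N by nia.
rewrite leq_pmul2r //; nia.
Qed.

Lemma rank_sum_ratio_mono : rank_sum q n1 r1 <= rank_sum q n r.
Proof.
apply: ler_sum_nat_widen => [||t tn|t]; last by rewrite mulr_ge0 ?bezout_bound_ge0 ?invr_ge0 ?exprn_ge0.
- by rewrite -!subn1 leq_sub2r // ceil_div_ratio_mono.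
- by rewrite ltnS leq_div2r.
rewrite ler_wpM2r ?invr_ge0 ?exprn_ge0 //; apply: bezout_bound_ratio_mono (slope_ratio_mono _).
move: tn; rewrite ltnS leq_divRL //; lia.
Qed.

Lemma singular_sum_ratio_mono : singular_sum q n1 r1 <= singular_sum q n r.
Proof.
have q1 : (1 < q)%N by exact: leq_ltn_trans nq.
rewrite /singular_sum ler_wpM2l ?invr_ge0 ?subr_ge0 ?ler1n ?(ltnW q1) //.
apply: ler_sum_nat_widen => // [|rho rn|rho];
  last by rewrite mulr_ge0 ?bezout_bound_ge0 ?zero_bound_ge0.
  by rewrite leq_mul2l -!subn1 leq_sub2r // ceil_div_ratio_mono.
apply: ler_pM; rewrite ?bezout_bound_ge0 ?zero_bound_ge0 ?zero_bound_ratio_mono //.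
apply: bezout_bound_ratio_mono (slope_ratio_mono _); lia.
Qed.

End Monotonicity.

(** * The sums for [(2 r) ^ r <= q] and [n = 4 r + 1] *)

Section LargeResidueField.
Variables (q r : nat).
Hypotheses (r2 : (2 <= r)%N) (hq : ((2 * r) ^ r <= q)%N).
Local Notation n := (4 * r + 1)%N.
Local Notation R := (2 * r)%N.
Local Notation X := (R%:R : rat).
Local Notation Y := (q%:R : rat).

Let X4 : 4 <= X. Proof. by rewrite (ler_nat rat 4); lia. Qed.
Let X0 : 0 < X. Proof. by apply: lt_le_trans X4. Qed.
Let XrY : X ^+ r <= Y. Proof. by rewrite -natrX ler_nat. Qed.
Let X2Y : X ^+ 2 <= Y.
Proof. by apply: le_trans XrY; rewrite ler_weXn2l //; have := X4; lra. Qed.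
Let Y16 : 16 <= Y. Proof. by apply: le_trans X2Y; have := X4; nra. Qed.
Let Y0 : 0 < Y. Proof. by apply: lt_le_trans Y16. Qed.

Lemma large_residue_field : (n < q)%N.
Proof.
rewrite -(ltr_nat rat); have -> : (4 * r + 1)%:R = 2 * X + 1 :> rat by rewrite natrD !natrM; ring.
by apply: lt_le_trans X2Y; have := X4; nra.
Qed.

(** With [n = 4 r + 1] the division is explicit: [4 r (a + 1) = a n + (4 r - a)]. *)
Lemma slope_even a : (0 < a <= n)%N -> slope n r (2 * a) = a.-1.
Proof.
case: a => // a /andP[_ an]; rewrite /slope.
have -> : (2 * r * (2 * a.+1) = a * n + (4 * r - a))%N by nia.
rewrite divnMDl ?addn1 // divn_small ?addn0 //; lia.
Qed.

Lemma slope_odd a : (a <= R)%N -> slope n r (2 * a + 1) = a.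
Proof.
move=> an; rewrite /slope.
have -> : (2 * r * (2 * a + 1) = a * n + (2 * r - a))%N by nia.
rewrite divnMDl ?addn1 // divn_small ?addn0 //; lia.
Qed.

Let g D s : rat := D%:R ^ (r%:Z - s%:Z).

Lemma power_le D s : (0 < D)%N -> ((s < r)%N -> (D <= R)%N) -> g D s <= X ^+ (r - s).
Proof.
move=> D0 h; have [rs|sr] := leqP r s.
  rewrite (eqP (rs : r - s == 0)%N) expr0 /g -opprB subzn // -exprnN.
  by rewrite invf_le1 ?exprn_gt0 ?ltr0n // exprn_ege1 // ler1n.
rewrite /g (subzn (ltnW sr)) -exprnP lerXn2r ?nnegrE ?ler0n ?(ltW X0) //.
by rewrite ler_nat h.
Qed.

(** The base [2 r + 1] is reached only with exponent 1, and [2 r + 1 <= 5/4 (2 r)] because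
    [2 r >= 4]. This is the origin of [5/4]. *)
Lemma power_le_slack D s : (0 < D)%N -> ((s < r)%N -> (D <= R + 1)%N) ->
  ((s.+1 < r)%N -> (D <= R)%N) -> g D s <= 5 / 4 * X ^+ (r - s).
Proof.
move=> D0 h1 h2; have Xp : 0 <= X ^+ (r - s) by rewrite exprn_ge0 // ltW.
have [e|ne] := eqVneq s.+1 r.
  have sr : (s < r)%N by rewrite -e.
  rewrite /g (subzn (ltnW sr)) -exprnP; have -> : (r - s = 1)%N by lia.
  rewrite !expr1; have : (D%:R : rat) <= (R + 1)%:R by rewrite ler_nat h1.
  by rewrite natrD; have := X4; lra.
apply: (@le_trans _ _ (X ^+ (r - s))); last by lra.
by apply: power_le => // sr; apply: h2; rewrite ltn_neqAle ne sr.
Qed.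

(** The slope at [2 t] is [t - 1], so the powers of [q] leave a single factor [1 / q], at most
    [(2 r) ^ - r]; as [2 r >= 4], the terms decay like powers of [1/4]. *)
Lemma rank_term_le t : (2 <= t <= R)%N ->
  bezout_bound q r (2 * t + 1) (slope n r (2 * t)) * (q%:R ^+ t)^-1 <= 5 / 4 * (1 / 4) ^+ t.-1.
Proof.
move=> /andP[t2 tR]; have [s tE] : exists s, t = s.+1 by case: (t) t2 => // s; exists s.
rewrite {t}tE in t2 tR *.
have sn : (0 < s.+1 <= n)%N.
  by move: tR; clear; lia.
rewrite (slope_even sn).
rewrite /bezout_bound -/(g _ _) -/Y /=.
have -> : g (2 * s.+1 + 1) s * Y ^+ s * (Y ^+ s.+1)^-1 = g (2 * s.+1 + 1) s / Y.
  by rewrite exprS; field; rewrite lt0r_neq0 // expf_neq0 // lt0r_neq0.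
have Xs : 0 < X ^+ s by rewrite exprn_gt0.
have gX : g (2 * s.+1 + 1) s <= 5 / 4 * (X ^+ r / X ^+ s).
  have [rs|sr] := leqP r s; last first.
    rewrite -(expfB _ sr).
    by apply: power_le_slack => //; lia.
  have -> : X ^+ r / X ^+ s = (X ^+ (s - r))^-1.
    by rewrite expfB_cond ?(gt_eqF X0) // invf_div.
  have -> : g (2 * s.+1 + 1) s = ((2 * s.+1 + 1)%:R ^+ (s - r))^-1.
    by rewrite /g -opprB subzn // -exprnN.
  have p1 : 0 < X ^+ (s - r) by rewrite exprn_gt0.
  apply: (@le_trans _ _ (X ^+ (s - r))^-1); last first.
    by have := invr_gt0 (X ^+ (s - r)); rewrite p1; lra.
  have D0 : 0 < ((2 * s.+1 + 1)%:R : rat) by rewrite ltr0n addn1.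
  rewrite lef_pV2 ?posrE ?p1 ?(exprn_gt0 _ D0) // lerXn2r ?nnegrE ?ler0n ?(ltW X0) //.
  by rewrite ler_nat; lia.
rewrite (ler_pdivrMr _ _ Y0).
apply: (le_trans gX).
rewrite -[leRHS]mulrA; apply: ler_wpM2l; first by have := X4; lra.
apply: (@le_trans _ _ (Y / X ^+ s)); first by rewrite ler_wpM2r // invr_ge0 ltW.
rewrite mulrC ler_wpM2r ?(ltW Y0) // expr_div_n expr1n div1r lef_pV2 ?posrE ?exprn_gt0 //.
by rewrite lerXn2r ?nnegrE //; have := X4; lra.
Qed.

Lemma ceil_div_large : ceil_div n R = 3%N.
Proof.
rewrite /ceil_div; have -> : (4 * r + 1 + 2 * r - 1 = 3 * (2 * r))%N by lia.
by rewrite mulnK // muln_gt0; lia.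
Qed.

(** The constant is the geometric series [5/4 (1/4) ^ (t - 1)] summed from [t = 2]. *)
Lemma rank_sum_le : rank_sum q n r <= 5 / 12.
Proof.
rewrite /rank_sum ceil_div_large /=.
have -> : (n %/ 2 = R)%N by lia.
apply: (@le_trans _ _ (\sum_(2 <= t < R.+1) 5 / 4 * (1 / 4) ^+ t.-1)).
  rewrite big_nat [leRHS]big_nat; apply: ler_sum => t tR.
  by apply: rank_term_le; rewrite -ltnS.
have : forall N, \sum_(2 <= t < N.+2) 5 / 4 * (1 / 4) ^+ t.-1 = 5 / 12 - 5 / 12 * (1 / 4) ^+ N :> rat.
  elim=> [|N IH]; first by rewrite big_geq // expr0; ring.
  by rewrite big_nat_recr //= IH exprS; field.
move=> e; have -> : (R.+1 = R.-1.+2)%N by lia.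
have : 0 <= (1 / 4 : rat) ^+ R.-1 by apply: exprn_ge0; lra.
by rewrite e; lra.
Qed.

(** For [rho = 2 s + e] with [e] equal to 1 or 2, the slopes are [s] and [s + t], and the powers of
    [q] reduce to [q ^ - e]. If [s >= 2] the bound follows from [X ^ (2 r) <= Y ^ 2]. The other case
    is [rho = 4], where [e = 2] provides one more factor [Y]. *)
Lemma singular_term_le rho t : (4 <= rho < n)%N -> (rho + 2 * t <= n)%N ->
  bezout_bound q r (rho + 1) (slope n r rho)
  * (bezout_bound q r (2 * t + 1) (slope n r (rho + 2 * t)) * (q%:R ^+ (rho + t))^-1)
  <= 5 / 4 * (Y / X ^+ 4).
Proof.
move=> /andP[rho4 rn] tn;
have [s [e [e12 rhoE]]] : exists s e, (e = 1 \/ e = 2)%N /\ rho = (2 * s + e)%N.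
  exists (rho.-1)./2, (rho - 2 * (rho.-1)./2)%N; split; move: rho4; clear; lia.
have sl i : (rho + 2 * i <= n)%N -> slope n r (rho + 2 * i) = (s + i)%N.
  rewrite rhoE => hi; case: e12 hi => -> hi.
    have -> : (2 * s + 1 + 2 * i = 2 * (s + i) + 1)%N by clear; lia.
    by rewrite slope_odd //; move: hi; clear; lia.
  have -> : (2 * s + 2 + 2 * i = 2 * (s + i).+1)%N by clear; lia.
  by rewrite slope_even //; move: hi; clear; lia.
have sl0 := sl 0%N; rewrite muln0 !addn0 in sl0.
rewrite (sl0 (ltnW rn)) (sl t tn) /bezout_bound -!/(g _ _) -/Y.
have Yn k : Y ^+ k != 0 by rewrite expf_neq0 // lt0r_neq0.
have -> : g (rho + 1) s * Y ^+ s * (g (2 * t + 1) (s + t) * Y ^+ (s + t) * (Y ^+ (rho + t))^-1)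
   = g (rho + 1) s * g (2 * t + 1) (s + t) / Y ^+ e.
  have -> : Y ^+ (rho + t) = Y ^+ s * Y ^+ s * Y ^+ e * Y ^+ t.
    by rewrite rhoE -!exprD; congr (_ ^+ _); clear; lia.
  rewrite exprD; move: (g _ _) (g _ _) (Y ^+ s) (Y ^+ t) (Y ^+ e) (Yn s) (Yn t) (Yn e).
  by move=> g1 g2 a b c a0 b0 c0; field; rewrite a0 b0 c0.
have Xp k : 0 < X ^+ k by rewrite exprn_gt0.
have g1 : g (rho + 1) s <= 5 / 4 * X ^+ (r - s) by apply: power_le_slack; move: e12 rhoE; clear; lia.
have g2 : g (2 * t + 1) (s + t) <= X ^+ (r - s).
  apply: (@le_trans _ _ (X ^+ (r - (s + t)))); first by apply: power_le; lia.
  apply: ler_weXn2l; first by have := X4; lra.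
  by clear; lia.
have g0 D i : 0 <= g D i by rewrite exprz_ge0.
have gg : g (rho + 1) s * g (2 * t + 1) (s + t) <= 5 / 4 * (X ^+ (r - s) * X ^+ (r - s)).
  by rewrite mulrA ler_pM.
have Ye : 0 < Y ^+ e by rewrite exprn_gt0.
rewrite (ler_pdivrMr _ _ Ye); apply: (le_trans gg).
rewrite -[leRHS]mulrA; apply: ler_wpM2l; first by have := X4; lra.
rewrite mulrAC (ler_pdivlMr _ _ (Xp _)) -expr2 -exprM -exprD -exprS.
have X2rY : X ^+ (r * 2) <= Y ^+ 2.
  by rewrite exprM; apply: lerXn2r XrY; rewrite nnegrE; apply: ltW => //; exact: Xp.
have X1 : 1 <= X by have := X4; lra.
have Y1 : 1 <= Y by have := Y16; lra.
have [s2|s2] := leqP 2 s.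
  apply: (@le_trans _ _ (X ^+ (r * 2))).
    apply: (ler_weXn2l X1); have := leq_sub2l r s2; move: r2; clear; lia.
  apply: (le_trans X2rY); apply: (ler_weXn2l Y1).
  by case: e12 => ->.
have -> : e = 2%N by move: s2 e12 rhoE rho4; clear; lia.
apply: (@le_trans _ _ (X ^+ (r * 2) * X ^+ 2)).
  rewrite -exprD; apply: (ler_weXn2l X1).
  have s1 : s = 1%N by move: s2 e12 rhoE rho4; clear; lia.
  by rewrite s1; move: r2; clear; lia.
rewrite [leRHS]exprSr; apply: ler_pM X2rY X2Y; exact: ltW (Xp _).
Qed.

(** There are at most [2 X] values of [rho] and [X] of [t], so the double sum is at most
    [5/2 Y / X ^ 2], hence at most [5/32 Y]. This is at most [(Y - 1) / 6] because [Y >= 16]. *)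
Lemma singular_sum_le : singular_sum q n r <= 1 / 6.
Proof.
rewrite /singular_sum ceil_div_large -/Y /=.
set C := 5 / 4 * (Y / X ^+ 4).
have Xp k : 0 < X ^+ k by apply: exprn_gt0.
have YX k : 0 <= Y / X ^+ k by apply: divr_ge0; apply: ltW => //; exact: Xp.
have C0 : 0 <= C by have := YX 4%N; rewrite /C; lra.
have Y1 : 0 < Y - 1 by have := Y16; lra.
apply: (@le_trans _ _ ((Y - 1)^-1 * ((2 * X) * (X * C)))); last first.
  have -> : 2 * X * (X * C) = 5 / 2 * (Y / X ^+ 2).
    rewrite /C; move: X Y (lt0r_neq0 X0) => x y x0; field; exact: x0.
  rewrite mulrC (ler_pdivrMr _ _ Y1).
  have le : Y / X ^+ 2 <= Y / 16.
    apply: ler_wpM2l; first exact: ltW.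
    have X16 : 16 <= X ^+ 2 by have := X4; nra.
    by rewrite lef_pV2 ?posrE //; apply: Xp.
  by have := Y16; lra.
apply: ler_wpM2l; first by rewrite invr_ge0 ltW.
have XC : 0 <= X * C by apply: mulr_ge0 C0; exact: ltW.
apply: (@le_trans _ _ (\sum_(4 <= rho < n) (X * C))); last first.
  rewrite sumr_const_nat -[leLHS]mulr_natl; apply: (ler_wpM2r XC).
  by rewrite -natrM ler_nat; clear; lia.
rewrite big_nat [leRHS]big_nat; apply: ler_sum => rho rn.
rewrite /zero_bound mulr_sumr.
apply: (@le_trans _ _ (\sum_(0 <= t < ((n - rho) %/ 2).+1) C)); last first.
  rewrite sumr_const_nat -[leLHS]mulr_natl; apply: (ler_wpM2r C0).
  by rewrite ler_nat; move: rn; clear; lia.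
rewrite big_nat [leRHS]big_nat; apply: ler_sum => t /andP[_ tn].
have {}tn : (rho + 2 * t <= n)%N by move: rn tn; clear; lia.
exact: singular_term_le rn tn.
Qed.

Lemma large_residue_field_sum : rank_sum q n r + singular_sum q n r < 1.
Proof. by have := rank_sum_le; have := singular_sum_le; lra. Qed.

End LargeResidueField.

(** * Nonsingular zeros of semistable systems *)

(* The condition inherited by the reduction of a system of minimal weight over [K]. *)
Definition semistable (F : fieldType) n r (Q : 'I_r -> 'M[F]_n) :=
  forall (C : 'M[F]_r) (W : 'M[F]_n),
  (forall (c : 'rV_r) (x : 'rV_n), (c <= C)%MS -> (x <= W)%MS -> qf (comb Q c) x = 0) ->
  (n * \rank C <= 2 * r * (n - \rank W))%N.

Section Semistable.
Variables (F : finFieldType) (n r : nat) (Q : 'I_r -> 'M[F]_n).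
Hypotheses (hr : (0 < r)%N) (hn : (4 * r + 1 <= n)%N) (hss : semistable Q).
Local Notation q := #|F|.
Local Notation slp := (slope n r).
Let q1 : (1 < q)%N := card_finNzRing_gt1 F.
Let q0 : (0 < q)%N := ltnW q1.
Let n0 : (0 < n)%N. Proof. by apply: leq_trans hn; rewrite addn1. Qed.

Lemma semistable_rank (C : 'M[F]_r) d (V : {set 'rV[F]_n}) k : subspace V -> #|V| = (q ^ d)%N ->
  (n <= d + k)%N ->
  (forall (c : 'rV_r) x, (c <= C)%MS -> x \in V -> qf (comb Q c) x = 0) ->
  (\rank C <= slp k)%N.
Proof.
move=> sV cV dk h; have [W hW] := subspace_mx sV.
have rW : \rank W = d.
  apply/eqP; rewrite -(eqn_exp2l _ _ q1) -cV -card_mx_rows; apply/eqP/eq_card => x.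
  by rewrite inE hW.
have := hss (C := C) (W := W) (fun c x cC xW => h c x cC (etrans (esym (hW x)) xW)).
rewrite rW /slope leq_divRL // mulnC => le; apply: leq_trans le _.
by rewrite leq_mul2l leq_subLR dk orbT.
Qed.

(** The form vanishes on a subspace of codimension at most half its rank plus one; semistability for
    the line spanned by [c] bounds this codimension below. Here lies the origin of the lower limits
    of summation in [sigma1] and [sigma2]. *)
Lemma semistable_qrank c : c != 0 -> ((ceil_div n (2 * r)).-1 <= (qrank (comb Q c))./2)%N.
Proof.
move=> c0; have [M [hM leM]] := isotropic_subspace (comb Q c).
have := hss (C := <<c>>%MS) (W := M).
rewrite mxrank_gen rank_rV c0 muln1 => /(_ _)/wrap[].
  move=> c' x; rewrite genmxE => /sub_rVP[a ->] xM; rewrite qf_comb.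
  under eq_bigr => k _ do rewrite mxE -mulrA.
  by rewrite -mulr_sumr -qf_comb hM // mulr0.
move=> le; rewrite /ceil_div; move: (qrank _)./2 leM => x leM.
have le2 : (n <= 2 * r * x.+1)%N.
  by apply: leq_trans le _; rewrite leq_mul2l; apply/orP; right; lia.
have : ((n + 2 * r - 1) %/ (2 * r) < x.+2)%N.
  by rewrite ltn_divLR; nia.
lia.
Qed.

Definition restrict d (W : 'M[F]_(d, n)) k : 'M[F]_d := W *m Q k *m W^T.

Lemma comb_restrict d (W : 'M[F]_(d, n)) c : comb (restrict W) c = W *m comb Q c *m W^T.
Proof.
rewrite /comb mulmx_sumr mulmx_suml; apply: eq_bigr => k _.
by rewrite -scalemxAr -scalemxAl.
Qed.

Lemma qf_sandwich d (W : 'M[F]_(d, n)) (A : 'M[F]_n) y : qf (W *m A *m W^T) y = qf A (y *m W).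
Proof. by rewrite /qf trmx_mul !mulmxA. Qed.

(** The vertex of a restricted form of rank [2 t] has codimension [n - d + 2 t] in the whole space.
    The tangent forms vanish on it, so semistability bounds their dimension by the slope. *)
Lemma restricted_even_rank d (W : 'M[F]_(d, n)) t : row_free W -> (2 * t + 1 <= q)%N ->
  (#|even_rank_forms (restrict W) t|%:R : rat)
  <= bezout_bound q r (2 * t + 1) (slp (n - d + 2 * t)).
Proof.
move=> Wf tq; apply: bezout_bound_ge; rewrite ?addn1 //=; first by rewrite -addn1.
  by rewrite -[X in (_ <= q ^ X)%N]mul1n -card_mx max_card.
move=> sr; have := @card_even_rank_forms _ _ _ (restrict W) t _ (even_rank_forms (restrict W) t) sr.
rewrite mul2n; apply=> c; rewrite inE => /eqP cE; split=> // C hC.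
have vsub := vtx_subspace (comb (restrict W) c) (setT_subspace F d).
have Winj : injective (fun y : 'rV[F]_d => y *m W) by exact: row_free_inj.
have dn : (d <= n)%N by rewrite -(eqP Wf) rank_leq_col.
apply: (@semistable_rank C (d - t.*2) [set y *m W | y in vertex (comb (restrict W) c)]).
- split; first by apply/imsetP; exists 0; rewrite ?mul0mx //; case: vsub.
  move=> a _ _ /imsetP[y yV ->] /imsetP[z zV ->]; apply/imsetP; exists (a *: y + z).
    by case: vsub => _; apply.
  by rewrite mulmxDl -scalemxAl.
- by rewrite card_imset // card_vertex cE.
- have := qrank_le (comb (restrict W) c); rewrite cE; lia.
- move=> c' _ c'C /imsetP[y yV ->].
  by rewrite -qf_sandwich -comb_restrict; exact: hC.
Qed.

Hypothesis hq : (n < q)%N.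

Lemma card_common_zeros_restrict d (W : 'M[F]_(d, n)) : row_free W ->
  (#|common_zeros (restrict W)|%:R : rat) * q%:R ^+ r <= q%:R ^+ n * zero_bound q n r (n - d).
Proof.
move=> Wf; have dn : (d <= n)%N by rewrite -(eqP Wf) rank_leq_col.
have := common_zeros_upper (restrict W); rewrite -(ler_nat rat) natrM natrX => /le_trans; apply.
rewrite natr_sum /zero_bound mulr_sumr subKn // divn2; rewrite big_nat [leRHS]big_nat.
apply: ler_sum => t; rewrite ltnS => /andP[_ td].
have t2 : (2 * t <= d)%N by rewrite mul2n -[d]odd_double_half; apply: leq_trans (leq_addl _ _);
  rewrite leq_double.
rewrite natrM mulrCA; apply: ler_pM; rewrite ?ler0n ?restricted_even_rank //.
  by rewrite addn1; apply: leq_ltn_trans hq; apply: leq_trans t2 dn.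
have qR0 : (q%:R : rat) != 0 by rewrite pnatr_eq0 -lt0n.
rewrite natrX -expfB_cond ?(negbTE qR0) //=; last by lia.
by rewrite (_ : (n - (n - d + t) = d - t)%N) //; lia.
Qed.

Lemma card_common_zeros_subspace (V : {set 'rV[F]_n}) d : subspace V -> #|V| = (q ^ d)%N ->
  (#|V :&: common_zeros Q|%:R : rat) * q%:R ^+ r <= q%:R ^+ n * zero_bound q n r (n - d).
Proof.
move=> sV cV; have [M hM] := subspace_mx sV.
have rM : \rank M = d.
  apply/eqP; rewrite -(eqn_exp2l _ _ q1) -cV -card_mx_rows; apply/eqP/eq_card => x.
  by rewrite inE hM.
pose W := row_base M; have Wf : row_free W by exact: row_base_free.
rewrite -rM; apply: le_trans (card_common_zeros_restrict Wf).
rewrite ler_wpM2r ?exprn_ge0 // ler_nat.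
rewrite -(card_imset (common_zeros (restrict W)) (row_free_inj Wf)).
apply/subset_leq_card/subsetP => x; rewrite inE -hM -(eq_row_base M) => /andP[/submxP[y ->]].
rewrite inE => /forallP h; apply/imsetP; exists y => //.
by rewrite inE; apply/forallP => k; rewrite /restrict qf_sandwich.
Qed.

Lemma card_common_zeros_lower :
  q%:R ^+ n <= (#|common_zeros Q|%:R : rat) * q%:R ^+ r + q%:R ^+ n * rank_sum q n r.
Proof.
have ht c (c0 : c != 0) (_ : ~~ odd (qrank (comb Q c))) := semistable_qrank c0.
have := common_zeros_lower ht; rewrite -(ler_nat rat) natrX natrD natrM natrX => /le_trans; apply.
rewrite lerD2l natr_sum /rank_sum mulr_sumr divn2 big_nat [leRHS]big_nat.
apply: ler_sum => t /andP[_]; rewrite ltnS => td.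
have t2 : (2 * t <= n)%N by rewrite mul2n -[n]odd_double_half; apply: leq_trans (leq_addl _ _);
  rewrite leq_double.
rewrite natrM mulrCA; apply: ler_pM; rewrite ?ler0n //.
  have W1 : row_free (1%:M : 'M[F]_n) by rewrite row_free_unit unitmx1.
  have := @restricted_even_rank n 1%:M t W1; rewrite subnn add0n.
  have -> : even_rank_forms (restrict 1%:M) t = even_rank_forms Q t.
    by apply/setP => c; rewrite !inE comb_restrict trmx1 mul1mx mulmx1.
  by apply; rewrite addn1; apply: leq_ltn_trans hq.
have qR0 : (q%:R : rat) != 0 by rewrite pnatr_eq0 -lt0n.
by rewrite natrX -expfB_cond ?(negbTE qR0) //=; lia.
Qed.

End Semistable.

(** * The singular locus of a system *)

Section SingularLocus.
Variables (F : finFieldType) (n r : nat) (Q : 'I_r -> 'M[F]_n).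
Local Notation q := #|F|.
Let q1 : (1 < q)%N := card_finNzRing_gt1 F.
Let q0 : (0 < q)%N := ltnW q1.

Lemma subspace_card_log m (V : {set 'rV[F]_m}) : subspace V ->
  (trunc_log q #|V| <= m)%N /\ #|V| = (q ^ trunc_log q #|V|)%N.
Proof.
move=> sV; have [M hM] := subspace_mx sV.
have cV : #|V| = (q ^ \rank M)%N.
  by rewrite -card_mx_rows; apply: eq_card => x; rewrite inE hM.
by rewrite cV trunc_expnK // rank_leq_col.
Qed.

Definition tangent c : {set 'rV[F]_r} :=
  [set c' | [forall x in radical (comb Q c), forall y in radical (comb Q c), bf (comb Q c') x y == 0]].

Lemma tangentP c c' : reflect
  (forall x y, x \in radical (comb Q c) -> y \in radical (comb Q c) -> bf (comb Q c') x y = 0)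
  (c' \in tangent c).
Proof.
rewrite inE; apply: (iffP forall_inP) => h x.
  by move=> y xR yR; apply/eqP; have /forall_inP := h x xR; apply.
by move=> xR; apply/forall_inP => y yR; apply/eqP; exact: h.
Qed.

Lemma tangent_subspace c : subspace (tangent c).
Proof.
split.
  by apply/tangentP => x y _ _; rewrite bf_comb big1 // => k _; rewrite mxE mul0r.
move=> a u w /tangentP hu /tangentP hw; apply/tangentP => x y xR yR.
rewrite bf_comb; under eq_bigr => k _ do rewrite !mxE mulrDl -mulrA.
by rewrite big_split /= -mulr_sumr -!bf_comb hu // hw // mulr0 addr0.
Qed.

(** Tangent forms have polar forms vanishing on the radical, but semistability asks for the
    vanishing of quadratic forms. Shrinking the radical to this subspace secures it, as used in
    [tdim_slope], and by [singular_zeros_mem] loses no common zero. *)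
Definition singular_space c : {set 'rV[F]_n} :=
  [set x in radical (comb Q c) | [forall c' in tangent c, qf (comb Q c') x == 0]].

Lemma singular_spaceP c x : reflect
  (x \in radical (comb Q c) /\ forall c', c' \in tangent c -> qf (comb Q c') x = 0)
  (x \in singular_space c).
Proof.
rewrite [x \in singular_space c]in_set; apply: (iffP andP) => [[xR /forall_inP h]|[xR h]]; split=> //.
  by move=> c' /h/eqP.
by apply/forall_inP => c' /h ->.
Qed.

Lemma singular_space_subspace c : subspace (singular_space c).
Proof.
have sR := radical_subspace (comb Q c); split.
  by apply/singular_spaceP; split=> [|c' _]; [case: sR | exact: qf0].
move=> a x y /singular_spaceP[xR hx] /singular_spaceP[yR hy]; apply/singular_spaceP; split.
  by case: sR => _; apply.
move=> c' c'T; rewrite qfD qfZ hx // hy // bfZl.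
by have /tangentP -> := c'T; rewrite ?mulr0 ?addr0.
Qed.

Definition tdim c := trunc_log q #|tangent c|.
Definition codim c := (n - trunc_log q #|singular_space c|)%N.

Lemma codim_le c : (codim c <= n)%N. Proof. exact: leq_subr. Qed.

Lemma card_singular_space c : #|singular_space c| = (q ^ (n - codim c))%N.
Proof.
by have [le e] := subspace_card_log (singular_space_subspace c); rewrite {1}e /codim subKn.
Qed.

Lemma polar_tangentP c s : (tdim c <= s)%N -> polar_tangent_le Q c s.
Proof.
move=> ts C hC; apply: leq_trans ts; rewrite -(leq_exp2l _ _ q1).
have [_ <-] := subspace_card_log (tangent_subspace c).
rewrite -card_mx_rows; apply/subset_leq_card/subsetP => c'; rewrite inE => c'C.
by apply/tangentP => x y /radicalP xR /radicalP yR; exact: hC.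
Qed.

Lemma radicalZ c a : a != 0 -> radical (comb Q (a *: c)) = radical (comb Q c).
Proof.
move=> a0; apply/setP => x; rewrite !inE.
have -> : pol (comb Q (a *: c)) = a *: pol (comb Q c).
  by rewrite !pol_comb scaler_sumr; apply: eq_bigr => k _; rewrite mxE scalerA.
by rewrite -scalemxAr scaler_eq0 (negbTE a0).
Qed.

Lemma singular_spaceZ c a : a != 0 -> singular_space (a *: c) = singular_space c.
Proof. by move=> a0; rewrite /singular_space /tangent radicalZ. Qed.

Lemma codimZ c a : a != 0 -> codim (a *: c) = codim c.
Proof. by move=> a0; rewrite /codim singular_spaceZ. Qed.

Lemma rank_pol_le_codim c : (\rank (pol (comb Q c)) <= codim c)%N.
Proof.
have : singular_space c \subset radical (comb Q c) by apply/subsetP => x /singular_spaceP[].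
move=> /subset_leq_card; rewrite card_singular_space card_radical leq_exp2l //.
have := codim_le c; have := rank_leq_row (pol (comb Q c)); lia.
Qed.

(** The common zeros at which the gradients of the forms are linearly dependent. *)
Definition singular_zeros : {set 'rV[F]_n} :=
  [set x in common_zeros Q | [exists c, (c != 0) && (x \in radical (comb Q c))]].

Lemma singular_zeros_mem x c : x \in common_zeros Q -> x \in radical (comb Q c) ->
  x \in singular_space c.
Proof.
rewrite inE => /forallP h xR; apply/singular_spaceP; split=> // c' _.
by rewrite qf_comb big1 // => k _; rewrite (eqP (h k)) mulr0.
Qed.

Definition degenerate := [set c : 'rV[F]_r | (c != 0) && (codim c < n)%N].

(** A nonzero singular zero lies in the singular space of some [c], hence of its [q - 1] nonzero
    multiples. The vector 0 lies in every singular space, and any degenerate [c] serves for it. *)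
Lemma card_singular_zeros : (exists c, c \in degenerate) ->
  (q.-1 * #|singular_zeros| <= \sum_(c in degenerate) #|singular_space c :&: common_zeros Q|)%N.
Proof.
move=> [c1 c1D].
have mult x : x \in singular_zeros ->
    (q.-1 <= #|[set c in degenerate | x \in singular_space c :&: common_zeros Q]|)%N.
  rewrite in_set => /andP[xZ /existsP[c2 /andP[c20 xR]]].
  have [c [cD xW]] : exists c, c \in degenerate /\ x \in singular_space c.
    have [x0|x0] := eqVneq x 0.
      by exists c1; split=> //; rewrite x0; case: (singular_space_subspace c1).
    have xW := singular_zeros_mem xZ xR; exists c2; split=> //; rewrite inE c20 /=.
    rewrite ltn_neqAle codim_le andbT; apply/eqP => cn.
    have := card_singular_space c2; rewrite cn subnn expn0 => /eqP/cards1P[y yE].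
    have [W0 _] := singular_space_subspace c2.
    by move: W0 xW; rewrite yE !inE => /eqP <- /eqP /esym x00; rewrite x00 eqxx in x0.
  have /andP[c0 cn] : (c != 0) && (codim c < n)%N by move: cD; rewrite inE.
  have inj : injective (fun a : F => a *: c).
    move=> a b /eqP; rewrite -subr_eq0 -scalerBl scaler_eq0 (negbTE c0) orbF subr_eq0.
    by move/eqP.
  rewrite -(cardC1 (0 : F)) -(card_imset _ inj); apply/subset_leq_card/subsetP => _ /imsetP[a a0 ->].
  have {}a0 : a != 0 by move: a0; rewrite inE.
  rewrite in_set; apply/andP; split.
    by rewrite in_set scaler_eq0 negb_or a0 c0 codimZ // cn.
  by rewrite in_setI singular_spaceZ // xW.
have -> : (\sum_(c in degenerate) #|singular_space c :&: common_zeros Q|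
  = \sum_x #|[set c in degenerate | x \in singular_space c :&: common_zeros Q]|)%N.
  transitivity (\sum_(c in degenerate) \sum_(x | x \in singular_space c :&: common_zeros Q) 1)%N.
    by apply: eq_bigr => c _; rewrite sum1_card.
  rewrite (exchange_big_dep predT) //=; apply: eq_bigr => x _.
  by rewrite -sum1_card; apply: eq_bigl => c; rewrite [RHS]inE.
rewrite [leqRHS](bigID (mem singular_zeros)) /=; apply: leq_trans (leq_addr _ _).
by rewrite mulnC -sum_nat_const; apply: leq_sum.
Qed.

Lemma singular_zeros_trivial : ~ (exists c, c \in degenerate) -> (#|singular_zeros| <= 1)%N.
Proof.
move=> nD; apply: (@leq_trans #|[set (0 : 'rV[F]_n)]|); last by rewrite cards1.
apply/subset_leq_card/subsetP => x.
rewrite in_set => /andP[xZ /existsP[c /andP[c0 xR]]]; have xW := singular_zeros_mem xZ xR.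
have cn : codim c = n.
  apply/eqP; rewrite eqn_leq codim_le leqNgt; apply/negP => lt.
  by apply: nD; exists c; rewrite inE c0.
have := card_singular_space c; rewrite cn subnn expn0 => /eqP/cards1P[y yE].
have [W0 _] := singular_space_subspace c.
by move: W0 xW; rewrite yE !inE => /eqP <-.
Qed.

End SingularLocus.

(** The two terms on the left are to come, in [singular_sum_char2], from the forms of polar rank
    [2 a] and [2 a - 2] that share the allotted value [2 a]. *)
Lemma sum_two_powers a k : (0 < k)%N -> (a.+1 ^ k + k * a ^ k <= (2 * a).+1 ^ k)%N.
Proof.
case: k => // k _; elim: k => [|k IH]; first by rewrite !expn1; lia.
rewrite [leqRHS]expnS [(a.+1 ^ k.+2)%N]expnS [(a ^ k.+2)%N]expnS.
have le : (a ^ k.+1 <= a.+1 ^ k.+1)%N by rewrite leq_exp2r.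
move: (a.+1 ^ k.+1)%N (a ^ k.+1)%N ((2 * a).+1 ^ k.+1)%N le IH => x y z le IH.
nia.
Qed.

Lemma mul_power_double a k : (k * a ^ k <= (2 * a) ^ k)%N.
Proof. by rewrite expnMn leq_mul2r ltnW ?orbT // ltn_expl. Qed.

Section SingularSum.
Variables (F : finFieldType) (n r : nat) (Q : 'I_r -> 'M[F]_n).
Hypotheses (hr : (0 < r)%N) (hn : (4 * r + 1 <= n)%N) (hss : semistable Q).
Local Notation q := #|F|.
Hypothesis hq : (n < q)%N.
Local Notation slp := (slope n r).
Local Notation zb := (zero_bound q n r).
Local Notation rk c := (\rank (pol (comb Q c))).
Local Notation t0 := ((ceil_div n (2 * r)).-1).
Let q1 : (1 < q)%N := card_finNzRing_gt1 F.
Let q0 : (0 < q)%N := ltnW q1.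
Let n0 : (0 < n)%N. Proof. by apply: leq_trans hn; rewrite addn1. Qed.
Let n4 : (4 * r <= n)%N. Proof. by apply: leq_trans hn; rewrite addn1. Qed.

Lemma tdim_slope c : (tdim Q c <= slp (codim Q c))%N.
Proof.
have [M hM] := subspace_mx (tangent_subspace Q c).
have -> : tdim Q c = \rank M.
  rewrite /tdim -(trunc_expnK (\rank M) q1) -card_mx_rows; congr trunc_log.
  by apply: eq_card => x; rewrite [RHS]in_set hM.
apply: (semistable_rank hn hss (singular_space_subspace Q c) (card_singular_space Q c)).
  by rewrite subnK // codim_le.
by move=> c' x; rewrite hM => cT /singular_spaceP[_ ->].
Qed.

Lemma degenerate_half_rank c : c \in degenerate Q -> (t0 <= (qrank (comb Q c))./2)%N.
Proof. by rewrite in_set => /andP[c0 _]; exact: semistable_qrank. Qed.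

Lemma zb_ge0 k : 0 <= zb k. Proof. exact: zero_bound_ge0. Qed.

Lemma zb_step k i : zb (k + 2 * i) <= (q%:R ^+ i)^-1 * zb k.
Proof.
apply: zero_bound_step => // t tn; rewrite addn1; apply: leq_ltn_trans hq.
exact: leq_trans (leq_addl _ _) tn.
Qed.

(** Each degenerate form is charged to one index [f c] of the outer sum of [sigma2]. *)
Lemma regroup (f : 'rV[F]_r -> nat) (g : nat -> rat) :
  (forall c, c \in degenerate Q -> (2 * t0 <= f c < n)%N) ->
  (forall rho, (rho < n)%N -> \sum_(c in degenerate Q | f c == rho) zb (codim Q c) <= g rho) ->
  \sum_(c in degenerate Q) zb (codim Q c) <= \sum_((2 * t0)%N <= rho < n) g rho.
Proof.
move=> hf hg.
have -> : \sum_(c in degenerate Q) zb (codim Q c)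
  = \sum_((2 * t0)%N <= rho < n) \sum_(c in degenerate Q | f c == rho) zb (codim Q c).
  rewrite (exchange_big_dep (mem (degenerate Q))) /=; last by move=> ? ? _ /andP[].
  apply: eq_bigr => c cD; rewrite (eq_bigl (fun rho => rho == f c)); last first.
    by move=> rho; rewrite cD /= eq_sym.
  by rewrite big_nat1_eq hf.
by rewrite big_nat [leRHS]big_nat; apply: ler_sum => rho /andP[_]; exact: hg.
Qed.

Lemma sum_constant_codim (G : {set 'rV[F]_r}) rho (E : rat) :
  (forall c, c \in G -> codim Q c = rho) -> #|G|%:R <= E ->
  \sum_(c in G) zb (codim Q c) <= E * zb rho.
Proof.
move=> hG GE; rewrite (eq_bigr (fun=> zb rho)) => [|c /hG -> //].
by rewrite sumr_const -mulr_natl ler_wpM2r ?zb_ge0.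
Qed.

(** In odd characteristic the tangent forms vanish on the radical as quadratic forms too, so the
    singular space is the radical and its codimension is the polar rank. *)
Lemma singular_sum_odd_char : 1 + 1 != 0 :> F ->
  \sum_(c in degenerate Q) zb (codim Q c)
  <= \sum_((2 * t0)%N <= rho < n) bezout_bound q r (rho + 1) (slp rho) * zb rho.
Proof.
move=> c2; have rkE c : rk c = codim Q c.
  have RW : radical (comb Q c) = singular_space Q c.
    apply/setP => x; apply/idP/singular_spaceP => [xR|[]//]; split=> // c' /tangentP h.
    have := h x x xR xR; rewrite bfxx => /eqP.
    by rewrite -mulr_natl mulf_eq0 mulr2n (negbTE c2) /= => /eqP.
  have := card_singular_space Q c; rewrite -RW card_radical => /(congr1 (trunc_log q)).
  rewrite !trunc_expnK //; have := codim_le Q c; have := rank_leq_row (pol (comb Q c)).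
  by move: (\rank _) (codim _ _) => a b; lia.
apply: (regroup (f := codim Q)) => [c cD|rho rn].
  have := degenerate_half_rank cD; have [_ <-] := rank_pol_odd_char (comb Q c) c2.
  move: cD; rewrite in_set -rkE => /andP[_ ->]; rewrite andbT.
  by move: (\rank _) => a h; rewrite mul2n -[a]odd_double_half; apply: leq_trans (leq_addl _ _);
    rewrite leq_double.
have -> : \sum_(c in degenerate Q | codim Q c == rho) zb (codim Q c)
   = \sum_(c in [set c in degenerate Q | codim Q c == rho]) zb (codim Q c).
  by apply: eq_bigl => c; rewrite in_set.
apply: sum_constant_codim => [c|]; first by rewrite in_set => /andP[_ /eqP].
apply: bezout_bound_ge; rewrite ?addn1 //=; first exact: ltn_trans rn hq.
  by rewrite -[X in (_ <= q ^ X)%N]mul1n -card_mx max_card.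
move=> sr; apply: (@card_stratum_minors _ n r Q) => // c; rewrite in_set => /andP[_ /eqP cr].
by rewrite rkE cr; split=> //; apply: polar_tangentP; rewrite -cr tdim_slope.
Qed.

Section CharTwo.
Hypothesis char2 : 1 + 1 = 0 :> F.

(** Sort the forms by the excess [i] of the tangent dimension over [slp rho]. An excess [i] costs at
    most a factor [q ^ i] in the Bezout bound, but forces codimension at least [rho + 2 i], which
    divides [zb] by at least [q ^ i]. The factor [r - slp rho] is the number of possible
    excesses. *)
Lemma stratum_sum (G : {set 'rV[F]_r}) a rho : (slp rho < r)%N ->
  (forall c, c \in G -> [/\ rk c = a.*2, (slp (codim Q c) < r)%N
      & exists i, codim Q c = (rho + 2 * i)%N]) ->
  \sum_(c in G) zb (codim Q c)
  <= ((r - slp rho) * a.+1 ^ (r - slp rho) * q ^ slp rho)%:R * zb rho.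
Proof.
move=> sr hG; set k := (r - slp rho)%N; have k0 : (0 < k)%N by rewrite subn_gt0.
pose ex c := (tdim Q c - slp rho)%N.
have exk c : c \in G -> (ex c < k)%N.
  move=> cG; have [_ sc _] := hG c cG; rewrite /ex /k; apply: ltn_sub2r => //.
  exact: leq_ltn_trans (tdim_slope c) sc.
have zle c : c \in G -> zb (codim Q c) <= (q%:R ^+ ex c)^-1 * zb rho.
  move=> cG; have [_ _ [i ci]] := hG c cG.
  have exi : (ex c <= i)%N.
    by rewrite /ex leq_subLR; apply: leq_trans (tdim_slope c) _; rewrite ci slope_add.
  rewrite ci; apply: (le_trans (zb_step rho i)); rewrite ler_wpM2r ?zb_ge0 //.
  by rewrite lef_pV2 ?posrE ?exprn_gt0 ?ltr0n // ler_weXn2l // ler1n.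
case kE : k k0 exk => [//|k'] _ exk; rewrite -kE.
rewrite (partition_big (fun c => inord (ex c) : 'I_k'.+1) predT) //=.
have -> : ((k * a.+1 ^ k * q ^ slp rho)%:R * zb rho : rat)
  = \sum_(i < k'.+1) (a.+1 ^ k * q ^ slp rho)%:R * zb rho.
  by rewrite sumr_const card_ord -kE -[RHS]mulr_natl mulrA -natrM mulnA.
apply: ler_sum => i _.
pose Gi := [set c in G | ex c == i].
rewrite (eq_bigl (mem Gi)); last first.
  move=> c; rewrite -[RHS]/(c \in Gi) inE; case cG : (c \in G) => //=.
  by rewrite -(inj_eq val_inj) /= inordK // exk.
apply: (@le_trans _ _ (\sum_(c in Gi) (q%:R ^+ i)^-1 * zb rho)).
  apply: ler_sum => c cGi; have /andP[cG /eqP <-] : (c \in G) && (ex c == i) by move: cGi;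
    rewrite /= inE.
  exact: zle.
rewrite sumr_const -[leLHS]mulr_natl mulrA ler_wpM2r ?zb_ge0 //.
rewrite ler_pdivrMr ?exprn_gt0 ?ltr0n // -natrX -natrM ler_nat.
have ik : (slp rho + i <= r)%N.
  have lt : (i < k)%N by rewrite kE ltn_ord.
  by move: lt; rewrite /k ltn_subRL => /ltnW.
apply: (@leq_trans (a.+1 ^ (r - (slp rho + i)) * q ^ (slp rho + i))%N).
  apply: (card_stratum_char2 char2 (Q := Q)) => // c; rewrite in_set => /andP[cG /eqP ci].
  have [rc _ _] := hG c cG; split=> //; apply: polar_tangentP.
  by rewrite -leq_subLR -ci.
by rewrite expnD mulnA leq_mul2r leq_mul2r leq_pexp2l ?orbT //; apply: leq_sub2l; exact: leq_addr.
Qed.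

(* In characteristic 2 the polar rank is even and may be smaller than the codimension; charging [c]
   to this intermediate value lets the excess codimension pay for the larger tangent space. *)
Definition allotted c : nat :=
  if (r <= slp (codim Q c))%N then codim Q c
  else if odd (codim Q c) then (rk c).+1
  else if codim Q c == rk c then rk c else (rk c).+2.

(** The polar rank is even, so an odd codimension is at least [rk c + 1], and an even one other than
    [rk c] is at least [rk c + 2]. *)
Lemma allotted_props c : c \in degenerate Q ->
  [/\ (2 * t0 <= allotted c < n)%N, (allotted c <= codim Q c)%N & (rk c <= allotted c)%N].
Proof.
move=> cD; have [ev rq] := rank_pol_char2 (comb Q c) char2.
have t0r : (2 * t0 <= rk c)%N.
  have := degenerate_half_rank cD; move: ev rq; move: (\rank _) (qrank _) => a b ev rq h.
  rewrite mul2n -[a]odd_double_half (negbTE ev) add0n leq_double.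
  by case: rq h => <- //; rewrite -[a.+1./2]/(uphalf a) uphalf_half (negbTE ev).
have rc := rank_pol_le_codim Q c.
have cn : (codim Q c < n)%N by move: cD; rewrite in_set => /andP[].
have le : (allotted c <= codim Q c)%N /\ (rk c <= allotted c)%N.
  rewrite /allotted; have [_|_] := leqP r (slp (codim Q c)); first by split.
  case oc : (odd (codim Q c)) => /=.
    have ne : (rk c != codim Q c)%N by apply: contraNneq ev => ->; rewrite oc.
    by split; [rewrite ltn_neqAle ne rc | exact: leqnSn].
  case: eqP => [->//|/eqP ne]; split; last by rewrite ltnW.
  have lt : (rk c < codim Q c)%N by rewrite ltn_neqAle eq_sym ne rc.
  rewrite ltn_neqAle lt andbT; apply/negP => /eqP e.
  by move: oc; rewrite -e /= (negbTE ev).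
have [le1 le2] := le; split=> //.
by rewrite (leq_trans t0r le2) (leq_ltn_trans le1 cn).
Qed.

Lemma singular_sum_char2 :
  \sum_(c in degenerate Q) zb (codim Q c)
  <= \sum_((2 * t0)%N <= rho < n) bezout_bound q r (rho + 1) (slp rho) * zb rho.
Proof.
apply: (regroup (f := allotted)) => [c /allotted_props[]//|rho rn].
pose G := [set c in degenerate Q | allotted c == rho].
have -> : \sum_(c in degenerate Q | allotted c == rho) zb (codim Q c)
   = \sum_(c in G) zb (codim Q c).
  by apply: eq_bigl => c; rewrite /G in_set.
have GP c : c \in G -> c \in degenerate Q /\ allotted c = rho.
  by rewrite in_set => /andP[? /eqP].
have rq : (0 < rho + 1 <= q)%N by rewrite addn1 /=; exact: ltn_trans rn hq.
(* When [r <= slp rho] the Bezout bound is at least [q ^ r], the number of all forms. *)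
have [rs|sr] := leqP r (slp rho).
  apply: sum_constant_codim => [c /GP[cD cr]|].
    have [_ le _] := allotted_props cD.
    have rc : (r <= slp (codim Q c))%N by apply: leq_trans rs _; rewrite -cr slope_mono.
    by rewrite -cr /allotted rc.
  apply: bezout_bound_ge => // [|sr]; first by rewrite -[X in (_ <= q ^ X)%N]mul1n -card_mx max_card.
  have -> : slp rho = r by apply/eqP; rewrite eqn_leq sr rs.
  by rewrite subnn mul1n -[X in (_ <= q ^ X)%N]mul1n -card_mx max_card.
set k := (r - slp rho)%N; have k0 : (0 < k)%N by rewrite subn_gt0.
have bbE : bezout_bound q r (rho + 1) (slp rho) = ((rho + 1) ^ k * q ^ slp rho)%:R.
  by rewrite natrM !natrX /bezout_bound subzn ?(ltnW sr) // -exprnP.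
have small c : c \in G -> (slp (codim Q c) < r)%N.
  move=> /GP[cD cr]; rewrite ltnNge; apply/negP => rs.
  by move: cr sr; rewrite /allotted rs => <-; rewrite ltnNge rs.
have ev c : ~~ odd (rk c) by have [] := rank_pol_char2 (comb Q c) char2.
have cE c : c \in G -> rho = (if odd (codim Q c) then (rk c).+1
  else if codim Q c == rk c then rk c else (rk c).+2).
  by move=> cG; have [_ <-] := GP c cG; rewrite /allotted leqNgt small.
have cle c : c \in G -> (rho <= codim Q c)%N.
  by move=> /GP[cD <-]; have [] := allotted_props cD.
(* For odd [rho = 2 a + 1] only polar rank [2 a] with odd codimension occurs, and [k (a + 1) ^ k] is
   at most [(rho + 1) ^ k]. *)
rewrite bbE; case orho : (odd rho).
  pose a := rho./2; have rhoE : rho = a.*2.+1 by rewrite -[LHS]odd_double_half orho.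
  apply: (@le_trans _ _ ((k * a.+1 ^ k * q ^ slp rho)%:R * zb rho)).
    apply: stratum_sum => // c cG; split; first last.
    - exists ((codim Q c - rho)./2); have := cE c cG; have := cle c cG.
      case oc : (odd (codim Q c)) => le e.
        rewrite mul2n -[X in (_ + X)%N]add0n -[X in (_ + (X + _))%N]/(nat_of_bool false).
        have -> : false = odd (codim Q c - rho) by rewrite oddB // oc orho.
        by rewrite odd_double_half subnKC.
      by move: orho; rewrite e; case: eqP => _ /=; rewrite ?negbK (negbTE (ev c)).
    - exact: small.
    have := cE c cG; case: (odd (codim Q c)) => [|].
      by rewrite rhoE => /succn_inj.
    by move=> e; move: orho; rewrite {1}e; case: eqP => _ /=; rewrite ?negbK (negbTE (ev c)).
  rewrite ler_wpM2r ?zb_ge0 // ler_nat leq_mul2r; apply/orP; right.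
  by rewrite rhoE addn1 -doubleS -mul2n; exact: mul_power_double.
(* For even [rho = 2 a] a form has either polar rank and codimension [2 a], or polar rank [2 a - 2]
   and an even codimension at least [2 a]. *)
pose a := rho./2; have rhoE : rho = a.*2 by rewrite -[LHS]odd_double_half orho.
pose G1 := [set c in G | codim Q c == rk c].
pose G2 := [set c in G | codim Q c != rk c].
have oddc c : c \in G -> odd (codim Q c) = false.
  move=> cG; have := cE c cG; case: (odd _) => // e; move: orho; rewrite e /=.
  by rewrite (negbTE (ev c)).
have -> : \sum_(c in G) zb (codim Q c) = \sum_(c in G1) zb (codim Q c) + \sum_(c in G2) zb (codim Q c).
  rewrite (bigID (fun c => codim Q c == rk c)) /=; congr (_ + _);
  by apply: eq_bigl => c; rewrite [RHS]in_set.
have s1 : \sum_(c in G1) zb (codim Q c) <= (a.+1 ^ k * q ^ slp rho)%:R * zb rho.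
  have G1P c : c \in G1 -> [/\ c \in G, codim Q c = rho & rk c = rho].
    rewrite in_set => /andP[cG /eqP cr]; have := cE c cG.
    by rewrite oddc // cr eqxx => ->.
  apply: sum_constant_codim => [c /G1P[]//|]; rewrite ler_nat.
  apply: (card_stratum_char2 char2 (Q := Q)); first exact: ltnW.
  move=> c /G1P[cG cr rr]; split; first by rewrite rr.
  by apply: polar_tangentP; rewrite -cr tdim_slope.
have s2 : \sum_(c in G2) zb (codim Q c) <= (k * a ^ k * q ^ slp rho)%:R * zb rho.
  have G2P c : c \in G2 -> c \in G /\ rho = (rk c).+2.
    by rewrite in_set => /andP[cG /negbTE cr]; have := cE c cG; rewrite oddc // cr.
  case aE : a => [|b].
    have -> : G2 = set0.
      by apply/setP => c; rewrite [RHS]in_set0; apply/negP => /G2P[_]; rewrite rhoE aE.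
    by rewrite big_set0 mulr_ge0 ?zb_ge0.
  apply: stratum_sum => // c /G2P[cG e]; split; first by move: e; rewrite rhoE aE doubleS => -[].
    exact: small.
  exists ((codim Q c - rho)./2); have le := cle c cG.
  rewrite mul2n -[X in (_ + X)%N]add0n -[X in (_ + (X + _))%N]/(nat_of_bool false).
  have -> : false = odd (codim Q c - rho) by rewrite oddB // oddc // orho.
  by rewrite odd_double_half subnKC.
apply: (le_trans (lerD s1 s2)); rewrite -mulrDl ler_wpM2r ?zb_ge0 //.
rewrite -natrD ler_nat -mulnDl leq_mul2r; apply/orP; right.
by rewrite rhoE addn1 -mul2n; exact: sum_two_powers.
Qed.

End CharTwo.

Theorem nonsingular_zero : rank_sum q n r + singular_sum q n r < 1 ->
  exists x : 'rV[F]_n, (forall k, qf (Q k) x = 0) /\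
    forall c, c != 0 -> x *m pol (comb Q c) != 0.
Proof.
move=> lt1.
suff lt : (#|singular_zeros Q| < #|common_zeros Q|)%N.
  have /subsetPn[x xZ xS] : ~~ (common_zeros Q \subset singular_zeros Q).
    by apply: contraL lt => /subset_leq_card; rewrite -leqNgt.
  exists x; split=> [k|c c0]; first by move: xZ; rewrite in_set => /forallP /(_ k)/eqP.
  apply: contra xS => /eqP xc; rewrite in_set xZ /=; apply/existsP; exists c.
  by rewrite c0; apply/radicalP.
have qn0 : 0 < (q%:R : rat) ^+ n by rewrite exprn_gt0 // ltr0n.
have qr0 : 0 < (q%:R : rat) ^+ r by rewrite exprn_gt0 // ltr0n.
have qm0 : 0 < (q%:R : rat) - 1 by rewrite subr_gt0 ltr1n.
have lower := card_common_zeros_lower hr hn hss hq.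
have S0 : 0 <= singular_sum q n r.
  rewrite mulr_ge0 ?invr_ge0 ?(ltW qm0) // sumr_ge0 // => k _.
  by rewrite mulr_ge0 ?bezout_bound_ge0 ?zero_bound_ge0.
(* Without degenerate forms 0 is the only possible singular zero, and divisibility by [q] yields
   further common zeros. *)
have [ex|nex] := pickP (mem (degenerate Q)); last first.
  have le1 : (#|singular_zeros Q| <= 1)%N.
    by apply: singular_zeros_trivial => -[c cD]; have := nex c; rewrite /= cD.
  apply: (leq_ltn_trans le1); apply: (@leq_trans q) => //; apply: dvdn_leq.
    rewrite -(ltr0n rat); rewrite -(pmulr_lgt0 _ qr0).
    have : q%:R ^+ n * rank_sum q n r < q%:R ^+ n * 1 :> rat.
      by rewrite ltr_pM2l //; lra.
    rewrite mulr1; lra.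
  apply: card_common_zeros_dvd; apply: leq_trans hn; lia.
move=> exD.
have up : (q.-1 * #|singular_zeros Q|)%:R * q%:R ^+ r
   <= q%:R ^+ n * ((q%:R - 1) * singular_sum q n r) :> rat.
  have := card_singular_zeros (ex_intro _ ex exD); rewrite -(ler_nat rat) => le.
  apply: (le_trans (ler_wpM2r (ltW qr0) le)).
  rewrite natr_sum mulr_suml.
  apply: (@le_trans _ _ (\sum_(c in degenerate Q) q%:R ^+ n * zb (codim Q c))).
    apply: ler_sum => c _.
    have := card_common_zeros_subspace hr hn hss hq (singular_space_subspace Q c)
      (card_singular_space Q c).
    by rewrite subKn // codim_le.
  rewrite -mulr_sumr ler_wpM2l ?(ltW qn0) // /singular_sum mulrA divff ?lt0r_neq0 // mul1r.
  have [c2|c2] := eqVneq (1 + 1 : F) 0; [exact: singular_sum_char2 | exact: singular_sum_odd_char].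
have qE : (q.-1)%:R = (q%:R : rat) - 1 by rewrite -subn1 natrB.
rewrite natrM qE -!mulrA [leRHS]mulrCA ler_pM2l // in up.
rewrite -(ltr_nat rat) -(ltr_pM2r qr0).
have : q%:R ^+ n * (rank_sum q n r + singular_sum q n r) < q%:R ^+ n * 1 :> rat by rewrite ltr_pM2l.
rewrite mulr1 mulrDr; lra.
Qed.

End SingularSum.

(** For one form the field may be too small for [n < q], so the count is made directly: the rank is
    at least 4, the vertex has at most [q ^ (n - 4)] vectors, fewer than there are zeros, and a zero
    outside the vertex is nonsingular. *)
Lemma nonsingular_zero_single_form (F : finFieldType) n (Q : 'I_1 -> 'M[F]_n) :
  (5 <= n)%N -> semistable Q ->
  exists x : 'rV[F]_n, (forall k, qf (Q k) x = 0) /\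
    forall c, c != 0 -> x *m pol (comb Q c) != 0.
Proof.
move=> n5 hss; pose A := Q 0.
have combE c : comb Q c = c 0 0 *: A by rewrite /comb big_ord1.
have c1 : (const_mx 1 : 'rV[F]_1) != 0.
  by apply/eqP => /rowP/(_ 0); rewrite !mxE; apply/eqP/oner_neq0.
have h2 : (2 <= (qrank A)./2)%N.
  have := semistable_qrank (ltn0Sn 0) n5 hss c1; rewrite combE mxE scale1r.
  apply: leq_trans; rewrite /ceil_div; have := leq_div2r (2 * 1) (_ : 6 <= n + 2 * 1 - 1)%N; lia.
have rn := qrank_le A.
suff /subsetPn[x] : ~~ (zeros A [set: 'rV[F]_n] \subset vertex A).
  rewrite inE vertexE => /andP[_ xz]; rewrite xz andbT => xr.
  exists x; split=> [k|c c0]; first by rewrite ord1; apply/eqP.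
  rewrite combE; have c00 : c 0 0 != 0.
    by apply: contraNneq c0 => e; apply/eqP/rowP => i; rewrite ord1 e mxE.
  have -> : pol (c 0 0 *: A) = c 0 0 *: pol A by rewrite /pol linearZ scalerDr.
  rewrite -scalemxAr scaler_eq0 negb_or c00; apply: contra xr => /eqP h; exact/radicalP.
apply/negP => /subset_leq_card; rewrite card_vertex.
have [s [s1 _ e]] := zeros_sign A.
set N := #|zeros _ _| in e *; set h := _./2 in h2 e; have q1 := card_finNzRing_gt1 F.
move: e q1; set q := #|F| => e q1.
have le1 : (q ^ (n - h) <= q ^ (n - 2))%N by rewrite leq_pexp2l ?(ltnW q1) // leq_sub2l.
have le2 : (q ^ (n - qrank A) <= q ^ (n - 4))%N.
  rewrite leq_pexp2l ?(ltnW q1) // leq_sub2l //.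
  by rewrite -[qrank A]odd_double_half (leq_trans _ (leq_addl _ _)) // -/h -[4%N]/(2.*2) leq_double.
move=> le3; have {le3 le2} le : (N <= q ^ (n - 4))%N by exact: leq_trans le3 le2.
have e1 : (q ^ (n - 2) = q ^ (n - 4) * q * q)%N by rewrite -!expnSr; congr (_ ^ _)%N; lia.
have e2 : (q ^ n = q ^ (n - 2) * q * q)%N by rewrite -!expnSr; congr (_ ^ _)%N; lia.
have q0 : (0 < q ^ (n - 4))%N by rewrite expn_gt0 (ltnW q1).
move: s1 e le le1 e1 e2 q0; move: (q ^ n)%N (q ^ (n - 2))%N (q ^ (n - 4))%N (q ^ (n - h))%N => a b d f.
rewrite !inE => s1 e le le1 e1 e2 d0.
have ge : (a <= q * N + q.-1 * f)%N.
  move: (q * N)%N (q.-1 * f)%N e => X Y e; clear -s1 e.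
  by case/or3P: s1 => /eqP s1; move: e; rewrite s1; lia.
have {ge} : (a <= q * d + q.-1 * b)%N.
  by apply: leq_trans ge _; rewrite leq_add // leq_mul2l ?le ?le1 orbT.
rewrite e2 e1; case: q q1 {e le le1 e1 e2} => [|[|k]] // _; nia.
Qed.

(** * Local fields *)

Record local_field (K : fieldType) (q : nat) := LocalField {
  lval :> K -> int;
  unif : K;
  lvalM : forall x y, x != 0 -> y != 0 -> lval (x * y) = lval x + lval y;
  lvalD : forall x y, x != 0 -> y != 0 -> x + y != 0 -> Num.min (lval x) (lval y) <= lval (x + y);
  unif0 : unif != 0;
  lval_unif : lval unif = 1;
  lval_complete : vcomplete lval;
  lval_residue : residue_card lval q }.

Section Normalization.
Variables (K : fieldType) (v : K -> int).
Hypothesis vM : forall x y, x != 0 -> y != 0 -> v (x * y) = v x + v y.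

Lemma valuation1 : v 1 = 0.
Proof. by apply: (addrI (v 1)); rewrite -vM ?oner_neq0 // mulr1 addr0. Qed.

Lemma valuationV x : x != 0 -> v x^-1 = - v x.
Proof.
by move=> x0; apply: (addrI (v x)); rewrite -vM ?invr_neq0 // divff // valuation1 addrN.
Qed.

Lemma valuationX x k : x != 0 -> v (x ^+ k) = v x *+ k.
Proof.
move=> x0; elim: k => [|k IH]; first by rewrite expr0 valuation1.
by rewrite exprS mulrS vM ?expf_neq0 // IH.
Qed.

Lemma valuationXz x (k : int) : x != 0 -> v (x ^ k) = k * v x.
Proof.
move=> x0; case: k => k; first by rewrite -exprnP valuationX // -mulr_natl natz.
by rewrite NegzE -exprnN valuationV ?expf_neq0 // valuationX // mulNr -mulr_natl natz.
Qed.

Lemma valuationN x : v (- x) = v x.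
Proof.
have [->|x0] := eqVneq x 0; first by rewrite oppr0.
have m1 : (-1 : K) != 0 by rewrite oppr_eq0 oner_neq0.
rewrite -mulN1r vM //; have : v (-1) + v (-1) = 0.
  by rewrite -vM // mulrNN mulr1 valuation1.
lia.
Qed.

(** Take an element of least positive value: the remainder of any value modulo it is again a value,
    hence zero. *)
Lemma valuation_generator : (exists x, (x != 0) && (v x != 0)) ->
  exists p, [/\ p != 0, 0 < v p & forall x, x != 0 -> (v p %| v x)%Z].
Proof.
move=> [x /andP[x0 vx]].
have [p [p0 vp pmin]] : exists p, [/\ p != 0, 0 < v p &
    forall y, y != 0 -> 0 < v y -> v p <= v y].
  have [y y0 vy] : exists2 y, y != 0 & 0 < v y.
    have [vxp|vxn|/eqP] := ltgtP (v x) 0; last by rewrite (negbTE vx).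
      by exists x^-1; rewrite ?invr_neq0 // valuationV // oppr_gt0.
    by exists x.
  have [m le] : exists m : nat, v y <= m%:Z by exists `|v y|%N; lia.
  elim: m y y0 vy le => [|m IH] y y0 vy le; first by lia.
  case: (classic (exists z, [/\ z != 0, 0 < v z & v z < v y])) => [[z [z0 vz zy]]|no].
    by apply: (IH z) => //; lia.
  exists y; split=> // z z0 vz; rewrite leNgt; apply/negP => zy; apply: no.
  by exists z.
exists p; split=> // y y0; apply/eqP.
pose k := (v y %/ v p)%Z; pose z := y * p ^ (- k).
have z0 : z != 0 by rewrite mulf_neq0 // expfz_neq0.
have vz : v z = (v y %% v p)%Z.
  by rewrite vM ?expfz_neq0 // valuationXz // mulNr [in LHS](divz_eq (v y) (v p)) -/k; lia.
have rlt : (v y %% v p)%Z < v p by have := ltz_mod (v y) (lt0r_neq0 vp); lia.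
have rge : 0 <= (v y %% v p)%Z by rewrite modz_ge0 // lt0r_neq0.
apply/eqP; apply/dvdz_mod0P; apply/eqP; rewrite eq_le rge andbT leNgt; apply/negP => rpos.
by have := pmin z z0; rewrite vz => /(_ rpos); lia.
Qed.

End Normalization.

Lemma normalized_local_field (K : fieldType) (v : K -> int) q :
  padic_field v q -> exists w : local_field K q, True.
Proof.
move=> [_ [vM vD vx] vc [s [ss s1 s2 s3]]].
have [p [p0 vp pd]] := valuation_generator vM vx.
pose w x := (v x %/ v p)%Z.
have d0 := lt0r_neq0 vp.
have wE x : x != 0 -> v x = w x * v p by move=> /pd /divzK.
have smallE N x : vsmall w N x <-> vsmall v (N * v p) x.
  by split=> -[->|h]; [left|right; rewrite -lez_divRL|left|right; rewrite lez_divRL].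
have maxE x : vsmall w 1 x <-> vsmall v 1 x.
  split=> -[->|h]; [by left| |by left|].
    have [->|x0] := eqVneq x 0; [by left|right; rewrite wE //; nia].
  have [->|x0] := eqVneq x 0; [by left|right; move: h; rewrite wE //; nia].
have ringE x : vsmall w 0 x <-> vsmall v 0 x by rewrite smallE mul0r.
have wM x y : x != 0 -> y != 0 -> w (x * y) = w x + w y.
  by move=> x0 y0; apply: (mulIf d0); rewrite mulrDl -!wE ?mulf_neq0 // vM.
have wD x y : x != 0 -> y != 0 -> x + y != 0 -> Num.min (w x) (w y) <= w (x + y).
  move=> x0 y0 xy0; have := vD x y x0 y0 xy0.
  by rewrite (wE _ x0) (wE _ y0) (wE _ xy0) -minr_pMl ?(ltW vp) // ler_pM2r.
have wp : w p = 1 by rewrite /w divzz d0.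
have wc : vcomplete w.
  move=> u hu; have [|l hl] := vc u.
    move=> N; have [M hM] := hu `|N|; exists M => m k Mm Mk.
    have /smallE[->|h] := hM m k Mm Mk; [by left|right].
    by apply: le_trans h; nia.
  by exists l => N; have [M hM] := hl (N * v p); exists M => m Mm; apply/smallE/hM.
have wr : residue_card w q.
  exists s; split=> // [i iq|i j iq jq ij|x]; first by apply/ringE/s1.
    by move=> /maxE; exact: s2.
  by move=> /ringE /s3[i iq /maxE]; exists i.
by exists (LocalField wM wD p0 wp wc wr).
Qed.

(** The ideal generated by the power [N] of the uniformizer; zero is listed apart because [v 0]
    carries no meaning. *)
Definition pow_ideal (K : fieldType) q (v : local_field K q) (N : nat) : {pred K} :=
  fun x => (x == 0) || (N%:Z <= v x).

Definition vring (K : fieldType) q (v : local_field K q) : {pred K} := pow_ideal v 0.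

Section ValuationRing.
Variables (K : fieldType) (q : nat) (v : local_field K q).
Local Notation p := (unif v).

Lemma pow_idealP (N : nat) x : reflect (vsmall v N x) (x \in pow_ideal v N).
Proof. by apply: (iffP orP) => [[/eqP|]|[->|]]; [left|right|left|right]. Qed.

Lemma pow_ideal_zmod_closed N : zmod_closed (pow_ideal v N).
Proof.
split=> [|x y]; first by rewrite unfold_in eqxx.
rewrite !unfold_in; have [->|x0] /= := eqVneq x 0.
  rewrite sub0r oppr_eq0; case: eqVneq => //= y0; by rewrite (valuationN (@lvalM _ _ v)).
move=> hx; have [->|y0] /= := eqVneq y 0; first by rewrite subr0 hx orbT.
move=> hy; have [//|xy] /= := eqVneq (x - y) 0.
have := lvalD v x0 (_ : - y != 0) xy; rewrite oppr_eq0 => /(_ y0).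
apply: le_trans; by rewrite (valuationN (@lvalM _ _ v)) le_min hx.
Qed.

HB.instance Definition _ N := GRing.isZmodClosed.Build K (pow_ideal v N) (pow_ideal_zmod_closed N).

Lemma pow_idealM N M x y : x \in pow_ideal v N -> y \in pow_ideal v M ->
  x * y \in pow_ideal v (N + M).
Proof.
rewrite !unfold_in; case: eqVneq => [->|x0 /= hx]; first by rewrite mul0r eqxx.
case: eqVneq => [->|y0 /= hy]; first by rewrite mulr0 eqxx.
by rewrite lvalM // orbC PoszD lerD.
Qed.

Lemma pow_idealW N M x : (M <= N)%N -> x \in pow_ideal v N -> x \in pow_ideal v M.
Proof. by move=> MN; rewrite !unfold_in => /orP[->//|h]; apply/orP; right; lia. Qed.

Lemma vring_subring_closed : subring_closed (vring v).
Proof.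
split=> [|x y hx hy|x y hx hy]; last exact: (pow_idealM hx hy).
  by rewrite unfold_in (valuation1 (@lvalM _ _ v)) lexx orbT.
exact: (rpredB hx hy).
Qed.

HB.instance Definition _ := GRing.isSubringClosed.Build K (vring v) vring_subring_closed.

Lemma pow_ideal_vring N x : x \in pow_ideal v N -> x \in vring v.
Proof. exact: pow_idealW. Qed.

Lemma unifX_neq0 N : p ^+ N != 0. Proof. by rewrite expf_neq0 ?unif0. Qed.

Lemma pow_idealE N x : (x \in pow_ideal v N) = (x / p ^+ N \in vring v).
Proof.
rewrite !unfold_in mulf_eq0 invr_eq0 (negbTE (unifX_neq0 _)) orbF.
case: eqVneq => //= x0; rewrite lvalM ?invr_neq0 ?unifX_neq0 //.
rewrite (valuationV (@lvalM _ _ v)) ?unifX_neq0 // (valuationX (@lvalM _ _ v)) ?unif0 // lval_unif.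
by rewrite subr_ge0 natz.
Qed.

Lemma vring_unitP x : x \in vring v -> x \notin pow_ideal v 1 -> x != 0 /\ x^-1 \in vring v.
Proof.
rewrite !unfold_in negb_or => hx /andP[x0 h]; split=> //.
rewrite invr_eq0 (negbTE x0) /= in hx *; rewrite (valuationV (@lvalM _ _ v)) //; lia.
Qed.

Lemma pow_ideal_prime x y : x \in vring v -> y \in vring v -> x * y \in pow_ideal v 1 ->
  x \in pow_ideal v 1 \/ y \in pow_ideal v 1.
Proof.
move=> hx hy xy; case xm : (x \in pow_ideal v 1); [by left|right].
have [x0 xi] := vring_unitP hx (negbT xm).
by rewrite -[y](mulKf x0); exact: pow_idealM xi xy.
Qed.

(** The field structure is carried by the indices ['I_q] of the given representatives, with
    operations computed on representatives. Outside the valuation ring [red] takes a default value,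
    whence the integrality hypotheses. *)
Lemma residue_field : exists (F : finFieldType) (red : K -> F) (lift : F -> K),
  [/\ #|F| = q, (forall a, lift a \in vring v /\ red (lift a) = a),
    (forall x y, x \in vring v -> y \in vring v -> (red x == red y) = (x - y \in pow_ideal v 1)),
    (forall x y, x \in vring v -> y \in vring v -> red (x + y) = red x + red y)
   & red 1 = 1 /\ (forall x y, x \in vring v -> y \in vring v -> red (x * y) = red x * red y)].
Proof.
have [s [ss s1 s2 s3]] := lval_residue v.
have q0 : (0 < q)%N.
  by have [|i iq _] := s3 1; [apply/(pow_idealP 0); exact: (rpred1 (vring v))|exact: leq_ltn_trans iq].
pose R := 'I_q; pose lift (i : R) := nth 0 s i.
have liftO i : lift i \in vring v by apply/(pow_idealP 0)/s1.
pose near x (i : R) := x - lift i \in pow_ideal v 1.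
pose red x : R := odflt (Ordinal q0) [pick i | near x i].
have redP x : x \in vring v -> x - lift (red x) \in pow_ideal v 1.
  rewrite /red => xO; case: pickP => [i //|no].
  have [|i iq /(pow_idealP 1) h] := s3 x; first exact/(pow_idealP 0).
  by have := no (Ordinal iq); rewrite /near h.
have liftI i j : lift i - lift j \in pow_ideal v 1 -> i = j.
  move=> h; apply/val_inj/eqP/negPn/negP => /eqP ij.
  by apply: (s2 i j) => //; apply/(pow_idealP 1).
have redE x y : x \in vring v -> y \in vring v -> (red x == red y) = (x - y \in pow_ideal v 1).
  move=> xO yO; apply/eqP/idP => [e|xy].
    have -> : x - y = (x - lift (red x)) - (y - lift (red y)) by rewrite e; ring.
    by rewrite rpredB // redP.
  apply: liftI.
  have -> : lift (red x) - lift (red y) = (x - y) - (x - lift (red x)) + (y - lift (red y)) by ring.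
  exact: rpredD (rpredB xy (redP _ xO)) (redP _ yO).
have liftK i : red (lift i) = i.
  apply: liftI; have := redP _ (liftO i); rewrite -rpredN opprB.
  exact.
pose add (i j : R) := red (lift i + lift j); pose opp (i : R) := red (- lift i).
pose mul (i j : R) := red (lift i * lift j).
pose inv (i : R) := if i == red 0 then red 0 else red (lift i)^-1.
have redD x y : x \in vring v -> y \in vring v -> red (x + y) = add (red x) (red y).
  move=> xO yO; apply/eqP; rewrite (redE _ _ (rpredD xO yO) (rpredD (liftO _) (liftO _))).
  have -> : x + y - (lift (red x) + lift (red y)) = (x - lift (red x)) + (y - lift (red y)) by ring.
  exact: rpredD (redP _ xO) (redP _ yO).
have redM x y : x \in vring v -> y \in vring v -> red (x * y) = mul (red x) (red y).
  move=> xO yO; apply/eqP; rewrite (redE _ _ (rpredM xO yO) (rpredM (liftO _) (liftO _))).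
  have -> : x * y - lift (red x) * lift (red y)
     = (x - lift (red x)) * y + lift (red x) * (y - lift (red y)) by ring.
  by rewrite rpredD //; [apply: (@pow_idealM 1 0)|apply: (@pow_idealM 0 1)]; rewrite ?redP.
have redN x : x \in vring v -> red (- x) = opp (red x).
  move=> xO; apply/eqP; rewrite (redE _ _ (etrans (rpredN _ _) xO) (etrans (rpredN _ _) (liftO _))).
  have -> : - x - - lift (red x) = - (x - lift (red x)) by ring.
  by rewrite rpredN redP.
have O0 : 0 \in vring v := rpred0 _. have O1 : 1 \in vring v := rpred1 _.
have addA : associative add.
  move=> i j k; rewrite -[i]liftK -[j]liftK -[k]liftK -!redD ?rpredD // addrA //.
have addC : commutative add by move=> i j; rewrite /add addrC.
have add0 : left_id (red 0) add by move=> i; rewrite -[i]liftK -redD // add0r.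
have addN : left_inverse (red 0) opp add.
  by move=> i; rewrite -[i]liftK -redN // -redD ?rpredN // addNr.
have mulA : associative mul.
  by move=> i j k; rewrite -[i]liftK -[j]liftK -[k]liftK -!redM ?rpredM // mulrA.
have mulC : commutative mul by move=> i j; rewrite /mul mulrC.
have mul1 : left_id (red 1) mul by move=> i; rewrite -[i]liftK -redM // mul1r.
have mulD : left_distributive mul add.
  move=> i j k; rewrite -[i]liftK -[j]liftK -[k]liftK -(redD _ _ (liftO i) (liftO j)).
  by rewrite -!redM ?rpredD // -redD ?rpredM // mulrDl.
have neq10 : red 1 != red 0.
  rewrite redE // subr0 unfold_in oner_eq0 /= (valuation1 (@lvalM _ _ v)).
  by [].
have mulV i : i != red 0 -> mul (inv i) i = red 1.
  move=> i0; rewrite /inv (negbTE i0).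
  have [l0 lO] : lift i != 0 /\ (lift i)^-1 \in vring v.
    apply: vring_unitP => //; move: i0; by rewrite -{1}[i]liftK redE // subr0.
  by rewrite -{2}[i]liftK -redM // mulVf.
have inv0 : inv (red 0) = red 0 by rewrite /inv eqxx.
pose Rz := GRing.isZmodule.Build R addA addC add0 addN.
pose Rr := GRing.Zmodule_isComNzRing.Build (HB.pack_for zmodType R Rz) mulA mulC mul1 mulD neq10.
pose Rf := GRing.ComNzRing_isField.Build (HB.pack_for comNzRingType R Rz Rr) mulV inv0.
pose F : finFieldType := HB.pack R Rz Rr Rf.
by exists F, red, lift; split=> //; rewrite -[RHS]card_ord.
Qed.

End ValuationRing.

(** * Smith normal form over the valuation ring *)

Section Smith.
Variables (K : fieldType) (q : nat) (v : local_field K q).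
Local Notation O := (vring v).
Local Notation p := (unif v).

Lemma mx_pow_idealM N M m n l (A : 'M[K]_(m, n)) (B : 'M_(n, l)) :
  A \is a mxOver (pow_ideal v N) -> B \is a mxOver (pow_ideal v M) ->
  A *m B \is a mxOver (pow_ideal v (N + M)).
Proof.
move=> /mxOverP hA /mxOverP hB; apply/mxOverP => i j; rewrite mxE.
by apply: rpred_sum => k _; exact: pow_idealM.
Qed.

Lemma mx_pow_idealE N m n (A : 'M[K]_(m, n)) :
  (A \is a mxOver (pow_ideal v N)) = ((p ^+ N)^-1 *: A \is a mxOver O).
Proof.
by apply/mxOverP/mxOverP => h i j; have := h i j; rewrite pow_idealE mxE mulrC.
Qed.

Lemma det_vring n (A : 'M[K]_n) : A \is a mxOver O -> \det A \in O.
Proof.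
move=> /mxOverP hA; apply: rpred_sum => s _; rewrite rpredMsign.
by apply: rpred_prod => i _.
Qed.

(** This is [GL_n] of the valuation ring: a determinant outside the maximal ideal is a unit. *)
Definition unimodular n (A : 'M[K]_n) :=
  A \is a mxOver O /\ \det A \notin pow_ideal v 1.

Lemma one_notin_max : 1 \notin pow_ideal v 1.
Proof. by rewrite unfold_in oner_eq0 /= (valuation1 (@lvalM _ _ v)). Qed.

Lemma unimodularM n (A B : 'M[K]_n) : unimodular A -> unimodular B -> unimodular (A *m B).
Proof.
move=> [hA dA] [hB dB]; split; first exact: mxOverM.
rewrite det_mulmx; apply/negP => /(pow_ideal_prime (det_vring hA) (det_vring hB)).
by case; apply/negP.
Qed.

Lemma unimodular_unit n (A : 'M[K]_n) : unimodular A -> A \in unitmx.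
Proof.
move=> [hA dA]; rewrite unitmxE unitfE.
by have [] := vring_unitP (det_vring hA) dA.
Qed.

Lemma unimodularV n (A : 'M[K]_n) : unimodular A -> unimodular (invmx A).
Proof.
move=> uA; have [hA dA] := uA; have Au := unimodular_unit uA.
have [d0 di] := vring_unitP (det_vring hA) dA; split; last first.
  rewrite det_inv; apply/negP => h; move/negP: one_notin_max; apply.
  by rewrite -(divff d0); exact: (pow_idealM (N := 0) (M := 1) (det_vring hA) h).
rewrite /invmx Au; apply/mxOverP => i j; rewrite mxE rpredM // mxE rpredMsign.
apply: det_vring; apply/mxOverP => k l; rewrite !mxE; exact: (mxOverP hA).
Qed.

Lemma unimodular_val n (A : 'M[K]_n) : unimodular A -> v (\det A) = 0.
Proof.
move=> [/det_vring]; rewrite !unfold_in negb_or => h /andP[d0].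
by rewrite (negbTE d0) /= in h *; lia.
Qed.

Lemma unimodular_perm n (s : 'S_n) : unimodular (perm_mx s : 'M[K]_n).
Proof.
split; first by apply/mxOverP => i j; rewrite !mxE; case: (_ == _); rewrite ?rpred1 ?rpred0.
by rewrite det_perm; case: odd_perm; rewrite ?expr1 ?rpredN one_notin_max.
Qed.

Lemma mxOver_block m1 m2 n1 n2 (A : 'M[K]_(m1, n1)) (B : 'M_(m1, n2)) (C : 'M_(m2,
  n1)) (D : 'M_(m2, n2)) :
  A \is a mxOver O -> B \is a mxOver O -> C \is a mxOver O -> D \is a mxOver O ->
  block_mx A B C D \is a mxOver O.
Proof.
move=> /mxOverP hA /mxOverP hB /mxOverP hC /mxOverP hD; apply/mxOverP => i j.
by rewrite !mxE; case: (split i) => k; rewrite !mxE; case: (split j).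
Qed.

Lemma mxOver1 n : (1%:M : 'M[K]_n) \is a mxOver O.
Proof. by apply/mxOverP => i j; rewrite mxE; case: eqP; rewrite ?rpred1 ?rpred0. Qed.

Lemma mxOver_zero m n : (0 : 'M[K]_(m, n)) \is a mxOver O.
Proof. by apply/mxOverP => i j; rewrite mxE rpred0. Qed.

(** An entry of least valuation divides all others, so it can serve as pivot to clear its row and
    column. It also divides the remaining block [M'], which gives the divisibility chain. *)
Lemma smith n (A : 'M[K]_n) : A \in unitmx -> exists G H (d : 'rV_n),
  [/\ unimodular G, unimodular H, G *m A *m H = diag_mx d
    & forall i j : 'I_n, (i <= j)%N -> d 0 j / d 0 i \in O].
Proof.
elim: n A => [|n IH] A Au.
  exists 1%:M, 1%:M, 0; split; [split|split| |by case]; rewrite ?mxOver1 ?det1 ?one_notin_max //.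
  by apply/matrixP => -[].
have [[i0 j0] A0] : exists x : 'I_n.+1 * 'I_n.+1, A x.1 x.2 != 0.
  have [x h|no] := pickP (fun x : 'I_n.+1 * 'I_n.+1 => A x.1 x.2 != 0); first by exists x.
  have A00 : A = 0 by apply/matrixP => i j; rewrite mxE; apply/eqP; have := no (i, j) => /negbFE.
  by move: Au; rewrite A00 unitmxE det0 // unitr0.
pose P x := A x.1 x.2 != 0; pose val x := v (A x.1 x.2).
case: (Order.TotalTheory.arg_minP val (A0 : P (i0, j0))) => -[i j] /= aij amin.
pose B : 'M[K]_(1 + n) := xrow ord0 i (xcol ord0 j A).
pose a := A i j.
have a0 : a != 0 by [].
have Aa k l : A k l / a \in O.
  have [->|kl] := eqVneq (A k l) 0; first by rewrite mul0r rpred0.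
  rewrite unfold_in lvalM ?invr_neq0 // (valuationV (@lvalM _ _ v)) //.
  by apply/orP; right; rewrite subr_ge0; exact: (amin (k, l)).
have BE : B = perm_mx (tperm ord0 i) *m A *m perm_mx (tperm ord0 j).
  by rewrite /B xrowE xcolE mulmxA.
have B00 : B ord0 ord0 = a by rewrite !mxE !tpermL.
have Ba k l : B k l / a \in O by rewrite !mxE.
have [u [l [M B1]]] : exists u l M, B = block_mx (a%:M : 'M_1) u l M :> 'M_(1 + n).
  exists (ursubmx B), (dlsubmx B), (drsubmx B).
  rewrite -[LHS](@submxK K 1 n 1 n); congr block_mx; apply/matrixP => x y;
    rewrite !ord1 [RHS]mxE eqxx mulr1n -B00 !mxE.
  by congr (A _ _); congr (tperm _ _ _); apply/val_inj.
have ua : a^-1 *: u \is a mxOver O.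
  apply/mxOverP => x y; have := Ba (lshift n x) (rshift 1 y).
  by rewrite B1 (block_mxEur (a%:M : 'M_1)) mxE mulrC.
have la : a^-1 *: l \is a mxOver O.
  apply/mxOverP => x y; have := Ba (rshift 1 x) (lshift n y).
  by rewrite B1 (block_mxEdl (a%:M : 'M_1)) mxE mulrC.
have Ma : a^-1 *: M \is a mxOver O.
  apply/mxOverP => x y; have := Ba (rshift 1 x) (rshift 1 y).
  by rewrite B1 (block_mxEdr (a%:M : 'M_1)) mxE mulrC.
pose L := block_mx (1%:M : 'M_1) 0 (- (a^-1 *: l)) 1%:M.
pose R := block_mx (1%:M : 'M_1) (- (a^-1 *: u)) 0 1%:M.
pose M' := M - (a^-1 *: l) *m u.
have LBR : L *m block_mx (a%:M : 'M_1) u l M *m R = block_mx (a%:M : 'M_1) 0 0 M'.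
  rewrite /L /R !mulmx_block !mul0mx !mul1mx !mulmx0 !mulmx1 !addr0 !mulNmx.
  have e1 : (a^-1 *: l) *m a%:M = l by rewrite mul_mx_scalar scalerA divff // scale1r.
  have e2 : a%:M *m (a^-1 *: u) = u by rewrite mul_scalar_mx scalerA divff // scale1r.
  by rewrite e1 addNr mul0mx !add0r mulmxN e2 addNr addrC.
have uL : unimodular L.
  split; last by rewrite /L det_lblock !det1 mulr1 one_notin_max.
  by apply: mxOver_block; rewrite ?mxOver1 ?mxOver_zero // rpredN.
have uR : unimodular R.
  split; last by rewrite /R det_ublock !det1 mulr1 one_notin_max.
  by apply: mxOver_block; rewrite ?mxOver1 ?mxOver_zero // rpredN.
have uB : block_mx (a%:M : 'M_1) u l M \in unitmx.
  by rewrite -B1 BE !unitmx_mul Au !unitmx_perm.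
have M'u : M' \in unitmx.
  have : L *m block_mx (a%:M : 'M_1) u l M *m R \in unitmx.
    by rewrite !unitmx_mul uB (unimodular_unit uL) (unimodular_unit uR).
  by rewrite LBR !unitmxE det_ublock unitrM => /andP[].
have [G [H [d [uG uH GMH dd]]]] := IH M' M'u.
have da i1 : d 0 i1 / a \in O.
  have M'a : a^-1 *: M' \is a mxOver O.
    by rewrite scalerBr scalemxAr rpredB // mxOverM.
  have := mxOverM (mxOverM uG.1 M'a) uH.1; rewrite -scalemxAr -scalemxAl GMH.
  by move/mxOverP/(_ i1 i1); rewrite !mxE eqxx mulr1n mulrC.
pose ext (X : 'M[K]_n) := block_mx (1%:M : 'M_1) 0 0 X.
have uext X : unimodular X -> unimodular (ext X).
  case=> hX dX; split; last by rewrite /ext det_ublock det1 mul1r.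
  by apply: mxOver_block; rewrite ?mxOver1 ?mxOver_zero.
exists (ext G *m L *m perm_mx (tperm ord0 i)), (perm_mx (tperm ord0 j) *m R *m ext H).
exists (row_mx (a%:M : 'M_1) d); split.
- exact: unimodularM (unimodularM (uext G uG) uL) (unimodular_perm _).
- exact: unimodularM (unimodularM (unimodular_perm _) uR) (uext H uH).
- have -> : ext G *m L *m perm_mx (tperm ord0 i) *m A *m (perm_mx (tperm ord0 j) *m R *m ext H)
    = ext G *m (L *m (perm_mx (tperm ord0 i) *m A *m perm_mx (tperm ord0 j)) *m R) *m ext H.
    by rewrite !mulmxA.
  rewrite -BE B1 LBR /ext !mulmx_block !mul0mx !mulmx0 !mul1mx !mulmx1 !addr0 !add0r GMH.
  apply: etrans (esym (@diag_mx_row K n 1 (a%:M : 'rV_1) d)).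
  by rewrite mul0mx; congr (block_mx _ _ _ _); apply/matrixP => x y; rewrite !ord1 !mxE !eqxx !mulr1n.
move=> k l' kl; rewrite !mxE; case: (@splitP 1 n k) kl => k' ek; case: (@splitP 1 n l') => l1 el kl.
- by rewrite !ord1 !mxE eqxx mulr1n divff ?rpred1.
- by rewrite !ord1 !mxE eqxx mulr1n.
- by move: kl; rewrite ek el ord1.
by apply: dd; move: kl; rewrite ek el leq_add2l.
Qed.

End Smith.

(** * Limits, integral systems and Hensel's lemma *)

Section Approximation.
Variables (K : fieldType) (q : nat) (v : local_field K q).
Local Notation O := (vring v).
Local Notation p := (unif v).
Local Notation pid := (pow_ideal v).

Lemma mx_pow_idealB N m n (A B : 'M[K]_(m, n)) :
  A \is a mxOver (pid N) -> B \is a mxOver (pid N) -> A - B \is a mxOver (pid N).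
Proof. by move=> hA hB; rewrite rpredB. Qed.

Lemma pow_ideal_separated x : (forall N, x \in pid N) -> x = 0.
Proof.
move=> h; apply/eqP; have := h `|v x|.+1%N; rewrite unfold_in => /orP[//|]; lia.
Qed.

Lemma vector_limit n (u : nat -> 'rV[K]_n) :
  (forall m, u m.+1 - u m \is a mxOver (pid m)) ->
  exists l, forall m, u m - l \is a mxOver (pid m).
Proof.
move=> hu; have [l hl] : exists l : 'I_n -> K, forall i m, u m 0 i - l i \in pid m.
  apply: (@fin_all_exists _ (fun=> K) (fun i l => forall m, u m 0 i - l \in pid m)) => i;
    pose w m := u m 0 i.
  have hw m : w m.+1 - w m \in pid m by have /mxOverP/(_ 0 i) := hu m; rewrite !mxE.
  have tel m k : w (m + k)%N - w m \in pid m.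
    elim: k => [|k IH]; first by rewrite addn0 subrr rpred0.
    rewrite addnS -[w (m + k).+1](subrK (w (m + k)%N)) -addrA rpredD //.
    exact: pow_idealW (leq_addr k m) (hw _).
  have [|l hl] := @lval_complete _ _ v w.
    move=> N; exists `|N|%N => m k Nm Nk.
    have /pow_idealP[->|le] : w m - w k \in pid `|N|; [|by left|right; lia].
    have -> : w m - w k = (w m - w `|N|%N) - (w k - w `|N|%N) by ring.
    by rewrite rpredB // -(subnKC Nm, subnKC Nk) ?tel // -(subnKC Nk) tel.
  exists l => m; have [M hM] := hl m.
  have -> : w m - l = (w (m + M)%N - l) - (w (m + M)%N - w m) by ring.
  by rewrite rpredB ?tel //; apply/pow_idealP/hM; exact: leq_addl.
by exists (\row_i l i) => m; apply/mxOverP => i j; rewrite !mxE !ord1.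
Qed.

(** Integrality is asked of the values: the matrix is determined by the form only up to an
    alternating matrix, so it may fail to be integral. *)
Definition integral_system n r (Q : 'I_r -> 'M[K]_n) :=
  forall k x, x \is a mxOver O -> qf (Q k) x \in O.

Section Integral.
Variables (n r : nat) (Q : 'I_r -> 'M[K]_n).
Hypothesis hQ : integral_system Q.

Lemma mx_pow_idealZ N m l (A : 'M[K]_(m, l)) : A \is a mxOver (pid N) ->
  exists2 B, B \is a mxOver O & A = p ^+ N *: B.
Proof.
rewrite mx_pow_idealE => h; exists ((p ^+ N)^-1 *: A) => //.
by rewrite scalerA divff ?unifX_neq0 // scale1r.
Qed.

Lemma unif_in N : p ^+ N \in pid N.
Proof. by rewrite pow_idealE divff ?unifX_neq0 // rpred1. Qed.

Lemma pow_idealMl N x y : x \in pid N -> y \in O -> x * y \in pid N.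
Proof. by move=> hx hy; rewrite -[N]addn0; exact: pow_idealM hx hy. Qed.

Lemma bf_integral k x y : x \is a mxOver O -> y \is a mxOver O -> bf (Q k) x y \in O.
Proof.
move=> hx hy; have -> : bf (Q k) x y = qf (Q k) (x + y) - qf (Q k) x - qf (Q k) y.
  by rewrite qfD; ring.
by rewrite !rpredB ?hQ // rpredD.
Qed.

Lemma bf_pow_ideal k N x y : x \is a mxOver (pid N) -> y \is a mxOver O -> bf (Q k) x y \in pid N.
Proof.
move=> /mx_pow_idealZ[x' hx ->] hy; rewrite bfZl.
exact: pow_idealMl (unif_in N) (bf_integral _ hx hy).
Qed.

Lemma qf_pow_ideal k N x : x \is a mxOver (pid N) -> qf (Q k) x \in pid (N + N).
Proof.
move=> /mx_pow_idealZ[x' hx ->]; rewrite qfZ expr2.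
exact: pow_idealMl (pow_idealM (unif_in N) (unif_in N)) (hQ k hx).
Qed.

Lemma mxOverW N m l (A : 'M[K]_(m, l)) : A \is a mxOver (pid N) -> A \is a mxOver O.
Proof. by move=> /mxOverP h; apply/mxOverP => i j; exact: pow_ideal_vring (h i j). Qed.

Lemma qf_congr k N x y : x - y \is a mxOver (pid N) -> y \is a mxOver O ->
  qf (Q k) x - qf (Q k) y \in pid N.
Proof.
move=> hxy hy; rewrite -{1}[x](subrK y) qfD.
have -> : qf (Q k) (x - y) + qf (Q k) y + bf (Q k) (x - y) y - qf (Q k) y
  = qf (Q k) (x - y) + bf (Q k) (x - y) y by ring.
rewrite rpredD ?bf_pow_ideal //; exact: pow_idealW (leq_addr _ _) (qf_pow_ideal k hxy).
Qed.

(** Newton's iteration with the inverse Jacobian frozen at [x0]. If the values lie in [p ^ (m + 1)],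
    the linear terms cancel up to a further factor [p], since the iterates stay congruent to [x0],
    and the quadratic term lies in [p ^ (2 m + 2)]. *)
Lemma hensel (E : 'M[K]_(r, n)) x0 : E \is a mxOver O -> x0 \is a mxOver O ->
  (forall k, qf (Q k) x0 \in pid 1) ->
  (forall i k, bf (Q k) (row i E) x0 - (i == k)%:R \in pid 1) ->
  exists2 x, x - x0 \is a mxOver (pid 1) & forall k, qf (Q k) x = 0.
Proof.
move=> hE hx0 f0 hB; pose f x : 'rV_r := \row_k qf (Q k) x.
pose u m := iter m (fun x => x - f x *m E) x0.
have inv m : u m - x0 \is a mxOver (pid 1) /\ f (u m) \is a mxOver (pid m.+1).
  elim: m => [|m [IH1 IH2]].
    split; first by rewrite subrr; apply/mxOverP => i j; rewrite mxE rpred0.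
    by apply/mxOverP => i j; rewrite mxE.
  have hfE : f (u m) *m E \is a mxOver (pid m.+1).
    by rewrite -[m.+1]addn0; apply: mx_pow_idealM.
  have hum : u m \is a mxOver O.
    by rewrite -[u m](subrK x0) rpredD // (mxOverW IH1).
  split.
    rewrite /= -/(u m) addrAC rpredB //.
    by apply/mxOverP => i j; apply: (@pow_idealW _ _ v m.+1) => //; exact: (mxOverP hfE).
  apply/mxOverP => i k; rewrite mxE /= -/(u m) qfD -[- _]scaleN1r qfZ bfZr sqrrN expr1n mul1r.
  set y := f (u m) in IH2 hfE *.
  have -> : bf (Q k) (u m) (y *m E) = \sum_i y 0 i * bf (Q k) (row i E) (u m).
    rewrite bfC {1}[y *m E]mulmx_sum_row bf_suml.
    by apply: eq_bigr => j _; rewrite bfZl.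
  have qk : qf (Q k) (u m) = \sum_i y 0 i * (i == k)%:R.
    rewrite (bigD1 k) //= eqxx mulr1 big1 ?addr0 ?mxE // => j /negbTE ->; exact: mulr0.
  rewrite qk addrAC mulN1r -sumrB; apply: rpredD; last first.
    by apply: (@pow_idealW _ _ v (m.+1 + m.+1)); [lia|exact: qf_pow_ideal].
  apply: rpred_sum => j _; rewrite -mulrBr -[m.+2]addn1; apply: pow_idealM.
    exact: (mxOverP IH2).
  rewrite -opprB rpredN -[u m](subrK x0) bfDr -addrA rpredD //.
  rewrite bfC; apply: bf_pow_ideal IH1 _.
  by apply/mxOverP => i' j'; rewrite mxE (mxOverP hE).
have hum m : u m \is a mxOver O.
  by rewrite -[u m](subrK x0) rpredD // (mxOverW (inv m).1).
have [m|l hl] := vector_limit (u := u).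
  rewrite /= -/(u m) addrAC subrr add0r rpredN.
  apply/mxOverP => i j; apply: (@pow_idealW _ _ v m.+1) => //.
  by apply: (mxOverP (_ : _ \is a mxOver (pid m.+1))); rewrite -[m.+1]addn0;
    apply: mx_pow_idealM (inv m).2 hE.
have hl0 : l \is a mxOver O by rewrite -[l]opprK -[- l](addKr (u 0)) opprD opprK rpredD ?rpredN //
  (mxOverW (hl 0%N)).
exists l.
  have -> : l - x0 = (u 1%N - x0) - (u 1%N - l) by rewrite opprB [RHS]addrC subrKA.
  exact: mx_pow_idealB (inv 1%N).1 (hl 1%N).
move=> k; apply: pow_ideal_separated => N.
have -> : qf (Q k) l = f (u N) 0 k - (qf (Q k) (u N) - qf (Q k) l) by rewrite mxE; ring.
rewrite rpredB ?qf_congr //.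
by apply: (@pow_idealW _ _ v N.+1) => //; exact: (mxOverP (inv N).2).
Qed.

End Integral.
End Approximation.

(** * Compactness of the set of primitive vectors *)

Section Compactness.
Variables (K : fieldType) (q : nat) (v : local_field K q).
Local Notation O := (vring v).
Local Notation p := (unif v).
Local Notation pid := (pow_ideal v).

(** Otherwise the residue classes containing primitive vectors with arbitrarily small values form an
    infinite tree, finitely branching as the residue field is finite. A branch converges to a common
    zero congruent modulo [p] to a primitive vector, hence nonzero. *)
Lemma anisotropic_bound n r (Q : 'I_r -> 'M[K]_n) : integral_system v Q ->
  (forall x, (forall k, qf (Q k) x = 0) -> x = 0) ->
  exists N, forall x, x \is a mxOver O -> x \isn't a mxOver (pid 1) ->
    exists k, qf (Q k) x \notin pid N.
Proof.
move=> hQ aniso; apply: NNPP => no.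
have bad N : exists x, [/\ x \is a mxOver O, x \isn't a mxOver (pid 1)
    & forall k, qf (Q k) x \in pid N].
  apply: NNPP => nx; apply: no; exists N => x hx px.
  apply/existsP; rewrite -negb_forall; apply/negP => /forallP h.
  by apply: nx; exists x.
pose good m x := x \is a mxOver O /\ forall N, exists y,
  [/\ y \is a mxOver O, y \isn't a mxOver (pid 1), y - x \is a mxOver (pid m)
    & forall k, qf (Q k) y \in pid N].
have good0 : good 0%N 0.
  split=> [|N]; first by rewrite rpred0.
  by have [y [y1 y2 y3]] := bad N; exists y; split=> //; rewrite subr0.
have [F [red [lift [_ liftP redE _ _]]]] := residue_field v.
have goodS m x : exists x', good m x -> good m.+1 x' /\ x' - x \is a mxOver (pid m).
  case: (classic (good m x)) => [[xO gx]|]; last by exists 0.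
  pose w (d : {ffun 'I_n -> F}) := p ^+ m *: \row_j lift (d j).
  have wm d : w d \is a mxOver (pid m).
    apply/mxOverP => i j; rewrite !mxE; apply: pow_idealMl (unif_in _ _) _.
    by have [] := liftP (d j).
  have [[d gd]|nd] := classic (exists d, good m.+1 (x + w d)).
    by exists (x + w d) => _; split; rewrite // addrAC subrr add0r.
  have : forall d, exists N, forall y, y \is a mxOver O -> y \isn't a mxOver (pid 1) ->
      y - (x + w d) \is a mxOver (pid m.+1) -> ~ forall k, qf (Q k) y \in pid N.
    move=> d; apply: NNPP => nN; apply: nd; exists d; split.
      by rewrite rpredD // (mxOverW (wm d)).
    move=> N; apply: NNPP => ny; apply: nN; exists N => y y1 y2 y3 y4.
    by apply: ny; exists y.
  move=> /(@fin_all_exists _ (fun=> nat))[N hN].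
  (* If each class [x + w d] failed at some precision [N d], a vector taken at the maximal precision
     would contradict the failure of the class given by its own digits. *)
  have [y [y1 y2 y3 y4]] := gx (\max_d N d).
  have [z zO yx] := mx_pow_idealZ y3.
  pose d : {ffun 'I_n -> F} := [ffun j => red (z 0 j)].
  case: (hN d y y1 y2) => [|k]; last exact: pow_idealW (leq_bigmax d) (y4 k).
  rewrite opprD addrA yx /w -scalerBr; apply/mxOverP => i j; rewrite !mxE -[m.+1]addn1.
  apply: pow_idealM (unif_in _ _) _; rewrite ffunE ord1.
  have zj : z 0 j \in O by exact: (mxOverP zO).
  have [lO lE] := liftP (red (z 0 j)).
  by rewrite -redE // lE.
pose f m x := proj1_sig (constructive_indefinite_description _ (goodS m x)).
have fP m x : good m x -> good m.+1 (f m x) /\ f m x - x \is a mxOver (pid m).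
  exact: (proj2_sig (constructive_indefinite_description _ (goodS m x))).
pose u := fix u m := if m is k.+1 then f k (u k) else 0.
have gu m : good m (u m) by elim: m => [|m /fP[]].
have [m|l hl] := vector_limit (u := u) (v := v); first by have [] := fP m _ (gu m).
have lO : l \is a mxOver O.
  have -> : l = u 0%N - (u 0%N - l) by rewrite opprB addrC subrK.
  by rewrite rpredB ?(mxOverW (hl 0%N)) // rpred0.
have [y [y1 y2 y3 y4]] := (gu 1%N).2 0%N.
have l0 : l = 0.
  apply: aniso => k; apply: (@pow_ideal_separated _ _ v) => N.
  have [z [z1 z2 z3 z4]] := (gu N).2 N.
  have -> : qf (Q k) l = qf (Q k) z - (qf (Q k) z - qf (Q k) l) by ring.
  rewrite rpredB // qf_congr //.
  by rewrite -[z](subrK (u N)) -addrA rpredD.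
move/negP: y2; apply; have := hl 1%N; rewrite l0 subr0 => h.
by rewrite -[y](subrK (u 1%N)) rpredD.
Qed.

End Compactness.

(** * Minimal systems *)

Lemma sum_quotient (V : nmodType) m n (F : nat -> V) : (0 < n)%N ->
  \sum_(y < m * n) F (y %/ n)%N = (\sum_(j < m) F j) *+ n.
Proof.
move=> n0; rewrite -(big_mkord predT (fun y => F (y %/ n)%N)) -(big_mkord predT F) /=.
elim: m => [|m IH]; first by rewrite mul0n !big_geq // mul0rn.
rewrite big_nat_recr //= mulrnDl -IH mulSn addnC.
rewrite (big_cat_nat (n := (m * n)%N)) ?leq_addr //=; congr (_ + _).
rewrite big_nat (eq_bigr (fun=> F m)) -?big_nat; last first.
  move=> y /andP[h1 h2]; congr F; apply/eqP; rewrite eqn_leq -ltnS ltn_divLR // mulSn addnC h2.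
  by rewrite leq_divRL.
by rewrite sumr_const_nat addKn.
Qed.

Section Transform.
Variable (K : fieldType).

Definition qmap n r (Q : 'I_r -> 'M[K]_n) x : 'rV_r := \row_k qf (Q k) x.

Definition transform n r n1 r1 (Q : 'I_r -> 'M[K]_n) (T : 'M[K]_(n1, n)) (U : 'M[K]_(r, r1)) k :=
  T *m comb Q (col k U)^T *m T^T.

Lemma qmap_transform n r n1 r1 (Q : 'I_r -> 'M[K]_n) (T : 'M_(n1, n)) (U : 'M_(r, r1)) x :
  qmap (transform Q T U) x = qmap Q (x *m T) *m U.
Proof.
apply/rowP => k; rewrite [RHS]mxE mxE.
have -> : qf (transform Q T U k) x = qf (comb Q (col k U)^T) (x *m T).
  by rewrite /qf /transform trmx_mul !mulmxA.
by rewrite qf_comb; apply: eq_bigr => i _; rewrite !mxE mulrC.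
Qed.

Lemma qmapZ n r (Q : 'I_r -> 'M[K]_n) a x : qmap Q (a *: x) = a ^+ 2 *: qmap Q x.
Proof. by apply/rowP => k; rewrite !mxE qfZ. Qed.

Lemma qmap_eq0 n r (Q : 'I_r -> 'M[K]_n) x : qmap Q x = 0 <-> forall k, qf (Q k) x = 0.
Proof.
by split=> [/rowP h k|h]; [have := h k|apply/rowP => k]; rewrite !mxE.
Qed.

End Transform.

(** * A lower bound for the weight *)

Section PairBound.
Variables (K : fieldType) (q : nat) (v : local_field K q).
Local Notation O := (vring v).
Local Notation pid := (pow_ideal v).

Lemma lval_prod (I : finType) (F : I -> K) : (forall i, F i != 0) ->
  v (\prod_i F i) = \sum_i v (F i).
Proof.
move=> h; have : \prod_i F i != 0 /\ v (\prod_i F i) = \sum_i v (F i); last by case.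
apply: (big_rec2 (fun a b => a != 0 /\ v a = b)) => [|i b a _ [a0 <-]];
  first by rewrite oner_eq0 (valuation1 (@lvalM _ _ v)).
by rewrite mulf_neq0 // lvalM.
Qed.

Lemma smith_val n (T G H : 'M[K]_n) d : T \in unitmx -> unimodular v G -> unimodular v H ->
  G *m T *m H = diag_mx d -> (forall i, d 0 i != 0) /\ v (\det T) = \sum_i v (d 0 i).
Proof.
move=> Tu uG uH E; have e := congr1 determinant E.
have dE : \det G * \det T * \det H = \prod_i d 0 i by move: e; rewrite !det_mulmx det_diag.
have nz (m : nat) (A : 'M[K]_m) : A \in unitmx -> \det A != 0 by rewrite unitmxE unitfE.
have G0 := nz _ _ (unimodular_unit uG); have H0 := nz _ _ (unimodular_unit uH); have T0 := nz _ _ Tu.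
have d0 i : d 0 i != 0.
  have : \prod_i d 0 i != 0 by rewrite -dE !mulf_neq0.
  by apply: contraNneq => di; rewrite (bigD1 i) //= di mul0r.
split=> //; rewrite -lval_prod // -dE !lvalM ?mulf_neq0 //.
by rewrite (unimodular_val uG) (unimodular_val uH) add0r addr0.
Qed.

Lemma primitive_multiple n (x : 'rV[K]_n) : x != 0 -> exists2 c, c != 0 &
  c *: x \is a mxOver O /\ c *: x \isn't a mxOver (pid 1).
Proof.
move=> x0; have [i0 xi0] : exists i, x 0 i != 0.
  apply/existsP; rewrite -negb_forall; apply: contra x0 => /forallP h.
  by apply/eqP/rowP => i; rewrite mxE; apply/eqP; exact: h.
pose P i := x 0 i != 0; pose val i := v (x 0 i).
case: (Order.TotalTheory.arg_minP val (xi0 : P i0)) => i xi imin.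
exists (x 0 i)^-1; rewrite ?invr_neq0 //; split.
  apply/mxOverP => k j; rewrite !mxE !ord1 mulrC.
  have [->|xj] := eqVneq (x 0 j) 0; first by rewrite mul0r rpred0.
  rewrite unfold_in lvalM ?invr_neq0 // (valuationV (@lvalM _ _ v)) //.
  by apply/orP; right; rewrite subr_ge0; exact: imin.
by apply/negP => /mxOverP/(_ 0 i); rewrite mxE mulVf //; apply/negP; exact: one_notin_max.
Qed.

Definition integral_pair n r (Q : 'I_r -> 'M[K]_n) (T : 'M[K]_n) (U : 'M[K]_r) :=
  forall x, x \is a mxOver O -> qmap Q (x *m T) *m U \is a mxOver O.

(** Smith reduction makes [T] and [U] diagonal, with entries [d] and [u]. The bound is the sum of
    [n r] instances of [key], indexed by [y]: the coordinate [y / r] against the form in position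
    [y / n] from the end. Each coordinate occurs [r] times and each form [n] times, which is the
    origin of the weights. *)
Lemma pair_bound n r (Q : 'I_r -> 'M[K]_n) : (0 < n)%N -> (0 < r)%N ->
  integral_system v Q -> (forall x, (forall k, qf (Q k) x = 0) -> x = 0) ->
  (forall n1 r1 (Q1 : 'I_r1 -> 'M[K]_n1), (r1 < r)%N -> (n1 <= n)%N -> (n * r1 < r * n1)%N ->
     exists2 x, x != 0 & forall k, qf (Q1 k) x = 0) ->
  exists B : int, forall T U, T \in unitmx -> U \in unitmx -> integral_pair Q T U ->
    B <= (2 * r)%:Z * v (\det T) + n%:Z * v (\det U).
Proof.
move=> n0 r0 hQ aniso IH.
have [N hN] := anisotropic_bound hQ aniso.
exists (- (n * r * N)%:Z) => T U Tu Uu hTU.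
have [G [H [d [uG uH E dd]]]] := smith v Tu.
have [G' [H' [u [uG' uH' E' ud]]]] := smith v Uu.
have [d0 vT] := smith_val Tu uG uH E; have [u0 vU] := smith_val Uu uG' uH' E'.
pose f x := qmap Q (x *m invmx H) *m invmx G'.
have TE : G *m T = diag_mx d *m invmx H.
  by rewrite -E mulmxK // (unimodular_unit uH).
have UE : U *m H' = invmx G' *m diag_mx u.
  by rewrite -E' -mulmxA mulKmx // (unimodular_unit uG').
have fint z : z \is a mxOver O -> f (z *m diag_mx d) *m diag_mx u \is a mxOver O.
  move=> hz; rewrite /f -[z *m _ *m _]mulmxA -TE mulmxA -mulmxA -UE mulmxA.
  by rewrite mxOverM ?uH'.1 // hTU // mxOverM ?uG.1.
(* Otherwise the forms of index at most [j] vanish modulo [p ^ N] on the first [i.+1] coordinates,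
   where the remaining forms have a common zero by induction. *)
have key (i : 'I_n) (j : 'I_r) : (n * (r - j.+1) < r * i.+1)%N -> - v (u 0 j) - 2 * v (d 0 i) < N%:Z.
  move=> lt; rewrite ltNge; apply/negP => le.
  pose P : 'M[K]_(i.+1, n) := pid_mx i.+1.
  pose S : 'M[K]_(r, r - j.+1) := \matrix_(l, k) (val l == j.+1 + k)%:R.
  have [|x1 x10 x1z] := IH _ _ (transform Q (P *m invmx H) (invmx G' *m S)) _ (ltn_ord i) lt.
    by rewrite ltn_subrL.
  have x0 : x1 *m P != 0.
    apply: contra x10 => /eqP e; rewrite -[x1]mulmx1 -pid_mx_1.
    by rewrite -(pid_mx_id _ i.+1 i.+1 (ltn_ord i)) mulmxA e mul0mx.
  have [c c0 [xO xp]] := primitive_multiple x0.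
  set x := c *: _ in xO xp.
  have fz (l : 'I_r) : (j < l)%N -> f x 0 l = 0.
    move=> jl; have kl : (l - j.+1 < r - j.+1)%N by rewrite ltn_sub2r // (leq_ltn_trans jl).
    have /qmap_eq0 := x1z; rewrite qmap_transform !mulmxA => /rowP/(_ (Ordinal kl)).
    have SE l' : S l' (Ordinal kl) = (l' == l)%:R by rewrite mxE -val_eqE [val l in RHS](esym
      (subnKC jl)).
    rewrite [LHS]mxE (bigD1 l) //= SE eqxx mulr1 big1 => [|l' ll]; last by rewrite SE (negbTE ll) mulr0.
    rewrite addr0 [RHS]mxE => e.
    rewrite /f /x -scalemxAl qmapZ -scalemxAl mxE; move: e; rewrite /= => ->.
    by rewrite mulr0.
  have fs (l : 'I_r) : (l <= j)%N -> f x 0 l \in pid N.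
    (* [z] is the solution of [z *m diag_mx d = d 0 i *: x]. It is integral because [x] is supported
       on the coordinates up to [i], whose [d 0 s] divide [d 0 i]. *)
    move=> lj; pose z : 'rV_n := \row_s (x 0 s * (d 0 i / d 0 s)).
    have zO : z \is a mxOver O.
      apply/mxOverP => i1 s; rewrite mxE; have [si|si] := leqP s i.
        by rewrite rpredM ?dd // (mxOverP xO).
      have -> : x 0 s = 0; last by rewrite mul0r rpred0.
      rewrite /x mxE [X in _ * X](_ : _ = 0) ?mulr0 //.
      rewrite mxE big1 // => k _; rewrite mxE ltn_eqF ?mulr0 //.
      exact: leq_trans (ltn_ord k) si.
    have zd : z *m diag_mx d = d 0 i *: x.
      apply/rowP => s; rewrite mul_mx_diag !mxE; field; exact: d0.
    have := fint z zO; rewrite zd /f -scalemxAl qmapZ -scalemxAl -/(f x).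
    move=> /mxOverP/(_ 0 l); rewrite -scalemxAl mul_mx_diag mxE mxE.
    have := ud l j lj; rewrite ![_ \in _]unfold_in.
    case: eqVneq => [e|_]; first by move/eqP: e; rewrite mulf_eq0 invr_eq0 !(negbTE (u0 _)).
    rewrite lvalM ?invr_neq0 // (valuationV (@lvalM _ _ v)) // => h1.
    case: (eqVneq (f x 0 l) 0) => //= fl0.
    have A0 : d 0 i ^+ 2 * f x 0 l * u 0 l != 0 by rewrite !mulf_neq0 ?expf_neq0.
    rewrite mulrA (negbTE A0) /=.
    rewrite lvalM ?mulf_neq0 ?expf_neq0 // lvalM ?expf_neq0 // (valuationX (@lvalM _ _ v)) //.
    rewrite mulr2n; move: h1 le => /=.
    move: (v (u 0 j)) (v (u 0 l)) (v (d 0 i)) (v (f x 0 l)) => a b e g; clear; lia.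
  have fN : f x \is a mxOver (pid N).
    apply/mxOverP => i1 l; rewrite !ord1; have [jl|] := ltnP j l; last exact: fs.
    by rewrite fz // rpred0.
  have [||k] := hN (x *m invmx H).
  - by rewrite mxOverM // (unimodularV uH).1.
  - apply: contra xp => h; rewrite -[x](mulmxKV (unimodular_unit uH)).
    exact: (mx_pow_idealM (N := 1) (M := 0) h uH.1).
  move/negP; apply.
  have -> : qf (Q k) (x *m invmx H) = (f x *m G') 0 k.
    by rewrite /f mulmxKV ?(unimodular_unit uG') // mxE.
  by have /mxOverP := mx_pow_idealM fN uG'.1; rewrite addn0.
have dn (y : nat) : (y < n * r)%N -> (y %/ r < n)%N by rewrite ltn_divLR.
have dr (y : nat) : (y < n * r)%N -> (y %/ n < r)%N by rewrite ltn_divLR // mulnC.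
pose av i := oapp (fun k : 'I_n => v (d 0 k)) 0 (insub i).
pose bv i := oapp (fun k : 'I_r => v (u 0 (rev_ord k))) 0 (insub i).
have avE a (an : (a < n)%N) : av a = v (d 0 (Ordinal an)) by rewrite /av insubT.
have bvE b (br : (b < r)%N) : bv b = v (u 0 (rev_ord (Ordinal br))) by rewrite /bv insubT.
have sa : \sum_(i < n) av i = v (\det T).
  by rewrite vT; apply: eq_bigr => i _; rewrite /av valK.
have sb : \sum_(i < r) bv i = v (\det U).
  by rewrite vU [RHS](reindex_inj rev_ord_inj); apply: eq_bigr => i _; rewrite /bv valK.
have le : \sum_(y < n * r) (- bv (y %/ n)%N - 2 * av (y %/ r)%N) <= \sum_(y < n * r) N%:Z.
  apply: ler_sum => y _; rewrite (avE _ (dn y (ltn_ord y))) (bvE _ (dr y (ltn_ord y))).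
  apply: ltW; apply: key; rewrite /=.
  have -> : (r - (r - (y %/ n).+1).+1 = y %/ n)%N.
    by have := dr y (ltn_ord y); move: (y %/ n)%N => a; lia.
  by rewrite mulnC [(r * _)%N]mulnC (leq_ltn_trans (leq_divM _ _)) // ltn_ceil.
move: le; rewrite sumr_const card_ord big_split /= !sumrN -mulr_sumr.
rewrite (sum_quotient _ av r0) [in \sum_(_ < n * r) _]mulnC (sum_quotient _ bv n0) sa sb.
move: (v _) (v _) => a b; clear.
rewrite -(mulr_natr b n) -(mulr_natr a r) -(mulr_natr N%:Z) !natz !PoszM; lra.
Qed.

End PairBound.

Lemma int_minimum (X : Type) (P : X -> Prop) (f : X -> int) B :
  (exists x, P x) -> (forall x, P x -> B <= f x) ->
  exists2 x, P x & forall y, P y -> f x <= f y.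
Proof.
move=> [x Px] hB; have [m le] : exists m : nat, f x <= B + m%:Z.
  by exists `|f x - B|%N; have := hB x Px; lia.
elim: m x Px le => [|m IH] x Px le.
  by exists x => // y Py; apply: le_trans le _; rewrite addr0 hB.
case: (classic (exists2 y, P y & f y < f x)) => [[y Py yx]|no].
  by apply: (IH y Py); lia.
by exists x => // y Py; rewrite leNgt; apply/negP => yx; apply: no; exists y.
Qed.

(** The triangular matrix of the same quadratic form. Its entries are values of the form and of its
    polar form at unit vectors, so it is integral when the form is, also in residue characteristic
    2, and can be reduced entrywise. *)
Definition triangular (R : pzSemiRingType) n (A : 'M[R]_n) : 'M[R]_n :=
  \matrix_(i, j) if (i < j)%N then A i j + A j i else if i == j then A i j else 0.

Lemma qf_sum (K : fieldType) n (A : 'M[K]_n) x : qf A x = \sum_i \sum_j A i j * x 0 i * x 0 j.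
Proof.
rewrite /qf mxE exchange_big /=; apply: eq_bigr => j _.
by rewrite !mxE mulr_suml; apply: eq_bigr => i _; rewrite [x 0 i * _]mulrC.
Qed.

Lemma qf_triangular (K : fieldType) n (A : 'M[K]_n) x : qf (triangular A) x = qf A x.
Proof.
pose L : 'M[K]_n := \matrix_(i, j) if (j < i)%N then A i j else 0.
have -> : triangular A = A + (L^T - L).
  apply/matrixP => i j; rewrite !mxE; have [lt|lt|e] := ltngtP i j.
  - by rewrite subr0.
  - by rewrite -val_eqE /= gtn_eqF // sub0r subrr.
  - by rewrite -val_eqE /= e eqxx subr0 addr0.
rewrite /qf mulmxDr mulmxDl mxE [X in _ + X](_ : _ = 0) ?addr0 //.
rewrite mulmxBr mulmxBl mxE -[X in X + _]/((x *m L^T *m x^T) 0 0).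
have -> : x *m L^T *m x^T = (x *m L *m x^T)^T by rewrite !trmx_mul trmxK mulmxA.
by rewrite !mxE subrr.
Qed.

(** * Reduction to the residue field *)

Section Reduction.
Variables (K : fieldType) (q : nat) (v : local_field K q).
Local Notation O := (vring v).
Local Notation p := (unif v).
Local Notation pid := (pow_ideal v).

Lemma integral_scaling n r (Q : 'I_r -> 'M[K]_n) :
  exists2 c, c != 0 & integral_system v (fun k => c *: Q k).
Proof.
pose N := (\sum_k \sum_i \sum_j `|v (Q k i j)|)%N.
exists (p ^+ N); rewrite ?unifX_neq0 // => k x hx.
have hA : p ^+ N *: Q k \is a mxOver O.
  apply/mxOverP => i j; rewrite mxE; have [->|A0] := eqVneq (Q k i j) 0.
    by rewrite mulr0 rpred0.
  rewrite unfold_in lvalM ?unifX_neq0 // (valuationX (@lvalM _ _ v)) ?unif0 // lval_unif.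
  have : (`|v (Q k i j)| <= N)%N.
    by rewrite /N (bigD1 k) //= (bigD1 i) //= (bigD1 j) //= -!addnA leq_addr.
  by move=> le; apply/orP; right; rewrite natz; move: le; clearbody N; move: (v _) => a; lia.
by apply: (mxOverP (_ : _ \is a mxOver O)); rewrite !mxOverM //; apply/mxOverP => i j;
  rewrite mxE (mxOverP hx).
Qed.

Variables (F : finFieldType) (red : K -> F) (lift : F -> K).
Hypothesis liftP : forall a, lift a \in O /\ red (lift a) = a.
Hypothesis redE : forall x y, x \in O -> y \in O -> (red x == red y) = (x - y \in pid 1).
Hypothesis redD : forall x y, x \in O -> y \in O -> red (x + y) = red x + red y.
Hypothesis red1 : red 1 = 1.
Hypothesis redM : forall x y, x \in O -> y \in O -> red (x * y) = red x * red y.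

Lemma red0 : red 0 = 0.
Proof. by apply: (addrI (red 0)); rewrite -redD ?rpred0 // !addr0. Qed.

Lemma redN x : x \in O -> red (- x) = - red x.
Proof. by move=> xO; apply: (addrI (red x)); rewrite -redD ?rpredN // !subrr red0. Qed.

Lemma red_eq0 x : x \in O -> (red x == 0) = (x \in pid 1).
Proof. by move=> xO; rewrite -red0 redE ?rpred0 // subr0. Qed.

Lemma red_sum (I : finType) (f : I -> K) : (forall i, f i \in O) ->
  red (\sum_i f i) = \sum_i red (f i).
Proof.
move=> h; have [] : \sum_i f i \in O /\ red (\sum_i f i) = \sum_i red (f i); last by [].
apply: (big_rec2 (fun a b => a \in O /\ red a = b)); first by rewrite rpred0 red0.
by move=> i b a _ [aO <-]; rewrite rpredD // redD.
Qed.

Lemma red_prod (I : finType) (f : I -> K) : (forall i, f i \in O) ->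
  red (\prod_i f i) = \prod_i red (f i).
Proof.
move=> h; have [] : \prod_i f i \in O /\ red (\prod_i f i) = \prod_i red (f i); last by [].
apply: (big_rec2 (fun a b => a \in O /\ red a = b)); first by rewrite rpred1 red1.
by move=> i b a _ [aO <-]; rewrite rpredM // redM.
Qed.

Local Notation redm := (map_mx red).

Lemma red_mulmx m n l (A : 'M[K]_(m, n)) (B : 'M_(n, l)) :
  A \is a mxOver O -> B \is a mxOver O -> redm (A *m B) = redm A *m redm B.
Proof.
move=> /mxOverP hA /mxOverP hB; apply/matrixP => i j; rewrite !mxE red_sum => [|k].
  by apply: eq_bigr => k _; rewrite redM // !mxE.
by rewrite rpredM.
Qed.

Lemma red_det n (A : 'M[K]_n) : A \is a mxOver O -> red (\det A) = \det (redm A).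
Proof.
move=> /mxOverP hA; rewrite red_sum => [|s]; last by rewrite rpredMsign rpred_prod.
apply: eq_bigr => s _; have pO : \prod_i A i (s i) \in O by rewrite rpred_prod.
have -> : \prod_i redm A i (s i) = red (\prod_i A i (s i)).
  by rewrite red_prod //; apply: eq_bigr => i _; rewrite mxE.
by case: odd_perm; rewrite ?expr1 ?expr0 ?mul1r // !mulN1r redN.
Qed.

Lemma red_qf n (A : 'M[K]_n) x : A \is a mxOver O -> x \is a mxOver O ->
  red (qf A x) = qf (redm A) (redm x).
Proof.
move=> hA hx; have hxT : x^T \is a mxOver O by apply/mxOverP => i j; rewrite mxE (mxOverP hx).
have -> : red (qf A x) = redm (x *m A *m x^T) 0 0 by rewrite mxE.
have xT : redm x^T = (redm x)^T by apply/matrixP => i j; rewrite !mxE.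
by rewrite !red_mulmx ?mxOverM // xT.
Qed.

Lemma lift_mx m n (A : 'M[F]_(m, n)) : exists2 B, B \is a mxOver O & redm B = A.
Proof.
exists (map_mx lift A); first by apply/mxOverP => i j; rewrite mxE; have [] := liftP (A i j).
by apply/matrixP => i j; rewrite !mxE; have [] := liftP (A i j).
Qed.

Lemma lift_unimodular n (A : 'M[F]_n) : A \in unitmx -> exists2 B, unimodular v B & redm B = A.
Proof.
move=> Au; have [B hB BA] := lift_mx A; exists B => //; split=> //.
by rewrite -red_eq0 ?det_vring // red_det // BA -unitfE -unitmxE.
Qed.

Definition reduced_system n r (Q : 'I_r -> 'M[K]_n) k := redm (triangular (Q k)).

Lemma triangular_integral n r (Q : 'I_r -> 'M[K]_n) k : integral_system v Q ->
  triangular (Q k) \is a mxOver O.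
Proof.
move=> hQ; pose e (i : 'I_n) : 'rV[K]_n := delta_mx 0 i.
have eO i : e i \is a mxOver O.
  by apply/mxOverP => a b; rewrite mxE; case: andP; rewrite ?rpred1 ?rpred0.
have eE i (B : 'M[K]_n) j : (e i *m B *m (e j)^T) 0 0 = B i j.
  by rewrite -rowE trmx_delta -colE !mxE.
apply/mxOverP => i j; rewrite mxE; case: ifP => _.
  have -> : Q k i j + Q k j i = bf (Q k) (e i) (e j) by rewrite bfE !eE.
  exact: bf_integral.
case: eqP => [->|_]; last by rewrite rpred0.
by have := hQ k _ (eO j); rewrite /qf eE.
Qed.

Lemma qf_reduced n r (Q : 'I_r -> 'M[K]_n) k x : integral_system v Q -> x \is a mxOver O ->
  qf (reduced_system Q k) (redm x) = red (qf (Q k) x).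
Proof. by move=> hQ hx; rewrite -red_qf ?triangular_integral // qf_triangular. Qed.

Lemma map_mxD_red m n (A B : 'M[K]_(m, n)) : A \is a mxOver O -> B \is a mxOver O ->
  redm (A + B) = redm A + redm B.
Proof. by move=> /mxOverP hA /mxOverP hB; apply/matrixP => i j; rewrite !mxE redD. Qed.

Lemma bf_qf (L : fieldType) n (A : 'M[L]_n) x y : bf A x y = qf A (x + y) - qf A x - qf A y.
Proof. by rewrite qfD; ring. Qed.

Lemma bf_reduced n r (Q : 'I_r -> 'M[K]_n) k x y : integral_system v Q ->
  x \is a mxOver O -> y \is a mxOver O ->
  bf (reduced_system Q k) (redm x) (redm y) = red (bf (Q k) x y).
Proof.
move=> hQ hx hy; rewrite !bf_qf -map_mxD_red // !qf_reduced ?rpredD //.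
by rewrite !redD ?redN ?rpredB ?rpredN ?hQ // rpredD.
Qed.

(** Nonsingularity says that the Jacobian at [x] has independent rows; a lift of a right inverse
    provides the matrix [E] of [hensel]. As [0 < r], a nonsingular zero is nonzero, and so is its
    lift. *)
Lemma nonsingular_lift n r (Q : 'I_r -> 'M[K]_n) x : (0 < r)%N -> integral_system v Q ->
  (forall k, qf (reduced_system Q k) x = 0) ->
  (forall c, c != 0 -> x *m pol (comb (reduced_system Q) c) != 0) ->
  exists2 y, y != 0 & forall k, qf (Q k) y = 0.
Proof.
move=> r0 hQ xz xns; have [x0 x0O x0E] := lift_mx x.
pose J := \matrix_k (x *m pol (reduced_system Q k)).
have cJ c : c *m J = x *m pol (comb (reduced_system Q) c).
  rewrite pol_comb mulmx_sumr mulmx_sum_row; apply: eq_bigr => k _.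
  by rewrite rowK -scalemxAr.
have /row_freeP[E JE] : row_free J.
  rewrite -kermx_eq0; apply/rowV0P => c /sub_kermxP; rewrite cJ => h.
  by apply/eqP; apply: contraTT (eqxx (0 : 'rV[F]_n)) => /xns; rewrite h eqxx.
have [E0 E0O E0E] := lift_mx E^T.
have [||y yx yz] := hensel hQ E0O x0O.
- by move=> k; rewrite -red_eq0 ?hQ // -qf_reduced // x0E xz.
- move=> i k; have rO : row i E0 \is a mxOver O by apply/mxOverP => a b; rewrite mxE (mxOverP E0O).
  have dO : (i == k)%:R \in O by rewrite rpred_nat.
  rewrite -redE ?bf_integral // -bf_reduced //.
  have -> : redm (row i E0) = row i E^T by rewrite map_row E0E.
  have -> : red (i == k)%:R = (J *m E) k i.
    by rewrite JE mxE eq_sym; case: eqP => _; rewrite ?red1 ?red0.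
  apply/eqP; rewrite x0E bfC /bf mxE [RHS]mxE; apply: eq_bigr => l _; congr (_ * _).
    by rewrite [RHS]mxE.
  by rewrite !mxE.
exists y => //; apply/eqP => y0; move: yx; rewrite y0 sub0r rpredN => x01.
have c0 : (delta_mx 0 (Ordinal r0) : 'rV[F]_r) != 0.
  by apply/eqP => /rowP/(_ (Ordinal r0)); rewrite !mxE !eqxx; apply/eqP/oner_neq0.
have := xns _ c0; suff -> : x = 0 by rewrite mul0mx eqxx.
apply/rowP => i; rewrite -x0E !mxE; apply/eqP; rewrite red_eq0 ?(mxOverP x0O) //.
exact: (mxOverP x01).
Qed.

End Reduction.

Section MinimalPair.
Variables (K : fieldType) (q : nat) (v : local_field K q).
Local Notation O := (vring v).
Local Notation p := (unif v).
Local Notation pid := (pow_ideal v).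
Variables (F : finFieldType) (red : K -> F) (lift : F -> K).
Hypothesis liftP : forall a, lift a \in O /\ red (lift a) = a.
Hypothesis redE : forall x y, x \in O -> y \in O -> (red x == red y) = (x - y \in pid 1).
Hypothesis redD : forall x y, x \in O -> y \in O -> red (x + y) = red x + red y.
Hypothesis red1 : red 1 = 1.
Hypothesis redM : forall x y, x \in O -> y \in O -> red (x * y) = red x * red y.
Local Notation redm := (map_mx red).

Definition lattice_weight n r (T : 'M[K]_n) (U : 'M[K]_r) : int :=
  (2 * r)%:Z * v (\det T) + n%:Z * v (\det U).

Definition step_row n w (a : K) : 'rV[K]_n := \row_i (if (i < w)%N then 1 else a).

Lemma det_step n w a : (w <= n)%N -> \det (diag_mx (@step_row n w a)) = a ^+ (n - w).
Proof.
move=> wn; rewrite det_diag (eq_bigr (fun i : 'I_n => if (i < w)%N then 1 else a)) => [|i _];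
  last by rewrite mxE.
rewrite -(big_mkord predT (fun i => if (i < w)%N then 1 else a)) (big_cat_nat (n := w)) //=.
rewrite big_nat big1 => [|i /andP[_ ->] //]; rewrite mul1r big_nat.
rewrite (eq_bigr (fun=> a)) => [|i /andP[h _]]; last by rewrite ltnNge h.
by rewrite -big_nat prodr_const_nat.
Qed.

Lemma row_ebase_sub m n (C : 'M[F]_(m, n)) (i : 'I_n) : (i < \rank C)%N -> (row i (row_ebase C) <=
  C)%MS.
Proof.
move=> lt; have e : row i (row_ebase C) = row (Ordinal lt) (row_base C).
  apply/rowP => j; rewrite !mxE (bigD1 i) //= big1 => [|k ki]; rewrite mxE /=.
    by rewrite eqxx lt mul1r addr0.
  by rewrite eq_sym -val_eqE in ki; rewrite (negbTE ki) mul0r.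
by rewrite e (submx_trans (row_sub _ _)) // eq_row_base.
Qed.

(* If the forms of [C] vanish on [W] modulo [p], multiplying the coordinates outside [W] by [p]
   allows dividing the forms of [C] by [p]; this changes the weight by
   [2 r (n - \rank W) - n \rank C], which minimality forces to be nonnegative. *)
Lemma minimal_semistable n r (Q : 'I_r -> 'M[K]_n) T U : T \in unitmx -> U \in unitmx ->
  integral_pair v Q T U ->
  (forall T' U', T' \in unitmx -> U' \in unitmx -> integral_pair v Q T' U' ->
     lattice_weight T U <= lattice_weight T' U') ->
  semistable (reduced_system red (transform Q T U)).
Proof.
move=> Tu Uu hTU hmin C W h.
pose R := transform Q T U; have hR : integral_system v R.
  move=> k x hx; have := hTU x hx; rewrite -qmap_transform => /mxOverP/(_ 0 k).
  by rewrite mxE.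
have [B uB BE] := lift_unimodular liftP redE redD red1 redM (row_ebase_unit W).
have [D uD DE] := lift_unimodular liftP redE redD red1 redM (row_ebase_unit C).
set w := \rank W; set s := \rank C.
have p0 := unif0 v; have pV0 : p^-1 != 0 by rewrite invr_neq0.
pose T' := diag_mx (step_row n w p) *m B *m T.
pose sU : 'rV[K]_r := \row_i (if (i < s)%N then p^-1 else 1).
pose U' := U *m D^T *m diag_mx sU.
have dU : \det (diag_mx sU) = p^-1 ^+ s.
  have -> : diag_mx sU = p^-1 *: diag_mx (step_row r s p).
    apply/matrixP => i j; rewrite !mxE; case: ifP => _; case: (i == j);
    by rewrite ?mulr1n ?mulr0n ?mulr0 ?mulr1 ?mulVf.
  have e : p^-1 ^+ r = p^-1 ^+ s * p^-1 ^+ (r - s) by rewrite -exprD subnKC // rank_leq_row.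
  rewrite detZ det_step ?rank_leq_row // e -mulrA.
  by rewrite -exprMn mulVf // expr1n mulr1.
have Bu := unimodular_unit uB; have Du := unimodular_unit uD.
have T'u : T' \in unitmx.
  by rewrite !unitmx_mul Bu Tu unitmxE det_step ?rank_leq_row // unitfE expf_neq0.
have U'u : U' \in unitmx.
  by rewrite !unitmx_mul unitmx_tr Du Uu unitmxE dU unitfE expf_neq0.
have hp : p \in pid 1 by have := unif_in v 1; rewrite expr1.
have int' : integral_pair v Q T' U'.
  move=> x hx; pose y := x *m diag_mx (step_row n w p) *m B.
  have xsO : x *m diag_mx (step_row n w p) \is a mxOver O.
    apply/mxOverP => i j; rewrite mul_mx_diag !mxE rpredM ?(mxOverP hx) //.
    by case: ifP => _; [exact: rpred1|exact: pow_ideal_vring hp].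
  have yO : y \is a mxOver O by rewrite mxOverM ?uB.1.
  have -> : qmap Q (x *m T') *m U' = qmap R y *m D^T *m diag_mx sU.
    by rewrite qmap_transform /T' /U' /y !mulmxA.
  have RyO : qmap R y \is a mxOver O.
    by apply/mxOverP => i k; rewrite mxE; exact: hR.
  have DTO : D^T \is a mxOver O by apply/mxOverP => i j; rewrite mxE (mxOverP uD.1).
  have zO : qmap R y *m D^T \is a mxOver O by rewrite mxOverM.
  apply/mxOverP => i l; rewrite mul_mx_diag mxE !ord1 [sU _ _]mxE; case: ifP => ls; last first.
    by rewrite mulr1 (mxOverP zO).
  have /eqP : red ((qmap R y *m D^T) 0 l) == 0.
    have -> : red ((qmap R y *m D^T) 0 l) = redm (qmap R y *m D^T) 0 l by rewrite [RHS]mxE.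
    rewrite (red_mulmx redD redM) //.
    have -> : (redm (qmap R y) *m redm D^T) 0 l
        = qf (comb (reduced_system red R) (row l (row_ebase C))) (redm y).
      rewrite mxE qf_comb; apply: eq_bigr => k _; rewrite !mxE -DE mxE mulrC.
      by rewrite (qf_reduced redD redM).
    apply/eqP; apply: h; first exact: row_ebase_sub.
    rewrite /y (red_mulmx redD redM) ?uB.1 // BE mulmx_sum_row.
    apply: summx_sub => i1 _; have [iw|iw] := ltnP i1 w.
      by rewrite scalemx_sub // row_ebase_sub.
    have -> : redm (x *m diag_mx (step_row n w p)) 0 i1 = 0.
      rewrite mxE mul_mx_diag mxE mxE ltnNge iw /= redM ?(mxOverP hx) ?(pow_ideal_vring hp) //.
      by apply/eqP; rewrite mulf_eq0 orbC (red_eq0 redE redD) ?(pow_ideal_vring hp) // hp.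
    by rewrite scale0r sub0mx.
  move/eqP; rewrite (red_eq0 redE redD) ?(mxOverP zO) //.
  by rewrite pow_idealE expr1.
have := hmin T' U' T'u U'u int'.
have nz m (A : 'M[K]_m) : A \in unitmx -> \det A != 0 by rewrite unitmxE unitfE.
have T0 := nz _ _ Tu; have U0 := nz _ _ Uu; have B0 := nz _ _ Bu; have D0 := nz _ _ Du.
rewrite /lattice_weight /T' /U' !det_mulmx dU det_step ?rank_leq_row // det_tr.
rewrite !lvalM ?mulf_neq0 ?expf_neq0 // (unimodular_val uB) (unimodular_val uD).
rewrite !(valuationX (@lvalM _ _ v)) // (valuationV (@lvalM _ _ v)) // lval_unif.
have wn : (w <= n)%N by exact: rank_leq_row.
rewrite mulNrn !natz -(ler_nat int) !natrM !natz -!subzn //.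
move: (v _) (v _) => a b; rewrite !PoszM; clear; move: (n) (r) (s) (w) => n' r' s' w' le.
lra.
Qed.

End MinimalPair.

Theorem padic_zero (K : fieldType) (q : nat) (v : local_field K q) n r (Q : 'I_r -> 'M[K]_n) :
  (0 < n)%N -> (0 < r)%N ->
  (forall n1 r1 (Q1 : 'I_r1 -> 'M[K]_n1), (r1 < r)%N -> (n1 <= n)%N -> (n * r1 < r * n1)%N ->
     exists2 x, x != 0 & forall k, qf (Q1 k) x = 0) ->
  (forall (F : finFieldType) (QF : 'I_r -> 'M[F]_n), #|F| = q -> semistable QF ->
     exists x, (forall k, qf (QF k) x = 0) /\ forall c, c != 0 -> x *m pol (comb QF c) != 0) ->
  exists2 x, x != 0 & forall k, qf (Q k) x = 0.
Proof.
move=> n0 r0 IH loc; apply: NNPP => no.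
have [c c0 hQ] := integral_scaling v Q.
pose Q' k := c *: Q k; have QE k x : qf (Q' k) x = c * qf (Q k) x.
  by rewrite /qf -scalemxAr -scalemxAl mxE.
have aniso x : (forall k, qf (Q' k) x = 0) -> x = 0.
  move=> h; apply/eqP; apply: contra_notT no => x0; exists x => // k.
  by have /eqP := h k; rewrite QE mulf_eq0 (negbTE c0) => /eqP.
have [B hB] := pair_bound n0 r0 hQ aniso IH.
pose P (TU : 'M[K]_n * 'M[K]_r) := [/\ TU.1 \in unitmx, TU.2 \in unitmx & integral_pair v Q' TU.1 TU.2].
have [||[T U] [/= Tu Uu hTU] hmin] := @int_minimum _ P (fun TU => lattice_weight v TU.1 TU.2) B.
- exists (1%:M, 1%:M); split; rewrite /= ?unitmx1 // => x hx; rewrite !mulmx1.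
  by apply/mxOverP => i k; rewrite mxE; exact: hQ.
- by case=> T U [/= Tu Uu hTU]; exact: hB.
have [F [red [lift [Fq liftP redE redD [red1 redM]]]]] := residue_field v.
have hss : semistable (reduced_system red (transform Q' T U)).
  apply: (minimal_semistable liftP redE redD red1 redM Tu Uu hTU) => T' U' T'u U'u h.
  by apply: (hmin (T', U')).
have [x [xz xns]] := loc F _ Fq hss.
have hR : integral_system v (transform Q' T U).
  move=> k y hy; have := hTU y hy; rewrite -qmap_transform => /mxOverP/(_ 0 k).
  by rewrite mxE.
have [y y0 yz] := nonsingular_lift liftP redE redD red1 redM r0 hR xz xns.
have /aniso yT : forall k, qf (Q' k) (y *m T) = 0.
  apply/qmap_eq0; have /qmap_eq0 := yz; rewrite qmap_transform => e.
  by rewrite -[qmap _ _](mulmxK Uu) e mul0mx.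
by move/negP: y0; apply; rewrite -[y](mulmxK Tu) yT mul0mx.
Qed.

(** * Common zeros *)

Definition locally_solvable q n r := forall (F : finFieldType) (Q : 'I_r -> 'M[F]_n),
  #|F| = q -> semistable Q ->
  exists x, (forall k, qf (Q k) x = 0) /\ forall c, c != 0 -> x *m pol (comb Q c) != 0.

Lemma empty_system_zero (K : fieldType) n (Q : 'I_0 -> 'M[K]_n) : (0 < n)%N ->
  exists2 x : 'rV_n, x != 0 & forall k, qf (Q k) x = 0.
Proof.
move=> n0; exists (const_mx 1); last by case.
by apply/eqP => /rowP/(_ (Ordinal n0)); rewrite !mxE; apply/eqP/oner_neq0.
Qed.

(** The pairs with [n / r] at least [N / R] are stable under the induction of [padic_zero], which
    passes to [n1 / r1 > n / r]. *)
Lemma zero_of_locally_solvable (K : fieldType) q (v : local_field K q) N R : (0 < R)%N ->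
  (forall n r, (0 < r <= R)%N -> (n <= N)%N -> (N * r <= n * R)%N -> locally_solvable q n r) ->
  forall r n (Q : 'I_r -> 'M[K]_n), (0 < n <= N)%N -> (r <= R)%N -> (N * r <= n * R)%N ->
  exists2 x, x != 0 & forall k, qf (Q k) x = 0.
Proof.
move=> R0 loc r; elim/ltn_ind: r => -[|r] IH n Q /andP[n0 nN] rR ratio.
  exact: empty_system_zero.
apply: (padic_zero v Q n0 (ltn0Sn r)); last by move=> F QF; apply: loc.
move=> n1 r1 Q1 r1r n1n lt; apply: IH => //.
- by rewrite (leq_trans n1n nN) andbT; case: n1 lt {n1n Q1} => //; rewrite muln0.
- exact: leq_trans (ltnW r1r) rR.
rewrite -(leq_pmul2r (ltn0Sn r)); nia.
Qed.

(** From [n >= N r / R > 4 r] the condition on the number of variables is inherited, and the sums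
    only decrease. *)
Lemma locally_solvable_of_sum q N R : (0 < R)%N -> (4 * R + 1 <= N)%N -> (N < q)%N ->
  rank_sum q N R + singular_sum q N R < 1 ->
  forall n r, (0 < r <= R)%N -> (n <= N)%N -> (N * r <= n * R)%N -> locally_solvable q n r.
Proof.
move=> R0 hN Nq lt1 n r /andP[r0 rR] nN ratio F Q Fq hss.
have rn : (4 * r + 1 <= n)%N by nia.
have n0 : (0 < n)%N by apply: leq_trans rn; rewrite addn1.
apply: nonsingular_zero => //; rewrite Fq; first exact: leq_ltn_trans Nq.
apply: le_lt_trans lt1; apply: lerD.
  exact: rank_sum_ratio_mono.
exact: singular_sum_ratio_mono.
Qed.

(** Variables beyond [m] are set to zero. For [(2 r) ^ r <= q] this brings [n] down to [4 r + 1],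
    which secures [n < q]. *)
Lemma common_zero_restrict (K : fieldType) n m r (Q : 'I_r -> 'M[K]_n) : (m <= n)%N ->
  (forall Q1 : 'I_r -> 'M[K]_m, exists2 x, x != 0 & forall k, qf (Q1 k) x = 0) ->
  exists2 x, x != 0 & forall k, qf (Q k) x = 0.
Proof.
move=> mn h; pose P : 'M[K]_(m, n) := pid_mx m.
have [x x0 xz] := h (fun k => P *m Q k *m P^T).
exists (x *m P) => [|k]; last by rewrite -[RHS](xz k) /qf trmx_mul !mulmxA.
apply: contra x0 => /eqP e; rewrite -[x]mulmx1 -pid_mx_1.
by rewrite -(pid_mx_id _ m m mn) mulmxA e mul0mx.
Qed.

Lemma common_nontrivial_zeroP (K : fieldType) n r (Q : 'I_r -> 'M[K]_n) :
  (exists2 x, x != 0 & forall k, qf (Q k) x = 0) -> common_nontrivial_zero Q.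
Proof.
move=> [x /rV0Pn x0 xz]; exists (x 0); split=> // k.
by rewrite -(xz k) qf_sum.
Qed.

Theorem theorem1 (K : fieldType) (v : K -> int) (q : nat) (hK : padic_field v q)
    (n r : nat) (Q : 'I_r -> 'M[K]_n) (hn : (4 * r + 1 <= n)%N) :
  ((2 * r) ^ r <= q)%N \/
  ((n < q)%N /\ sigma1 q n r + sigma2 q n r < 1) ->
  common_nontrivial_zero Q.
Proof.
move=> hq; apply: common_nontrivial_zeroP; have [w _] := normalized_local_field hK.
have n0 : (0 < n)%N by apply: leq_trans hn; rewrite addn1.
have [r0|r0] := posnP r; first by move: Q {hn hq}; rewrite r0 => Q; exact: empty_system_zero.
case: hq => [hq|[nq lt1]]; last first.
  apply: (zero_of_locally_solvable w r0 (locally_solvable_of_sum r0 hn nq _)) => //;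
    last by rewrite n0 leqnn.
  have q0 : (0 < q)%N by exact: ltn_trans nq.
  apply: le_lt_trans lt1; rewrite sigma1E // sigma2E // lerD2r lerDr.
  by rewrite exprz_ge0.
(* For [r = 1] the hypothesis only says [q >= 2], so [n < q] may fail and the direct count for one
   form is used. *)
have [r1|r2] := leqP r 1.
  have rE : r = 1%N by apply/eqP; rewrite eqn_leq r1 r0.
  move: Q; rewrite rE in hn * => Q.
  apply: (@zero_of_locally_solvable _ _ w n 1) => // [n1 r2|]; last by rewrite n0 leqnn.
  move=> /andP[r20 r21] n1n; have -> : r2 = 1%N by apply/eqP; rewrite eqn_leq r21 r20.
  rewrite !muln1 => nn1 F Q1 _; apply: nonsingular_zero_single_form; exact: leq_trans nn1.
apply: (@common_zero_restrict K n (4 * r + 1) r Q hn) => Q1.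
have nq := large_residue_field r2 hq.
apply: (zero_of_locally_solvable w r0 (locally_solvable_of_sum r0 (leqnn _) nq _)) => //.
  exact: large_residue_field_sum.
by rewrite addn1 /=.
Qed.
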